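(* Let a finite-horizon MDP, reference measures $\mu_h$, basis functions $\boldsymbol{\gamma}_K=(\gamma_1,\dots,\gamma_K)^\top$, and the random approximations $V_{h,N}$ of the optimal value functions $V_h^\star$ be as described in the context, and suppose that the structural assumptions (A1)--(A4) stated in the context hold. Suppose moreover that $\mathbb{E}_{X\sim\mu_h}[|\boldsymbol{\gamma}_K(X)|^2]\le \varrho_{\gamma,K}^2$ for all $h\in\{0,\dots,H-1\}$. Then there is an absolute constant $C>0$ such that for every $h\in\{0,1,\dots,H\}$, $$ \Vert V_h^\star-V_{h,N}\Vert_{L^2(\mu_h\otimes\mathsf{P})}\le C\,\mathfrak{R}^{\max}\left((H-h)\,\varrho_{\gamma,K}\Lambda_K\bigl(L_{V,K}L_{\mathcal K}I_{\mathcal D}(\mathsf A)+L_{V,K}L_{\mathcal K}\mathsf D(\mathsf A)+V_{\max}^\star\bigr)\sqrt{\frac{K}{N}}+\sum_{l=h}^{H-1}\mathcal{R}_{K,l}\right), $$ where $L_{V,K}:=L_R+V_{\max}^\star\Lambda_K L_{\gamma,K}\sqrt K$, and where for $0\le h<H$ $$ \mathcal{R}_{K,h}:=\sup_{\boldsymbol\zeta\in\mathbb{R}^{K\times|\mathsf A|}}\mathbb{E}_{X\sim\mu_h}\left[\sup_{a\in\mathsf A}\left(\beta_{a,\boldsymbol\zeta}^\top\boldsymbol\gamma_K(X)-P_{h+1}^aV_{h+1,\boldsymbol\zeta}(X)\right)^2\right]^{1/2}, $$ $$ \beta_{a,\boldsymbol\zeta}:=\operatorname*{arg\,inf}_{\beta\in\mathbb{R}^K}\mathbb{E}_{X\sim\mu_h}\left[\left(\beta^\top\boldsymbol\gamma_K(X)-P_{h+1}^aV_{h+1,\boldsymbol\zeta}(X)\right)^2\right],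 $$ with $V_{h,\boldsymbol\zeta}(x):=\sup_{a\in\mathsf A}\bigl(R_h(x,a)+\mathcal T_{\widetilde L_{h+1}}[\zeta_a^\top\boldsymbol\gamma_K](x)\bigr)$ for $0\le h<H$ and $V_{H,\boldsymbol\zeta}(x):=F(x)$. Here $\boldsymbol\zeta=(\zeta_a)_{a\in\mathsf A}$ with $\zeta_a\in\mathbb{R}^K$ for each $a$ ($\mathsf A$ may be infinite).
   Context: **MDP.** $\mathsf S$ (states) and $\mathsf A$ (actions) are measurable spaces, finite or infinite; $H\ge1$ is the horizon; $P_h(\cdot|x,a)$, $h=1,\dots,H$, are transition kernels from $\mathsf S\times\mathsf A$ to $\mathsf S$; $R_h:\mathsf S\times\mathsf A\to\mathbb R$, $h=0,\dots,H-1$, are rewards; $F:\mathsf S\to\mathbb R$ is the terminal reward. A policy is $\boldsymbol\pi=(\pi_0,\dots,\pi_{H-1})$ with $\pi_t:\mathsf S\to\mathcal P(\mathsf A)$ (probability measures on $\mathsf A$; a deterministic policy is identified with a map $\mathsf S\to\mathsf A$). Under $\boldsymbol\pi$, $A_t\sim\pi_t(S_t)$ and $S_{t+1}\sim P_{t+1}(\cdot|S_t,A_t)$. The optimal value functions are $V_h^\star(x):=\sup_{\boldsymbol\pi}\mathbb E_{\boldsymbol\pi}\bigl[\sum_{t=h}^{H-1}R_t(S_t,A_t)+F(S_H)\,|\,S_h=x\bigr]$; they satisfy $V_H^\star=F$ and $V_h^\star(x)=\sup_{a\in\mathsf A}(R_h(x,a)+P_{h+1}^aV_{h+1}^\star(x))$,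 where $P_{h+1}^aV(x):=\mathbb E_{S'\sim P_{h+1}(\cdot|x,a)}[V(S')]$. Suprema over uncountable families of random variables are understood as essential suprema. $|\cdot|$ is the Euclidean norm and $|\cdot|_\infty$ the $\ell_\infty$ norm. **Assumptions.** (A1) There are a measurable space $\mathsf E$, a probability measure $\mathcal P_{\mathsf E}$ on it, and measurable maps $\mathcal K_h:\mathsf S\times\mathsf A\times\mathsf E\to\mathsf S$, such that the chain is $S_t=\mathcal K_t(S_{t-1},a_{t-1},\varepsilon_t)$ with $\varepsilon_t$ i.i.d. $\sim\mathcal P_{\mathsf E}$; thus $P_h^af(x)=\mathbb E_{\varepsilon\sim\mathcal P_{\mathsf E}}[f(\mathcal K_h(x,a,\varepsilon))]$. Moreover $\mathsf S,\mathsf A$ carry metrics $\rho_{\mathsf S},\rho_{\mathsf A}$, $\mathsf S\times\mathsf A$ carries the metric $\rho((x,a),(x',a'))=\Vert(\rho_{\mathsf S}(x,x'),\rho_{\mathsf A}(a,a'))\Vert$ for a fixed norm on $\mathbb R^2$, and for a constant $L_{\mathcal K}$ independent of $h$, $\rho_{\mathsf S}(\mathcal K_h(x,a,\varepsilon),\mathcal K_h(x',a',\varepsilon))\le L_{\mathcal K}\,\rho((x,a),(x',a'))$ for all $(x,a),(x',a'),\varepsilon$. (A2) $|R_h(x,a)|\le R_{\max}$ and $|F(x)|\le R_{\max}$ for all $x,a,h$, and $\sup_{a}|R_h(x,a)-R_h(x',a)|\le L_R\,\rho_{\mathsf S}(x,x')$, with $R_{\max},L_R$ independent of $h$. (A3)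 $|\Sigma_{h,K}^{-1}\boldsymbol\gamma_K(x)|_\infty\le\Lambda_K$ for all $x\in\mathsf S$, $h\in\{0,\dots,H-1\}$, and $|\boldsymbol\gamma_K(x)-\boldsymbol\gamma_K(x')|\le L_{\gamma,K}\,\rho_{\mathsf S}(x,x')$ with $L_{\gamma,K}>0$, where $\gamma_k:\mathsf S\to\mathbb R$ and $\Sigma_{h,K}:=\mathbb E_{X\sim\mu_h}[\boldsymbol\gamma_K(X)\boldsymbol\gamma_K^\top(X)]$ is invertible. (A4) The $\mu_h$ are probability measures on $\mathsf S$ such that $P_h(\cdot|x,a)$ is absolutely continuous w.r.t. $\mu_h$ for all $h\in\{1,\dots,H\}$, $x$, $a$. Writing $P_{h+1}^{\pi_h}(dx'|x):=P_{h+1}(dx'|x,\pi_h(x))$ (averaged over $a\sim\pi_h(x)$ if $\pi_h$ is randomized), composing kernels, and setting $\mathfrak R_{h,l}(x'|x,\boldsymbol\pi):=\dfrac{P_{h+1}^{\pi_h}\cdots P_l^{\pi_{l-1}}(dx'|x)}{\mu_l(dx')}$ for $h<l$, one has $$\mathfrak R^{\max}:=\sup_{0\le h<l<H,\ \boldsymbol\pi}\Bigl(\int\mu_h(dx)\int\mathfrak R_{h,l}^2(x'|x,\boldsymbol\pi)\,\mu_l(dx')\Bigr)^{1/2}<\infty.$$ **Constants.** $\widetilde L_h:=(H-h+1)R_{\max}$, $V_{\max}^\star:=\widetilde L_0=(H+1)R_{\max}$. Truncation: $\mathcal T_L[g](x):=\max(-L,\min(L,g(x)))$. **Algorithm.**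 Draw independent pairs $(X_i^h,\varepsilon_i^h)\sim\mu_h\otimes\mathcal P_{\mathsf E}$, $h=0,\dots,H-1$, $i=1,\dots,N$; $\mathsf P$ is their joint law. Set $V_{H,N}:=F$ and, backwards for $h=H-1,\dots,0$, $$V_{h,N}(x):=\sup_{a\in\mathsf A}\bigl(R_h(x,a)+\mathcal T_{\widetilde L_{h+1}}[\beta_{N,a}^\top\boldsymbol\gamma_K](x)\bigr),\qquad \beta_{N,a}:=\frac1N\sum_{i=1}^N V_{h+1,N}(Y_i^a)\,\Sigma_{h,K}^{-1}\boldsymbol\gamma_K(X_i^h),$$ with $Y_i^a:=\mathcal K_{h+1}(X_i^h,a,\varepsilon_i^h)$. **Metric quantities.** For a metric space $(\mathsf X,\rho)$: $\mathsf D(\mathsf X)$ is its diameter, $\mathcal N(\mathsf X,\rho,u)$ the smallest number of $\rho$-balls of radius $u$ covering $\mathsf X$, and $I_{\mathcal D}(\mathsf X):=\int_0^{\mathsf D(\mathsf X)}\sqrt{\log\mathcal N(\mathsf X,\rho,u)}\,du$ (Dudley integral). For $\mathsf A$ the metric is $\rho_{\mathsf A}$.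
   Formalization: The terminal reward F is also assumed L_R-Lipschitz (the claim is false otherwise); the constant C may depend on the fixed norm on R^2 used in (A1); for H=1, where the supremum defining R^max is over an empty set, R^max is taken to be 1. *)

(* Defs.v *)
(* MathComp-Analysis *)
Set Warnings "-notation-overridden,-ambiguous-paths,-notation-incompatible-prefix".
From HB Require Import structures.
From mathcomp Require Import all_boot all_order all_algebra.
From mathcomp Require Import all_classical all_reals all_analysis.

Set Implicit Arguments.
Unset Strict Implicit.
Unset Printing Implicit Defensive.

Import Order.TTheory GRing.Theory Num.Theory.
Import numFieldNormedType.Exports.

Local Open Scope classical_set_scope.
Local Open Scope ring_scope.

Section norms_and_metrics.
Context {R : realType}.

Definition is_norm2 (nrm : R -> R -> R) :=
  [/\ forall s t, nrm s t = 0 -> s = 0 /\ t = 0,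
      forall c s t, nrm (c * s) (c * t) = `|c| * nrm s t
    & forall s t s' t', nrm (s + s') (t + t') <= nrm s t + nrm s' t'].

Definition is_metric (X : Type) (rho : X -> X -> R) :=
  [/\ forall x y, rho x y = 0 <-> x = y,
      forall x y, rho x y = rho y x
    & forall x y z, rho x z <= rho x y + rho y z].

(* The canonical norm of a matrix type is the sup norm, hence these. *)
Definition enorm K (v : 'cV[R]_K) : R := Num.sqrt (\sum_i v i ord0 ^+ 2).
Definition maxnorm K (v : 'cV[R]_K) : R := \big[Num.max/0]_i `|v i ord0|.

Definition dotv K (u v : 'cV[R]_K) : R := \sum_i u i ord0 * v i ord0.

Definition trunc (L y : R) : R := Num.max (- L) (Num.min L y).

Local Open Scope ereal_scope.

Definition diameter (X : Type) (rho : X -> X -> R) : \bar R :=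
  ereal_sup [set r | exists x y, r = (rho x y)%:E].

(* +oo when no finite cover exists *)
Definition covering_number (X : Type) (rho : X -> X -> R) (u : R) : \bar R :=
  ereal_inf [set r | exists n (c : 'I_n -> X),
    (forall x, exists i, (rho (c i) x < u)%R) /\ r = n%:R%:E].

Definition dudley (X : Type) (rho : X -> X -> R) : \bar R :=
  \int[@lebesgue_measure R]_(u in [set u : R |
      (0 < u)%R /\ u%:E <= diameter rho])
    sqrte (lne (covering_number rho u)).

End norms_and_metrics.

(* Essential supremum of a family (f_i), taken among the functions that are
   measurable for a sub-sigma-algebra F.  It is unique up to a mu-null set;
   [esssup] picks a version.  (The library's [ess_sup mu f] is the essential
   supremum of a single function, a number.) *)
Section essential_supremum_of_a_family.
Context {d} {T : measurableType d} {R : realType}.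
Variable mu : {measure set T -> \bar R}.

Definition measurable_wrt (F : set (set T)) (g : T -> R) :=
  forall B : set R, measurable B -> F (g @^-1` B).

Definition is_esssup (F : set (set T)) (I : Type) (f : I -> T -> R)
    (g : T -> R) :=
  [/\ measurable_wrt F g,
      forall i, {ae mu, forall x, f i x <= g x}
    & forall g', measurable_wrt F g' ->
        (forall i, {ae mu, forall x, f i x <= g' x}) ->
        {ae mu, forall x, g x <= g' x}].

Definition esssup (F : set (set T)) (I : Type) (f : I -> T -> R) : T -> R :=
  xget (fun=> 0) [set g | is_esssup F f g].

End essential_supremum_of_a_family.

(* Markov kernels are stable under the two compositions of the library. *)
Section kernel_composition.
Context {d1 d2 d3} {X : measurableType d1} {Y : measurableType d2}
  {Z : measurableType d3} {R : realType}.
Local Open Scope ereal_scope.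

Section parameterized.
Variables (l : R.-pker X ~> Y) (k : R.-pker (X * Y) ~> Z).

Definition pkcomp : X -> {measure set Z -> \bar R} := mkcomp l k.

HB.instance Definition _ := Kernel.on pkcomp.

Let pkcomp_setT x : pkcomp x setT = 1.
Proof.
rewrite /pkcomp /mkcomp /= /kcomp.
under eq_integral do rewrite prob_kernel.
by rewrite integral_cst//= mul1e prob_kernel.
Qed.

HB.instance Definition _ :=
  Kernel_isProbability.Build _ _ X Z R pkcomp pkcomp_setT.

End parameterized.

Section unparameterized.
Variables (l : R.-pker X ~> Y) (k : R.-pker Y ~> Z).

Definition pkcomp_noparam : X -> {measure set Z -> \bar R} :=
  mkcomp_noparam l k.

HB.instance Definition _ := Kernel.on pkcomp_noparam.

Let pkcomp_noparam_setT x : pkcomp_noparam x setT = 1.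
Proof.
rewrite /pkcomp_noparam /mkcomp_noparam /= /kcomp_noparam.
under eq_integral do rewrite prob_kernel.
by rewrite integral_cst//= mul1e prob_kernel.
Qed.

HB.instance Definition _ :=
  Kernel_isProbability.Build _ _ X Z R pkcomp_noparam pkcomp_noparam_setT.

End unparameterized.

Section pointwise.
Variables (k : R.-pker X ~> Y) (x : X).

Definition kernel_at : set Y -> \bar R := k x.

HB.instance Definition _ := Measure.on kernel_at.

Let kernel_at_setT : kernel_at setT = 1.
Proof. exact: prob_kernel. Qed.

HB.instance Definition _ :=
  Measure_isProbability.Build _ _ _ kernel_at kernel_at_setT.

End pointwise.

End kernel_composition.

Record mdp {dS dA} (S : measurableType dS) (A : measurableType dA)
    (R : realType) := Mdp {
  horizon : nat;
  (* [trans h] is P_h, used for 1 <= h <= horizon;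
     [reward h] is R_h, used for 0 <= h < horizon. *)
  trans : nat -> R.-pker (S * A) ~> S;
  reward : nat -> S * A -> R;
  terminal : S -> R;
  horizon_gt0 : (0 < horizon)%N;
  measurable_reward : forall h, (h < horizon)%N ->
    measurable_fun setT (reward h);
  measurable_terminal : measurable_fun setT terminal }.

Section optimal_values.
Context {dS dA} {S : measurableType dS} {A : measurableType dA} {R : realType}.
Variable M : mdp S A R.
Local Notation H := (horizon M).

(* The t-th component is used for 0 <= t < horizon. *)
Definition policy := nat -> R.-pker S ~> A.

(* Expectation, under the policy pi and given S_t = x, of a functional G of
   the trajectory: G receives the n state-action pairs
   (S_t, A_t), ..., (S_{t+n-1}, A_{t+n-1}) and the state S_{t+n}. *)
Fixpoint traj_expectation (pi : policy) (n t : nat)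
    (G : seq (S * A) -> S -> R) (x : S) : R :=
  if n is n'.+1 then
    \int[pi t x]_a \int[trans M t.+1 (x, a)]_y
      traj_expectation pi n' t.+1 (fun w s => G ((x, a) :: w) s) y
  else G [::] x.

Definition total_reward (h : nat) (w : seq (S * A)) (s : S) : R :=
  \sum_(p <- zip (iota h (size w)) w) reward M p.1 p.2 + terminal M s.

Definition policy_value (pi : policy) (h : nat) (x : S) : R :=
  traj_expectation pi (H - h) h (total_reward h) x.

Definition Vstar (h : nat) (x : S) : R :=
  sup [set policy_value pi h x | pi in [set: policy]].

(* P_h^a V (x) *)
Definition Pop (h : nat) (a : A) (V : S -> R) (x : S) : R :=
  \int[trans M h (x, a)]_y V y.

(* P_{h+1}^{pi_h} *)
Definition step (pi : policy) (h : nat) : R.-pker S ~> S :=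
  pkcomp (pi h) (trans M h.+1).

(* P_{h+1}^{pi_h} ... P_{h+n+1}^{pi_{h+n}} : n + 1 steps starting at time h *)
Fixpoint multistep (pi : policy) (n h : nat) : R.-pker S ~> S :=
  if n is n'.+1 then pkcomp_noparam (step pi h) (multistep pi n' h.+1)
  else step pi h.

End optimal_values.

Record regression {dS} (S : measurableType dS) (R : realType) (K : nat) :=
  Regression {
  ref : nat -> probability S R; (* mu_h *)
  basis : S -> 'cV[R]_K; (* gamma_K *)
  measurable_basis : forall k, measurable_fun setT (fun x => basis x k ord0) }.

Section assumptions.
Context {dS dA dE} {S : measurableType dS} {A : measurableType dA}
  {E : measurableType dE} {R : realType}.
Variable M : mdp S A R.
Local Notation H := (horizon M).

Definition random_map_representation (PE : probability E R)
    (kap : nat -> S * A * E -> S) :=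
  forall h, (0 < h <= H)%N ->
    measurable_fun setT (kap h) /\
    (forall x a B, measurable B ->
      trans M h (x, a) B = PE ((fun e => kap h (x, a, e)) @^-1` B)).

Definition lipschitz_random_map (nrm : R -> R -> R) (rhoS : S -> S -> R)
    (rhoA : A -> A -> R) (kap : nat -> S * A * E -> S) (LK : R) :=
  forall h, (0 < h <= H)%N -> forall x a x' a' e,
    rhoS (kap h (x, a, e)) (kap h (x', a', e)) <=
    LK * nrm (rhoS x x') (rhoA a a').

(* The terminal reward is a reward at time H, and obeys the same Lipschitz
   bound as the others.  Without it the error bound fails: a terminal reward
   that oscillates at arbitrarily small scales makes the maximal regression
   error over the actions exceed anything L_R and the entropy of the action
   space can control. *)
Definition bounded_lipschitz_rewards (rhoS : S -> S -> R) (Rmax LR : R) :=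
  [/\ forall h, (h < H)%N -> forall x a, `|reward M h (x, a)| <= Rmax,
      forall x, `|terminal M x| <= Rmax,
      forall h, (h < H)%N -> forall x x' a,
        `|reward M h (x, a) - reward M h (x', a)| <= LR * rhoS x x'
    & forall x x', `|terminal M x - terminal M x'| <= LR * rhoS x x'].

Context {K : nat}.
Variable D : regression S R K.

(* Sigma_{h,K} *)
Definition gram (h : nat) : 'M[R]_K :=
  \matrix_(i, j) \int[ref D h]_x (basis D x i ord0 * basis D x j ord0).

Definition basis_conditions (rhoS : S -> S -> R) (LamK LgK : R) :=
  [/\ forall h, (h < H)%N -> gram h \in unitmx,
      forall h, (h < H)%N -> forall x,
        maxnorm (invmx (gram h) *m basis D x) <= LamK,
      0 < LgK
    & forall x x', enorm (basis D x - basis D x') <= LgK * rhoS x x'].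

Definition second_moment_bound (vrho : R) :=
  forall h, (h < H)%N ->
    (\int[ref D h]_x (enorm (basis D x) ^+ 2)%:E <= (vrho ^+ 2)%:E)%E.

Definition transitions_dominated :=
  forall h, (0 < h <= H)%N -> forall x a, trans M h (x, a) `<< ref D h.

(* fR_{h,l}( . | x, pi), for h < l *)
Definition policy_density (pi : policy) (h l : nat) (x : S) : S -> \bar R :=
  Radon_Nikodym
    (charge_of_finite_measure (kernel_at (multistep M pi (l - h.+1) h) x))
    (ref D l).

(* fR^max.  When the horizon is 1 there is no pair h < l < H; the value is then
   1, that of the diagonal term h = l, which is a lower bound of the supremum
   for every longer horizon. *)
Definition Rfrak_max : \bar R :=
  if (1 < H)%N then
    ereal_sup [set r | exists h l (pi : policy), (h < l < H)%N /\
      r = sqrte (\int[ref D h]_x \int[ref D l]_y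
                   (policy_density pi h l x y ^+ 2))%E]
  else 1%E.

(* The dynamic programming equation.  As every other supremum over the actions,
   it is an essential supremum. *)
Definition bellman_equation :=
  forall h, (h < H)%N ->
    is_esssup (ref D h) measurable
      (fun a x => reward M h (x, a) + Pop M h.+1 a (Vstar M h.+1) x)
      (Vstar M h).

End assumptions.

Section algorithm.
Context {dS dA dE dO} {S : measurableType dS} {A : measurableType dA}
  {E : measurableType dE} {Omega : measurableType dO} {R : realType}.
Variables (M : mdp S A R) (K : nat) (D : regression S R K) (Rmax : R).
Local Notation H := (horizon M).

Definition Ltilde (h : nat) : R := (H - h).+1%:R * Rmax.

Variables (N : nat) (Pr : probability Omega R).
Variables (X : nat -> 'I_N -> {RV Pr >-> S})
          (eps : nat -> 'I_N -> {RV Pr >-> E}).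
Variables (kap : nat -> S * A * E -> S).

Definition sample_pair (ti : 'I_H * 'I_N) (w : Omega) : S * E :=
  (X ti.1 ti.2 w, eps ti.1 ti.2 w).

(* The pairs (X_i^h, eps_i^h), h < H, have law mu_h \x PE and are mutually
   independent: the product rule for subfamilies is the case in which the
   other B's are the whole space. *)
Definition independent_samples (PE : probability E R) :=
  (forall ti B, measurable B ->
     Pr (sample_pair ti @^-1` B) = (ref D ti.1 \x PE)%E B) /\
  (forall B : 'I_H * 'I_N -> set (S * E), (forall ti, measurable (B ti)) ->
     Pr (\bigcap_ti (sample_pair ti @^-1` B ti)) =
     \big[*%E/1%E]_ti Pr (sample_pair ti @^-1` B ti)).

(* The sigma-algebra on S * Omega generated by x and by the samples of the
   levels h, ..., H - 1.  The random function V_{h,N} is measurable for it; this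
   keeps it independent of the samples of the lower levels, at which it is going
   to be evaluated. *)
Definition samples_from (h : nat) : set (set (S * Omega)) :=
  <<s [set C | exists2 B : set S, measurable B &
          C = (fun z => z.1) @^-1` B \/
          exists t i, (h <= t < H)%N /\ C = (fun z => X t i z.2) @^-1` B]
      `|` [set C | exists2 B : set E, measurable B &
          exists t i, (h <= t < H)%N /\ C = (fun z => eps t i z.2) @^-1` B] >>.

(* beta_{N,a} at level h, computed from the approximation V of level h.+1 *)
Definition betaN (h : nat) (V : S * Omega -> R) (a : A) (w : Omega)
    : 'cV[R]_K :=
  N%:R^-1 *: \sum_(i < N) V (kap h.+1 (X h i w, a, eps h i w), w) *:
                (invmx (gram D h) *m basis D (X h i w)).

Fixpoint VN_back (n : nat) : S * Omega -> R :=
  if n is n'.+1 then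
    let h := (H - n)%N in
    esssup (ref D h \x Pr)%E (samples_from h) (fun a z =>
      reward M h (z.1, a) +
      trunc (Ltilde h.+1) (dotv (betaN h (VN_back n') a z.2) (basis D z.1)))
  else fun z => terminal M z.1.

(* V_{h,N}(x), as a function of x and of the random outcome *)
Definition VN (h : nat) : S * Omega -> R := VN_back (H - h).

End algorithm.

Section approximation_error.
Context {dS dA} {S : measurableType dS} {A : measurableType dA} {R : realType}.
Variables (M : mdp S A R) (K : nat) (D : regression S R K) (Rmax : R).
Local Notation H := (horizon M).

Definition Vzeta (h : nat) (zeta : A -> 'cV[R]_K) : S -> R :=
  if (h < H)%N then
    esssup (ref D h) measurable (fun a x =>
      reward M h (x, a) +
      trunc (Ltilde M Rmax h.+1) (dotv (zeta a) (basis D x)))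
  else terminal M.

Definition regression_risk (h : nat) (V : S -> R) (a : A) (b : 'cV[R]_K)
    : \bar R :=
  (\int[ref D h]_x ((dotv b (basis D x) - Pop M h.+1 a V x) ^+ 2)%:E)%E.

(* beta_{a,zeta}: the minimizer of the risk *)
Definition betaZ (h : nat) (zeta : A -> 'cV[R]_K) (a : A) : 'cV[R]_K :=
  xget 0 [set b | forall b',
    (regression_risk h (Vzeta h.+1 zeta) a b <=
     regression_risk h (Vzeta h.+1 zeta) a b')%E].

(* calR_{K,h} *)
Definition approx_error (h : nat) : \bar R :=
  ereal_sup [set r | exists zeta : A -> 'cV[R]_K,
    r = sqrte (\int[ref D h]_x
          (esssup (ref D h) measurable (fun a y =>
             (dotv (betaZ h zeta a) (basis D y)
              - Pop M h.+1 a (Vzeta h.+1 zeta) y) ^+ 2) x)%:E)%E].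

End approximation_error.

(* Main.v *)
Require Import Defs.
Set Warnings "-notation-overridden,-ambiguous-paths,-notation-incompatible-prefix".
From HB Require Import structures.
From mathcomp Require Import all_boot all_order all_algebra.
From mathcomp Require Import all_classical all_reals all_analysis.
From mathcomp Require Import measurable_realfun ring lra.

Set Implicit Arguments.
Unset Strict Implicit.
Unset Printing Implicit Defensive.

Import Order.TTheory GRing.Theory Num.Theory.
Import numFieldNormedType.Exports.

Local Open Scope classical_set_scope.
Local Open Scope ring_scope.

(** The error at time h is compared with the errors that the algorithm makes at
    the times l >= h. For a fixed outcome of the samples, the gap between the
    optimal value and its approximation satisfies a one-step recursion: it is at
    most the supremum over the actions of the expected gap at the next state, plus
    an error made at time h itself ([gap_recursion]). A deterministic policy that
    nearly attains the suprema unrolls the recursion into a sum of errors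
    propagated by products of transition kernels, and Cauchy-Schwarz against the
    density of such a product brings each of them back to its own reference
    measure, at the price of the factor fR^max ([error_propagation]).

    The error made at time l has two parts. Given the samples of the later times,
    the coefficient computed for the action a is an empirical mean of N
    independent terms. Its expectation is the least-squares projection of the
    conditional expectation of the next approximation ([beta_meanE]), that is, the
    coefficient beta_(a,zeta) for the zeta made of the coefficients at time l + 1
    ([betaZ_coefs]). The residual of this projection is therefore bounded by the
    approximation error ([max_residual_L2]). The other part is the deviation of
    the empirical mean, uniformly in the action. As a process indexed by the
    actions it has sub-Gaussian increments of order L_V L_K rhoA(a, a') / sqrt N,
    because the approximations are Lipschitz in the state for every outcome
    ([Vt_lipschitz]); chaining bounds its supremum by the entropy integral and the
    diameter ([chaining_bound], [noise_envelope]). Chaining stops after N halvings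
    of the radius, where the Lipschitz bound of each outcome takes over. Norms are
    finally taken over the outcomes, by the triangle inequality ([expected_gap]).

    Essential suprema over an uncountable action space are versions, fixed up to
    null sets, and a null set in the state variable cannot be carried through the
    point-by-point argument above. One therefore fixes at each time a countable
    set of actions that is dense and along which the rewards and the optimal
    values are almost surely approximated ([exists_skeleton]), and runs both
    recursions with suprema over that set. The optimal values agree almost
    everywhere with the first ([Vstar_eq_Vh]) and the algorithm with the second
    ([VN_eq_Vt]). The latter uses that the next states of the samples are
    independent of the later samples and have a law dominated by the next
    reference measure, so that they avoid null sets ([null_next_state]). *)

(** * Elementary inequalities *)

Section elementary_inequalities.
Context {R : realType}.
Implicit Types x y t w B T l : R.

(** A crude form of Hoeffding's lemma for a fair sign: the exponent is four times
    the optimal one, which keeps the proof elementary. *)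
Lemma expR_cosh_le t : expR t + expR (- t) <= 2 * expR (2 * t ^+ 2).
Proof.
wlog t0 : t / 0 <= t => [wl|].
  have [|/ltW t0] := leP 0 t; first exact: wl.
  by rewrite addrC -[t in leRHS]opprK sqrrN -{2}[t]opprK wl// oppr_ge0.
have [t12|t12] := leP t (2^-1).
  have v0 := expR_gt0 (- t).
  have v1 : 1 - t <= expR (- t) by exact: expR_ge1Dx.
  have v2 : expR (- t) <= 1 by rewrite -expR0 ler_expR oppr_le0.
  have e2 : 1 + 2 * t ^+ 2 <= expR (2 * t ^+ 2) by exact: expR_ge1Dx.
  have -> : expR t = (expR (- t))^-1 by rewrite expRN invrK.
  move: v0 v1 v2; set v := expR (- t) => v0 v1 v2.
  apply: (@le_trans _ _ (2 * (1 + 2 * t ^+ 2))); last by rewrite ler_pM2l.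
  rewrite -(ler_pM2r v0) mulrDl mulVf ?gt_eqF//.
  nra.
have le_sqr : t <= 2 * t ^+ 2 by nra.
by rewrite mulr2n mulrDl !mul1r lerD// ler_expR//; nra.
Qed.

(** Convexity of the exponential puts its graph over [-B, B] below the chord;
    the linear term has mean zero for a centred variable. *)
Lemma expR_le_chord l w B : 0 < B -> `|w| <= B ->
  expR (l * w) <= expR (2 * (l * B) ^+ 2)
                  + w * ((expR (l * B) - expR (- (l * B))) / (2 * B)).
Proof.
move=> B0 wB.
have Bn0 : B != 0 by rewrite gt_eqF.
move: wB; rewrite ler_norml => /andP[wB1 wB2].
have p01 : 0 <= (B - w) / (2 * B) <= 1.
  by rewrite divr_ge0/= ?ler_pdivrMr ?subr_ge0 ?mulr_ge0 ?mulr_gt0//; lra.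
pose p : {i01 R} := Itv01 (andP p01).1 (andP p01).2.
have := convex_expR p (- (l * B) : R^o) (l * B : R^o).
rewrite !convRE/= /unstable.onem.
have -> : (B - w) / (2 * B) * - (l * B) + (1 - (B - w) / (2 * B)) * (l * B) =
    l * w by field.
move=> /le_trans; apply.
have := expR_cosh_le (l * B).
set e := expR (l * B); set e' := expR (- _) => ee.
have -> : (B - w) / (2 * B) * e' + (1 - (B - w) / (2 * B)) * e =
  (e + e') / 2 + w * ((e - e') / (2 * B)) by field.
by rewrite lerD2r ler_pdivrMr// mulrC.
Qed.

(** A square is dominated by its truncation at level T plus an exponential
    tail; the bound is what turns moment generating functions into a maximal
    inequality for second moments. *)
Lemma sqr_le_expR x T l : 0 < l -> 0 <= T ->
  x ^+ 2 <= 2 * T ^+ 2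
            + 8 / l ^+ 2 * expR (- (l * T)) * (expR (l * x) + expR (- l * x)).
Proof.
move=> l0 T0.
wlog x0 : x / 0 <= x => [wl|].
  have [|/ltW x0] := leP 0 x; first exact: wl.
  have := wl (- x); rewrite oppr_ge0 => /(_ x0).
  by rewrite sqrrN !mulNr !mulrN opprK [expR (- _) + _]addrC.
have ln0 : l != 0 by rewrite gt_eqF.
have := expR_gt0 (- (l * T)); have := expR_gt0 (l * x).
have := expR_gt0 (- l * x).
have e : expR (- (l * T)) * expR (l * x) = expR (l * x - l * T).
  by rewrite -expRD addrC.
have [xT|/ltW xT] := leP x T.
  move=> p1 p2 p3; apply: (@le_trans _ _ (2 * T ^+ 2)); first nra.
  by rewrite lerDl !mulr_ge0 ?addr_ge0 ?invr_ge0 ?sqr_ge0 ?ltW.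
move=> p1 p2 p3.
set v := l * x - l * T in e *.
have v0 : 0 <= v by rewrite /v -mulrBr mulr_ge0 ?subr_ge0// ltW.
have ev : v ^+ 2 <= 4 * expR v.
  have h : 1 + v / 2 <= expR (v / 2) by exact: expR_ge1Dx.
  have -> : expR v = expR (v / 2) ^+ 2.
    by rewrite expr2 -expRD; congr expR; field.
  nra.
apply: (@le_trans _ _ (2 * T ^+ 2 + 8 / l ^+ 2 * expR v)); last first.
  rewrite lerD2l -e -!mulrA ler_wpM2l// ler_wpM2l ?invr_ge0 ?sqr_ge0//.
  by apply: ler_wpM2l; [exact: ltW|rewrite lerDl ltW].
have -> : x = T + v / l by rewrite /v; field.
apply: (@le_trans _ _ (2 * T ^+ 2 + 2 * (v / l) ^+ 2)).
  have := sqr_ge0 (T - v / l); rewrite !sqrrB sqrrD; lra.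
rewrite lerD2l expr_div_n.
rewrite [leRHS](_ : _ = 2 * ((4 * expR v) / l ^+ 2)); last by field.
by rewrite ler_wpM2l// ler_wpM2r ?invr_ge0 ?sqr_ge0.
Qed.

(** Halving the radius n times brings it below the order of the noise. *)
Lemma inv2X_le_inv_sqrt n : (0 < n)%N -> 2^-1 ^+ n <= (Num.sqrt n%:R)^-1 :> R.
Proof.
move=> n0; rewrite exprVn lef_pV2 ?posrE ?exprn_gt0 ?sqrtr_gt0 ?ltr0n//.
rewrite -(@ger0_norm _ (2 ^+ n)) ?exprn_ge0// -sqrtr_sqr ler_wsqrtr//.
rewrite -exprM -natrX ler_nat (leq_trans (ltnW (ltn_expl n (isT : 1 < 2)%N)))//.
by rewrite leq_exp2l// leq_pmulr.
Qed.

End elementary_inequalities.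

(** * Square-integrable bounds *)

Section nonmeasurable_monotonicity.
Context {d} {T : measurableType d} {R : realType}.
Variable mu : {measure set T -> \bar R}.
Local Open Scope ereal_scope.

(** The integral of a nonnegative function is a supremum over the simple
    functions below it, so monotonicity does not see measurability. *)
Lemma le_integral_nonmeasurable (f g : T -> \bar R) :
  (forall x, 0 <= f x) -> (forall x, f x <= g x) ->
  \int[mu]_x f x <= \int[mu]_x g x.
Proof.
move=> f0 fg; have g0 x : 0 <= g x by exact: le_trans (fg x).
rewrite !ge0_integralTE//; apply: ereal_sup_le => _ [h hf <-]; exists h => //.
by move=> x; exact: le_trans (fg x).
Qed.

End nonmeasurable_monotonicity.

Section L2_bounds.
Context {d} {T : measurableType d} {R : realType}.
Variable mu : {measure set T -> \bar R}.

(** Measurability and the sign of the bound are bundled, so that norm bounds can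
    be added and scaled without side conditions. *)
Definition L2_le (f : T -> R) (b : R) :=
  [/\ measurable_fun setT f, 0 <= b
    & (\int[mu]_x (f x ^+ 2)%:E <= (b ^+ 2)%:E)%E].

Lemma measurable_sqr_EFin (f : T -> R) : measurable_fun setT f ->
  measurable_fun setT (fun x => (f x ^+ 2)%:E).
Proof. by move=> mf; apply/measurable_EFinP; exact: measurable_funX. Qed.

Lemma ge0_sqr_EFin (f : T -> R) x : (0 <= (f x ^+ 2)%:E)%E.
Proof. by rewrite lee_fin sqr_ge0. Qed.

Lemma L2_le_mono (f g : T -> R) b : measurable_fun setT f ->
  (forall x, `|f x| <= `|g x|) -> L2_le g b -> L2_le f b.
Proof.
move=> mf fg [mg b0 gb]; split => //; apply: le_trans gb.
apply: ge0_le_integral => //.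
- by move=> x _; exact: ge0_sqr_EFin.
- exact: measurable_sqr_EFin.
- exact: measurable_sqr_EFin.
- by move=> x _; rewrite lee_fin -(real_normK (num_real (f x)))
    -(real_normK (num_real (g x))) lerXn2r ?nnegrE.
Qed.

Lemma L2_le_ler (f : T -> R) b c : b <= c -> L2_le f b -> L2_le f c.
Proof.
move=> bc [mf b0 fb]; split => //; first exact: le_trans bc.
by apply: (le_trans fb); rewrite lee_fin lerXn2r ?nnegrE// (le_trans b0).
Qed.

Lemma L2_le_scale (f : T -> R) b c : L2_le f b ->
  L2_le (fun x => c * f x) (`|c| * b).
Proof.
move=> [mf b0 fb]; split; [exact: measurable_funM|exact: mulr_ge0|].
under eq_integral do rewrite exprMn EFinM.
rewrite ge0_integralZl_EFin ?sqr_ge0//; last 2 first.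
- by move=> x _; exact: ge0_sqr_EFin.
- exact: measurable_sqr_EFin.
by rewrite exprMn real_normK ?num_real// [leRHS]EFinM; apply: lee_wpmul2l => //;
  rewrite lee_fin sqr_ge0.
Qed.

(** Lets strict inequalities and near-maximizers be used at an arbitrarily small
    cost. *)
Lemma L2_le_lim (f : T -> R) (b : R) : 0 <= b ->
  (forall e, 0 < e -> L2_le f (b + e)) -> L2_le f b.
Proof.
move=> b0 H; have [mf _ _] := H 1 ltr01; split => //.
have key e : 0 < e -> (\int[mu]_x (f x ^+ 2)%:E <= ((b + e) ^+ 2)%:E)%E.
  by move=> /H[].
have i0 : (0 <= \int[mu]_x (f x ^+ 2)%:E)%E.
  by apply: integral_ge0 => x _; exact: ge0_sqr_EFin.
case: (\int[mu]_x _)%E i0 key => [r|_|//]; last by move=> /(_ 1 ltr01).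
rewrite !lee_fin => r0 key.
rewrite -[r]sqr_sqrtr// lerXn2r ?nnegrE ?sqrtr_ge0//.
apply/ler_addgt0Pr => e e0; have := key e e0; rewrite lee_fin => h.
rewrite -(@ger0_norm _ (b + e)) ?addr_ge0 ?(ltW e0)// -sqrtr_sqr.
by rewrite ler_wsqrtr.
Qed.

(** The triangle inequality, from (f + g)^2 <= (1 + t) f^2 + (1 + 1/t) g^2
    with the optimal ratio t = c / b (perturbed to be positive). *)
Lemma L2_le_add (f g : T -> R) b c : L2_le f b -> L2_le g c ->
  L2_le (fun x => f x + g x) (b + c).
Proof.
move=> [mf b0 fb] [mg c0 gc].
have mfg : measurable_fun setT (fun x => f x + g x) by exact: measurable_funD.
have key e : 0 < e ->
    (\int[mu]_x ((f x + g x) ^+ 2)%:E <= ((b + c + e) ^+ 2)%:E)%E.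
  move=> e0; pose b' := b + e / 2; pose c' := c + e / 2.
  have b'0 : 0 < b' by rewrite ltr_wpDl// divr_gt0.
  have c'0 : 0 < c' by rewrite ltr_wpDl// divr_gt0.
  have t0 : 0 < c' / b' by rewrite divr_gt0.
  have s0 : 0 < b' / c' by rewrite divr_gt0.
  apply: (@le_trans _ _ (\int[mu]_x ((1 + c' / b')%:E * (f x ^+ 2)%:E
      + (1 + b' / c')%:E * (g x ^+ 2)%:E))%E).
    apply: ge0_le_integral => //.
    - by move=> x _; rewrite lee_fin sqr_ge0.
    - exact: measurable_sqr_EFin.
    - by apply: emeasurable_funD; apply: measurable_funeM;
        exact: measurable_sqr_EFin.
    - move=> x _; rewrite -!EFinM -EFinD lee_fin.
      have h : 0 <= (c' * f x - b' * g x) ^+ 2 / (b' * c').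
        by rewrite divr_ge0 ?sqr_ge0// mulr_ge0 ?ltW.
      have e1 : (1 + c' / b') * f x ^+ 2 + (1 + b' / c') * g x ^+ 2 =
          (f x + g x) ^+ 2 + (c' * f x - b' * g x) ^+ 2 / (b' * c').
        by field; rewrite !gt_eqF.
      by rewrite e1 lerDl.
  rewrite ge0_integralD//; last 4 first.
  - by move=> x _; rewrite -EFinM lee_fin mulr_ge0 ?sqr_ge0// addr_ge0// ltW.
  - by apply: measurable_funeM; exact: measurable_sqr_EFin.
  - by move=> x _; rewrite -EFinM lee_fin mulr_ge0 ?sqr_ge0// addr_ge0// ltW.
  - by apply: measurable_funeM; exact: measurable_sqr_EFin.
  rewrite !ge0_integralZl_EFin//; last 6 first.
  - by move=> x _; exact: ge0_sqr_EFin.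
  - exact: measurable_sqr_EFin.
  - by rewrite addr_ge0// ltW.
  - by move=> x _; exact: ge0_sqr_EFin.
  - exact: measurable_sqr_EFin.
  - by rewrite addr_ge0// ltW.
  apply: (@le_trans _ _ ((1 + c' / b')%:E * (b' ^+ 2)%:E
      + (1 + b' / c')%:E * (c' ^+ 2)%:E)%E).
    apply: leeD; (apply: lee_wpmul2l; first by rewrite lee_fin addr_ge0// ltW).
      apply: (le_trans fb); rewrite lee_fin lerXn2r ?nnegrE ?(ltW b'0)//.
      by rewrite lerDl divr_ge0// ltW.
    apply: (le_trans gc); rewrite lee_fin lerXn2r ?nnegrE ?(ltW c'0)//.
    by rewrite lerDl divr_ge0// ltW.
  rewrite -!EFinM -EFinD lee_fin.
  have -> : b + c + e = b' + c' by rewrite /b' /c'; lra.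
  by rewrite le_eqVlt; apply/orP; left; apply/eqP; field; rewrite !gt_eqF.
apply: L2_le_lim => // [|e e0]; first exact: addr_ge0.
by split; [|rewrite !addr_ge0// ltW|exact: key].
Qed.

Lemma L2_le0 : L2_le (fun=> 0) 0.
Proof.
by split => //; under eq_integral do rewrite expr0n/=; rewrite integral0 expr0n.
Qed.

Lemma L2_le_sum (I : eqType) (s : seq I) (f : I -> T -> R) (b : I -> R) :
  (forall i, i \in s -> L2_le (f i) (b i)) ->
  L2_le (fun x => \sum_(i <- s) f i x) (\sum_(i <- s) b i).
Proof.
elim: s => [fb|i s IH fb].
  by rewrite big_nil; under eq_fun do rewrite big_nil; exact: L2_le0.
rewrite big_cons; under eq_fun do rewrite big_cons.
apply: L2_le_add; first by apply: fb; rewrite mem_head.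
by apply: IH => j js; apply: fb; rewrite inE js orbT.
Qed.

End L2_bounds.

Lemma L2_le_cst {d} {T : measurableType d} {R : realType} (P : probability T R)
  (c : R) : L2_le P (fun=> c) `|c|.
Proof.
split => //; rewrite integral_cst//= probability_setT mule1.
by rewrite real_normK ?num_real.
Qed.

Lemma bounded_integrable {d} {T : measurableType d} {R : realType}
  (mu : {finite_measure set T -> \bar R}) (f : T -> R) (B : R) :
  measurable_fun setT f -> (forall x, `|f x| <= B) ->
  mu.-integrable setT (EFin \o f).
Proof.
move=> mf fB; apply: measurable_bounded_integrable => //.
  by rewrite ltey_eq fin_num_measure.
exists B; split; first exact: num_real.
by move=> M BM x _ /=; exact: le_trans (fB x) (ltW BM).
Qed.
Arguments bounded_integrable {d T R mu f} B.

(** * Chaining *)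

Section subgaussian_maximum.
Context {d} {W : measurableType d} {R : realType}.
Variable P : probability W R.

(** A single square-integrable envelope for finitely many sub-Gaussian
    variables: add up the exponential tails of all of them and optimize the
    truncation level; the number of variables enters through its logarithm. *)
Lemma subgaussian_envelope n (X : 'I_n -> W -> R) (s : R) :
  (0 < n)%N -> 0 < s -> (forall i, measurable_fun setT (X i)) ->
  (forall i l, (\int[P]_w (expR (l * X i w))%:E
                <= (expR (2 * (l * s) ^+ 2))%:E)%E) ->
  exists2 g : W -> R, L2_le P g (6 * s * (1 + Num.sqrt (ln n%:R)))
                    & forall i w, `|X i w| <= g w.
Proof.
move=> n0 s0 mX mgf.
have n1 : 1 <= n%:R :> R by rewrite ler1n.
have nR0 : 0 < n%:R :> R by rewrite ltr0n.
have ln0 : 0 <= ln n%:R :> R by rewrite ln_ge0.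
pose q := 1 + Num.sqrt (ln n%:R) : R.
have q1 : 1 <= q by rewrite lerDl sqrtr_ge0.
have lnq : ln n%:R <= q ^+ 2.
  by have := sqr_sqrtr ln0; have := sqrtr_ge0 (ln n%:R : R); rewrite /q; nra.
have q0 : 0 < q by lra.
have [sn0 qn0] : s != 0 /\ q != 0 by rewrite !gt_eqF.
(* This T cancels both the bound of the generating functions and their number,
   so that the n tails add up to a multiple of 1 / l ^ 2. *)
pose l := q / s; pose T := 2 * l * s ^+ 2 + ln n%:R / l.
have l0 : 0 < l by rewrite divr_gt0.
have ln00 : l != 0 by rewrite gt_eqF.
have T0 : 0 <= T.
  apply: addr_ge0; last exact: divr_ge0 ln0 (ltW l0).
  exact: mulr_ge0 (mulr_ge0 (ler0n _ 2) (ltW l0)) (sqr_ge0 _).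
have T3 : T <= 3 * q * s.
  have -> : T = 2 * q * s + s * (ln n%:R / q) by rewrite /T /l; field; apply/andP.
  have : ln n%:R / q <= q by rewrite ler_pdivrMr// -expr2.
  by move=> h; have := ler_wpM2l (ltW s0) h; lra.
pose k := 8 / l ^+ 2 * expR (- (l * T)).
have k0 : 0 <= k by rewrite !mulr_ge0 ?invr_ge0 ?sqr_ge0 ?expR_ge0.
pose h w := 2 * T ^+ 2 + k * \sum_(i < n) (expR (l * X i w) + expR (- l * X i w)).
have mexp c i : measurable_fun setT (fun w => expR (c * X i w)).
  apply: measurableT_comp; first exact: measurable_expR.
  exact: measurable_funM.
have mh : measurable_fun setT h.
  apply: measurable_funD => //; apply: measurable_funM => //.
  by apply: measurable_sum => i; apply: measurable_funD.
have h0 w : 0 <= h w.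
  apply: addr_ge0; first exact: mulr_ge0 (ler0n _ 2) (sqr_ge0 _).
  by apply: mulr_ge0 k0 _; apply: sumr_ge0 => i _; rewrite addr_ge0 ?expR_ge0.
exists (fun w => Num.sqrt (h w)).
  split.
  - by apply: measurableT_comp mh; apply: continuous_measurable_fun; exact: sqrt_continuous.
  - by rewrite !mulr_ge0 ?(ltW s0)// (le_trans ler01).
  under eq_integral do rewrite sqr_sqrtr//.
  rewrite [leLHS](_ : _ = (2 * T ^+ 2)%:E + k%:E *
    \sum_(i < n) (\int[P]_w (expR (l * X i w))%:E
                  + \int[P]_w (expR (- l * X i w))%:E))%E; last first.
    under eq_integral do rewrite /h EFinD [X in (_ + X)%E]EFinM -sumEFin.
    rewrite ge0_integralD//; last 3 first.
    - by move=> x _; rewrite lee_fin; exact: mulr_ge0 (ler0n _ 2) (sqr_ge0 _).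
    - by move=> x _; rewrite sumEFin -EFinM lee_fin mulr_ge0// sumr_ge0// => i _;
        rewrite addr_ge0 ?expR_ge0.
    - apply: measurable_funeM; under eq_fun do rewrite sumEFin.
      apply/measurable_EFinP; apply: measurable_sum => i.
      exact: measurable_funD.
    rewrite integral_cst//= probability_setT mule1; congr (_ + _)%E.
    rewrite ge0_integralZl_EFin//; last 2 first.
    - by move=> x _; rewrite sumEFin lee_fin sumr_ge0// => i _;
        rewrite addr_ge0 ?expR_ge0.
    - under eq_fun do rewrite sumEFin.
      apply/measurable_EFinP; apply: measurable_sum => i.
      exact: measurable_funD.
    congr (_ * _)%E; rewrite ge0_integral_sum//; last first.
      by move=> i; apply/measurable_EFinP; exact: measurable_funD.
    apply: eq_bigr => i _; under eq_integral do rewrite EFinD.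
    by rewrite ge0_integralD//; apply/measurable_EFinP; exact: mexp.
  pose e := expR (2 * (l * s) ^+ 2).
  apply: (@le_trans _ _ ((2 * T ^+ 2)%:E + k%:E * \sum_(i < n) (e%:E + e%:E))%E).
    rewrite leeD2l// lee_wpmul2l// ?lee_fin//; apply: lee_sum => i _.
    apply: leeD; first by have := mgf i l.
    by have := mgf i (- l); rewrite mulNr sqrrN.
  rewrite sumEFin -EFinM -EFinD lee_fin sumr_const card_ord.
  have ke : k * ((e + e) *+ n) = 16 / l ^+ 2.
    have -> : k = 8 / l ^+ 2 * (e^-1 / n%:R).
      rewrite /k /e -expRN; congr (_ * _).
      rewrite -[n%:R in RHS]lnK ?posrE// -expRN -expRD; congr expR.
      by rewrite /T; field.
    have en0 : e != 0 by rewrite gt_eqF// expR_gt0.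
    have nn0 : n%:R != 0 :> R by rewrite gt_eqF.
    rewrite -[(e + e) *+ n]mulr_natr; move: n%:R nn0 => v nn0.
    by field; rewrite ln00 en0 nn0.
  rewrite ke.
  have -> : 16 / l ^+ 2 = 16 * s ^+ 2 / q ^+ 2 by rewrite /l; field; apply/andP.
  have : 16 * s ^+ 2 / q ^+ 2 <= 16 * s ^+ 2.
    rewrite ler_pdivrMr ?exprn_gt0// ler_peMr ?exprn_ege1//.
    exact: mulr_ge0 (ler0n _ 16) (sqr_ge0 _).
  have : T ^+ 2 <= (3 * q * s) ^+ 2 by rewrite lerXn2r ?nnegrE// (le_trans T0).
  have : s ^+ 2 <= (q * s) ^+ 2.
    by rewrite exprMn ler_peMl ?sqr_ge0// exprn_ege1.
  rewrite -/q; nra.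
move=> i w; rewrite -sqrtr_sqr ler_wsqrtr//.
apply: le_trans (sqr_le_expR (X i w) l0 T0) _; rewrite lerD2l ler_wpM2l//.
rewrite (bigD1 i)//= lerDl sumr_ge0// => j _.
Qed.

End subgaussian_maximum.

Section covering.
Context {R : realType} {X : Type}.
Variable rho : X -> X -> R.

Lemma le_covering_number u v : u <= v ->
  (covering_number rho v <= covering_number rho u)%E.
Proof.
move=> uv; apply: le_ereal_inf => _ [n [c [cu ->]]].
exists n, c; split => // x; have [i ciu] := cu x.
by exists i; exact: lt_le_trans uv.
Qed.

Lemma covering_number_attained u : (covering_number rho u < +oo)%E ->
  exists n (c : 'I_n -> X), (forall x, exists i, rho (c i) x < u) /\
    covering_number rho u = n%:R%:E.
Proof.
move=> /ereal_inf_lt[_ [n [c [cu ->]]] _].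
pose cov n := `[< exists c : 'I_n -> X, forall x, exists i, rho (c i) x < u >].
have exc : exists n, cov n by exists n; apply/asboolP; exists c.
case: (ex_minnP exc) => m /asboolP[e em] min_m.
exists m, e; split => //; apply/eqP; rewrite eq_le; apply/andP; split.
  by apply: ereal_inf_lbound; exists m, e.
apply: le_ereal_inf_tmp => _ [k [f [fu ->]]].
by rewrite lee_fin ler_nat min_m//; apply/asboolP; exists f.
Qed.

(** A lower Riemann sum of the entropy integral: the step function with values h
    lies below the integrand. *)
Lemma dudley_ge_sum (D : R) (r h : nat -> R) J : diameter rho = D%:E ->
  r 0%N <= D -> (forall j, 0 <= r j.+1 <= r j) -> (forall j, 0 <= h j) ->
  (forall j u, r j.+1 < u <= r j ->
     ((h j)%:E <= sqrte (lne (covering_number rho u)))%E) ->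
  ((\sum_(j < J) h j * (r j - r j.+1))%:E <= dudley rho)%E.
Proof.
move=> diamD rD rdec h0 hg.
pose f u := \sum_(j < J) h j * \1_(`]r j.+1, r j]%classic) u.
rewrite (_ : (_)%:E = \int[@lebesgue_measure R]_u (f u)%:E)%E; last first.
  under eq_integral do rewrite /f -sumEFin.
  rewrite ge0_integral_sum//; last 2 first.
  - move=> j; apply/measurable_EFinP; apply: measurable_funM => //.
  - by move=> j u _; rewrite lee_fin mulr_ge0.
  rewrite -sumEFin; apply: eq_bigr => j _.
  under eq_integral do rewrite EFinM.
  rewrite ge0_integralZl_EFin//; last first.
    by apply/measurable_EFinP.
  rewrite integral_indic//= setIT lebesgue_measure_itv/= lte_fin.
  have /andP[_ rj] := rdec j.
  case: ltP => rjj; first by rewrite -EFinD -EFinM.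
  by rewrite (_ : r j = r j.+1) ?subrr ?mulr0 ?mule0//; apply/eqP; rewrite eq_le rj rjj.
have r0 j : 0 <= r j.
  by have /andP[r1 r2] := rdec j; exact: le_trans r2.
have rnb j : r j <= r 0%N.
  by elim: j => // j; apply: le_trans; have /andP[] := rdec j.
rewrite /dudley [leRHS]integral_mkcond; apply: le_integral_nonmeasurable => u.
  by rewrite lee_fin sumr_ge0// => j _; rewrite mulr_ge0.
pose g u := sqrte (lne (covering_number rho u)).
suff : ((f u)%:E <= if (r J < u)%R then (g \_ (fun u => (0 < u)%R /\ (u%:E <= diameter rho)%E)) u else 0)%E.
  move=> /le_trans; apply; case: ifP => // _; rewrite /patch; case: ifP => //.
  by rewrite sqrte_ge0.
rewrite /f {f}; elim: J => [|J IH].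
  rewrite big_ord0; case: ifP => // _; rewrite /patch; case: ifP => // _.
  exact: sqrte_ge0.
rewrite big_ord_recr/= EFinD indicE.
have /andP[_ rj] := rdec J.
case: ifPn IH => [rJu IH|rJu IH].
  rewrite (le_lt_trans rj rJu) memNset ?mulr0 ?adde0//=.
  by rewrite in_itv/= => /andP[_]; rewrite leNgt rJu.
rewrite -leNgt in rJu.
case: ifPn => [rJ1u|]; last first.
  rewrite -leNgt => urJ1; rewrite memNset ?mulr0 ?adde0//=.
  by rewrite in_itv/= => /andP[]; rewrite ltNge urJ1.
rewrite mem_set/= ?in_itv/= ?rJ1u//= mulr1.
rewrite -[leRHS]add0e leeD// /patch mem_set; first by apply: hg; rewrite rJ1u rJu.
split; first by apply: le_lt_trans rJ1u; exact: r0.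
by rewrite diamD lee_fin (le_trans rJu)// (le_trans (rnb J)).
Qed.

(** An infinite covering number is infinite at all smaller radii too, and makes
    the entropy integral infinite. *)
Lemma covering_number_lt_pinfty (D u : R) : diameter rho = D%:E ->
  (dudley rho < +oo)%E -> 0 < u <= D -> (covering_number rho u < +oo)%E.
Proof.
move=> diamD dud /andP[u0 uD]; rewrite ltNge leye_eq; apply/negP => /eqP covu.
suff h c : 0 <= c -> ((c * u)%:E <= dudley rho)%E.
  have : (0 <= dudley rho)%E by rewrite (le_trans _ (h 0 _))// mul0r.
  case: dudley dud h => [y|//|//] _ h; rewrite lee_fin => y0.
  have := h ((y + 1) / u); rewrite divr_ge0 ?addr_ge0 ?(ltW u0)//.
  by move=> /(_ isT); rewrite divfK ?gt_eqF// lee_fin; lra.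
move=> c0.
have := @dudley_ge_sum D (fun j => if j is 0%N then u else 0)
  (fun j => c) 1%N diamD.
rewrite big_ord1 subr0; apply => //.
  by case=> [|j]; rewrite ?lexx// ltW.
case=> [|j] v; last by move=> /andP[/lt_le_trans h /h]; rewrite ltxx.
move=> /andP[v0 vu]; have := le_covering_number vu.
by rewrite covu leye_eq => /eqP ->; rewrite leey.
Qed.

(** A finite entropy integral makes the space totally bounded, hence separable. *)
Lemma dense_sequence (D : R) : X -> diameter rho = D%:E ->
  (dudley rho < +oo)%E ->
  exists q : nat -> X, forall x e, 0 < e -> exists j, rho (q j) x < e.
Proof.
move=> x0 diamD dud.
have /choice[c Hc] : forall m : nat, exists c : nat -> X,
    forall x, exists k, rho (c k) x < m.+1%:R^-1.
  move=> m; have m0 : 0 < m.+1%:R^-1 :> R by rewrite invr_gt0.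
  have [mD|Dm] := leP (m.+1%:R^-1) D.
    have cov : (covering_number rho m.+1%:R^-1 < +oo)%E.
      by apply: (covering_number_lt_pinfty diamD dud); rewrite m0.
    have [n [c [Hc _]]] := covering_number_attained cov.
    exists (fun k => if insub k is Some i then c i else x0) => x.
    by have [i ci] := Hc x; exists i; rewrite valK.
  exists (fun=> x0) => x; exists 0%N; apply: le_lt_trans Dm.
  by rewrite -lee_fin -diamD; apply: ereal_sup_ubound; exists x0, x.
exists (fun j => let p := odflt (0, 0)%N (unpickle j) in c p.1 p.2) => x e e0.
have [m] := ltr_add_invr e0; rewrite add0r => me.
have [k Hk] := Hc m x; exists (pickle (m, k)).
by rewrite pickleK/=; exact: lt_trans me.
Qed.

End covering.

Lemma metric_ge0 {R : realType} {X : Type} (rho : X -> X -> R) :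
  is_metric rho -> forall x y, 0 <= rho x y.
Proof.
move=> [rho0 rhoC rhoD] x y.
have := rhoD x y x; rewrite (rhoC y x) ((rho0 x x).2 erefl) -mulr2n.
by rewrite pmulrn_lge0.
Qed.

Lemma le_diameter {R : realType} {X : Type} (rho : X -> X -> R) x y :
  ((rho x y)%:E <= diameter rho)%E.
Proof. by apply: ereal_sup_ubound; exists x, y. Qed.

Section chaining.
Context {d} {W : measurableType d} {R : realType} {X : Type}.
Variables (P : probability W R) (rho : X -> X -> R) (Z : X -> W -> R).
Variables (s : R) (J : nat) (x0 : X) (b0 : R).
Hypothesis rho_metric : is_metric rho.
Hypothesis s0 : 0 <= s.
Hypothesis mZ : forall x, measurable_fun setT (Z x).
Hypothesis mgf : forall x y l,
  (\int[P]_w (expR (l * (Z x w - Z y w)))%:E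
   <= (expR (2 * (l * (s * rho x y)) ^+ 2))%:E)%E.
Hypothesis lipZ : forall x y w, `|Z x w - Z y w| <= s * 2 ^+ J * rho x y.
Hypothesis Zx0 : L2_le P (Z x0) b0.

Let rho_ge0 := metric_ge0 rho_metric.

Lemma increments_envelope n (p q : 'I_n -> X) (r : R) : 0 < s -> 0 < r ->
  (0 < n)%N -> (forall i, rho (p i) (q i) <= r) ->
  exists2 g : W -> R, L2_le P g (6 * (s * r) * (1 + Num.sqrt (ln n%:R)))
                    & forall i w, `|Z (p i) w - Z (q i) w| <= g w.
Proof.
move=> s_gt0 r0 n0 pq.
apply: (subgaussian_envelope (X := fun i w => Z (p i) w - Z (q i) w)) => //.
- exact: mulr_gt0.
- by move=> i; exact: measurable_funB.
- move=> i l; apply: (le_trans (mgf _ _ _)).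
  rewrite lee_fin ler_expR ler_pM2l// !exprMn ler_wpM2l ?sqr_ge0//.
  by rewrite ler_wpM2l ?sqr_ge0// lerXn2r ?nnegrE// ltW.
Qed.

(** Nets of radius D / 2 ^ j.+1 are linked through their nearest points in the
    previous net.  The lower Riemann sums of the entropy integral bound the
    total, and below the finest net the crude Lipschitz bound suffices. *)
Lemma chaining_pos (D I : R) : (0 < J)%N -> 0 < s -> 0 < D ->
  diameter rho = D%:E -> dudley rho = I%:E ->
  exists2 g : W -> R, L2_le P g (b0 + 24 * s * (I + D))
                    & forall x w, `|Z x w| <= g w.
Proof.
move=> J0 s_gt0 D0 diamD dudI.
(* The first net has radius D / 2, so that it is linked to x0 at distance at most
   twice its radius, as the later nets are to their predecessors. *)
pose r j : R := D * 2^-1 ^+ j.+1.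
have half0 : 0 < 2^-1 :> R by [].
have r0 j : 0 < r j by rewrite mulr_gt0 ?exprn_gt0.
have rS j : r j = 2 * r j.+1 by rewrite /r [in RHS]exprS; field.
have rD j : r j <= D.
  elim: j => [|j]; first by rewrite /r expr1 ger_pMr// invf_le1// ler1n.
  by apply: le_trans; rewrite [leRHS]rS; have := r0 j.+1; lra.
have dud_oo : (dudley rho < +oo)%E by rewrite dudI ltry.
have cov_oo j : (covering_number rho (r j) < +oo)%E.
  by apply: (covering_number_lt_pinfty diamD) => //; rewrite r0 rD.
have /choice[M HM] : forall j, exists n, exists c : 'I_n -> X,
    (forall x, exists i, rho (c i) x < r j) /\
    covering_number rho (r j) = n%:R%:E.
  by move=> j; exact: covering_number_attained.
pose c j := projT1 (cid (HM j)).
have cP j x : exists i, rho (c j i) x < r j.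
  by have [+ _] := projT2 (cid (HM j)); exact.
have covM j : covering_number rho (r j) = (M j)%:R%:E.
  by have [] := projT2 (cid (HM j)).
have M0 j : (0 < M j)%N by have [i _] := cP j x0; exact: leq_ltn_trans (ltn_ord i).
pose h j : R := Num.sqrt (ln (M j)%:R).
have sumI : \sum_(j < J) h j * r j <= 2 * I.
  have := @dudley_ge_sum _ _ rho D r h J diamD (rD 0%N) _ _ _.
  rewrite dudI lee_fin => H.
  suff : \sum_(j < J) h j * (r j - r j.+1) <= I.
    move=> /(ler_wpM2l (ler0n R 2)).
    rewrite mulr_sumr; apply: le_trans.
    by apply: ler_sum => j _; rewrite rS; lra.
  apply: H.
  - by move=> j; rewrite (ltW (r0 _))/= [leRHS]rS; have := r0 j.+1; lra.
  - by move=> j; exact: sqrtr_ge0.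
  - move=> j u /andP[_ urj]; have := le_covering_number rho urj.
    rewrite covM => cu.
    have M1 : 1 <= (M j)%:R :> R by rewrite ler1n.
    rewrite (_ : (h j)%:E = sqrte (lne (M j)%:R%:E)); last first.
      by rewrite lne_EFin// ltr0n.
    have cov1 : (1 <= covering_number rho u)%E by rewrite (le_trans _ cu)// lee_fin.
    rewrite lee_sqrt; last by rewrite lne_ge0.
    rewrite lee_lne// !in_itv/= leey andbT ?lee_fin ?ler0n//.
    exact: le_trans cov1.
have sumD : \sum_(j < J) r j <= D.
  suff H k : \sum_(j < k) r j <= D - r k * 2 by have := H J; have := r0 J; lra.
  elim: k => [|k IH]; first by rewrite big_ord0 /r expr1 divfK// subrr.
  by rewrite big_ord_recr/=; move: IH; rewrite (rS k); lra.
pose a j := 6 * (s * (2 * r j)) * (1 + h j).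
have chain j : exists2 G : W -> R, L2_le P G (\sum_(k < j.+1) a k)
    & forall i w, `|Z (c j i) w - Z x0 w| <= G w.
  elim: j => [|j [G LG HG]].
    rewrite big_ord1; apply: (increments_envelope (q := fun=> x0)) => //.
      by rewrite mulr_gt0.
    move=> i; rewrite -[2]/(2%:R) /r expr1 mulrC divfK//.
    by have := le_diameter rho (c 0%N i) x0; rewrite diamD lee_fin.
  have /choice[p Hp] : forall i, exists k, rho (c j k) (c j.+1 i) < r j.
    by move=> i; exact: cP.
  have pr i : rho (c j.+1 i) (c j (p i)) <= 2 * r j.+1.
    by rewrite -rS; have [_ -> _] := rho_metric; exact: ltW.
  have [g Lg Hg] := increments_envelope s_gt0 (mulr_gt0 (ltr0n _ 2) (r0 _))
    (M0 _) pr.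
  exists (fun w => G w + g w); first by rewrite big_ord_recr/=; exact: L2_le_add.
  move=> i w; rewrite -(subrKA (Z (c j (p i)) w)) addrC.
  by rewrite (le_trans (ler_normD _ _))// lerD.
case: J J0 lipZ sumI sumD => // k _ lip sumI sumD.
have [G LG HG] := chain k.
exists (fun w => `|Z x0 w| + G w + s * D).
  have Lx0 : L2_le P (fun w => `|Z x0 w|) b0.
    apply: L2_le_mono Zx0; first exact: measurableT_comp (mZ x0).
    by move=> w; rewrite normr_id.
  have := L2_le_add (L2_le_add Lx0 LG) (L2_le_cst P (s * D)).
  apply: L2_le_ler.
  have -> : \sum_(j < k.+1) a j =
      12 * s * (\sum_(j < k.+1) r j) + 12 * s * (\sum_(j < k.+1) h j * r j).
    by rewrite !mulr_sumr -big_split; apply: eq_bigr => j _; rewrite /a /=; ring.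
  rewrite ger0_norm ?mulr_ge0 ?(ltW D0)//.
  have : s * (\sum_(j < k.+1) r j) <= s * D by rewrite ler_wpM2l.
  have : s * (\sum_(j < k.+1) h j * r j) <= s * (2 * I) by rewrite ler_wpM2l.
  have : 0 <= s * D by rewrite mulr_ge0// ltW.
  lra.
move=> x w; have [i ci] := cP k x.
have e1 : `|Z x w - Z (c k i) w| <= s * D.
  apply: (le_trans (lip _ _ _)); have [_ -> _] := rho_metric.
  rewrite -mulrA ler_wpM2l//.
  have -> : D = 2 ^+ k.+1 * r k by rewrite /r exprVn mulrCA mulfV ?mulr1// expf_neq0.
  by rewrite ler_wpM2l ?exprn_ge0// ltW.
have -> : Z x w = Z x0 w + (Z (c k i) w - Z x0 w) + (Z x w - Z (c k i) w) by ring.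
rewrite (le_trans (ler_normD _ _))// lerD// (le_trans (ler_normD _ _))//.
by rewrite lerD.
Qed.

(** Having s multiply the entropy and the diameter keeps the case s = 0 meaningful:
    the process is then constant in the index, however large the index space. *)
Lemma chaining_bound : (0 < J)%N ->
  (s%:E * dudley rho < +oo)%E -> (s%:E * diameter rho < +oo)%E ->
  exists g b, [/\ L2_le P g b, forall x w, `|Z x w| <= g w
    & (b%:E <= b0%:E + (24 * s)%:E * (dudley rho + diameter rho))%E].
Proof.
move=> J0 dud diam.
have dud0 : (0 <= dudley rho)%E by apply: integral_ge0 => u _; exact: sqrte_ge0.
have diam0 : (0 <= diameter rho)%E.
  apply: le_trans (le_diameter rho x0 x0).
  by rewrite lee_fin rho_ge0.
have degenerate : (forall x, s * rho x x0 <= 0) ->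
    exists g b, [/\ L2_le P g b, forall x w, `|Z x w| <= g w
    & (b%:E <= b0%:E + (24 * s)%:E * (dudley rho + diameter rho))%E].
  move=> sr; exists (fun w => `|Z x0 w|), b0; split.
  - apply: L2_le_mono Zx0; first exact: measurableT_comp (mZ x0).
    by move=> w; rewrite normr_id.
  - move=> x w; have := lipZ x x0 w.
    rewrite mulrAC => /le_trans /(_ (mulr_le0_ge0 (sr x) (exprn_ge0 _ (ler0n _ 2)))).
    by rewrite normr_le0 subr_eq0 => /eqP ->.
  - rewrite leeDl//; apply: mule_ge0; last exact: adde_ge0.
    by rewrite lee_fin mulr_ge0.
have [s_eq0|sn0] := eqVneq s 0.
  by apply: degenerate => x; rewrite s_eq0 mul0r.
have s_gt0 : 0 < s by rewrite lt_def sn0.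
case diamD : (diameter rho) diam diam0 => [D| |] //; last first.
  by rewrite gt0_muley ?lte_fin.
case dudI : (dudley rho) dud dud0 => [I| |] //; last first.
  by rewrite gt0_muley ?lte_fin.
rewrite !lee_fin => _ I0 _ D0.
have [D_eq0|Dn0] := eqVneq D 0.
  rewrite -diamD -dudI; apply: degenerate => x.
  have := le_diameter rho x x0; rewrite diamD D_eq0 lee_fin => h.
  by rewrite mulr_ge0_le0.
have D_gt0 : 0 < D by rewrite lt_def Dn0.
have [g Lg gZ] := chaining_pos J0 s_gt0 D_gt0 diamD dudI.
by exists g, (b0 + 24 * s * (I + D)).
Qed.

End chaining.

(** * Independent samples *)

Section sigma_algebra_of_samples.
Context {dW dT} {W : measurableType dW} {T : measurableType dT}
  {I : finType} {R : realType}.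
Variable P : probability W R.
Variable S : I -> W -> T.
Hypothesis mS : forall i, measurable_fun setT (S i).

(** The pi-system of the cylinders over the samples with index in J. *)
Definition sample_boxes (J : {pred I}) : set (set W) :=
  [set C | exists B : I -> set T, [/\ forall i, measurable (B i),
     forall i, i \notin J -> B i = setT & C = \bigcap_i (S i @^-1` B i)]].

Local Notation sample_space J := (g_sigma_algebraType (sample_boxes J)).

Lemma measurable_sample_box (B : I -> set T) : (forall i, measurable (B i)) ->
  measurable (\bigcap_i (S i @^-1` B i)).
Proof.
move=> mB; apply: fin_bigcap_measurable => // i _.
by rewrite -[X in measurable X]setTI; exact: mS.
Qed.

Lemma setI_closed_sample_boxes J : setI_closed (sample_boxes J).
Proof.
move=> _ _ [B [mB BJ ->]] [C [mC CJ ->]]; exists (fun i => B i `&` C i); split.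
- by move=> i; exact: measurableI.
- by move=> i iJ; rewrite BJ// CJ// setTI.
- by rewrite -bigcapI; apply: eq_bigcapr => i _; rewrite preimage_setI.
Qed.

Lemma sample_boxesT J : sample_boxes J setT.
Proof.
exists (fun=> setT); split => //.
by apply/esym/seteqP; split => // w _ i _.
Qed.

Lemma measurable_fun_sample (J : {pred I}) i : i \in J ->
  measurable_fun setT (S i : sample_space J -> T).
Proof.
move=> iJ _ B mB; rewrite setTI; apply: sub_sigma_algebra.
exists (fun j => if j == i then B else setT); split.
- by move=> j; case: ifP.
- by move=> j; case: eqP => // ->; rewrite iJ.
- apply/seteqP; split => [w Bw j _/=|w /(_ i Logic.I)/=]; last by rewrite eqxx.
  by case: eqP => // ->.
Qed.

Lemma measurable_to_sample_space d (X : measurableType d) (J : {pred I})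
  (f : X -> sample_space J) :
  (forall i, i \in J -> measurable_fun setT (S i \o f)) ->
  measurable_fun setT f.
Proof.
move=> mf; apply: (@measurability _ _ X (sample_space J) setT f _ erefl).
move=> _ [_ [B [mB BJ ->]] <-]; rewrite setTI preimage_bigcap.
apply: fin_bigcap_measurable => // i _.
have [iJ|iJ] := boolP (i \in J); last first.
  by rewrite BJ//; exact: measurableT.
by rewrite -comp_preimage -[X in measurable X]setTI; exact: mf.
Qed.

Lemma measurable_to_samples J :
  measurable_fun setT (id : W -> sample_space J).
Proof. by apply: measurable_to_sample_space => i _; exact: mS. Qed.

Lemma measurable_sub_samples (J K : {pred I}) : {subset J <= K} ->
  measurable_fun setT (id : sample_space K -> sample_space J).
Proof.
move=> JK; apply: measurable_to_sample_space => i iJ.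
exact: measurable_fun_sample (JK i iJ).
Qed.

Hypothesis indep : forall B : I -> set T, (forall i, measurable (B i)) ->
  P (\bigcap_i (S i @^-1` B i)) = (\big[*%E/1]_i P (S i @^-1` B i))%E.

(** A sample is independent of the sigma-algebra of the other samples: the
    product rule extends from cylinders by uniqueness of measures. *)
Lemma sample_indep (J : {pred I}) i A (B : set (sample_space J)) :
  i \notin J -> measurable A -> measurable B ->
  P (S i @^-1` A `&` B) = (P (S i @^-1` A) * P B)%E.
Proof.
move=> iJ mA mB.
have mSA : measurable (S i @^-1` A) by rewrite -[X in measurable X]setTI; exact: mS.
pose r : {nonneg R} := NngNum (fine_ge0 (measure_ge0 P (S i @^-1` A))).
have rE : (r%:num%:E = P (S i @^-1` A))%E by rewrite /= fineK// fin_num_measure.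
rewrite -rE [LHS](_ : _ = mrestr P mSA B); last by rewrite /mrestr setIC.
rewrite [RHS](_ : _ = mscale r P B)//.
have sub : sample_boxes J `<=` measurable.
  by move=> _ [C [mC _ ->]]; exact: measurable_sample_box.
apply: (@g_sigma_algebra_measure_unique _ R W (sample_boxes J) sub (fun=> setT)
  (fun=> sample_boxesT J) _ (mrestr P mSA) (mscale r P)
  (@setI_closed_sample_boxes J)) => //.
- by apply/seteqP; split => // w _; exists 0%N.
- move=> _ [C [mC CJ ->]]; rewrite [LHS](_ : _ = P (\bigcap_j (S j @^-1` C j) `&` S i @^-1` A))//.
  rewrite [RHS](_ : _ = r%:num%:E * P (\bigcap_j (S j @^-1` C j)))%E// rE.
  pose C' j := if j == i then A else C j.
  have mC' j : measurable (C' j) by rewrite /C'; case: ifP.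
  have -> : \bigcap_j (S j @^-1` C j) `&` S i @^-1` A =
      \bigcap_j (S j @^-1` C' j).
    apply/seteqP; split => [w [wC wA] j _|w wC'].
      by rewrite /C' /preimage/=; case: eqP => [->//|_]; exact: wC.
    split; last by have := wC' i Logic.I; rewrite /C' /preimage/= eqxx.
    move=> j _; have := wC' j Logic.I; rewrite /C' /preimage/=.
    by case: eqP => // -> _; rewrite CJ.
  have C'i : C' i = A by rewrite /C' eqxx.
  have split_i (G : I -> \bar R) :
      (\big[*%E/1]_j G j = G i * \big[*%E/1]_(j | j != i) G j)%E by exact: bigD1.
  rewrite (indep mC) (indep mC') !split_i C'i (CJ i iJ) preimage_setT.
  rewrite probability_setT mul1e; congr (_ * _)%E.
  by apply: eq_bigr => j /negPf; rewrite /C' => ->.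
- suff : (P (setT `&` S i @^-1` A) < +oo)%E by [].
  by rewrite setTI ltey_eq fin_num_measure.
Qed.

(** Integrating out one sample while the others are kept fixed: the pair formed
    by the sample and the other ones has a product law. *)
Lemma integral_sample (nu : probability T R) (J : {pred I}) i
  (F : T * sample_space J -> \bar R) : i \notin J ->
  (forall A, measurable A -> P (S i @^-1` A) = nu A) ->
  measurable_fun setT F -> (forall z, 0 <= F z)%E ->
  (\int[P]_w F (S i w, w) = \int[P]_w \int[nu]_t F (t, w))%E.
Proof.
move=> iJ lawS mF F0.
pose joint w : T * sample_space J := (S i w, w).
have mjoint : measurable_fun setT joint.
  exact: measurable_fun_pair (mS i) (@measurable_to_samples J).
pose joint' : {mfun W >-> (T * sample_space J)%type} :=
  HB.pack joint (isMeasurableFun.Build _ _ _ _ joint mjoint).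
pose idJ : {mfun W >-> sample_space J} :=
  HB.pack (id : W -> sample_space J)
    (isMeasurableFun.Build _ _ _ _ _ (@measurable_to_samples J)).
have prodE X : measurable X ->
    (nu \x distribution P idJ)%E X = distribution P joint' X.
  apply: product_measure_unique => A B mA mB.
  rewrite /distribution /pushforward/= -lawS//.
  exact: sample_indep iJ mA mB.
have -> : (\int[P]_w F (S i w, w) = \int[distribution P joint']_z F z)%E.
  rewrite ge0_integral_pushforward//.
rewrite (eq_measure_integral (nu \x distribution P idJ)%E); last first.
  by move=> A mA _; apply: esym; exact: prodE.
rewrite fubini_tonelli2// ge0_integral_pushforward//.
  exact: measurable_fun_fubini_tonelli_G.
by move=> w _; apply: integral_ge0 => t _; exact: F0.
Qed.

(** Independent centred bounded variables, jointly with data they do not depend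
    on: the moment generating functions multiply. *)
Lemma sample_mgf (nu : probability T R) (J : {pred I}) (s : seq I)
  (V : T * sample_space J -> R) (B l : R) :
  uniq s -> (forall i, i \in s -> i \notin J) ->
  (forall i A, i \in s -> measurable A -> P (S i @^-1` A) = nu A) ->
  measurable_fun setT V -> (forall z, `|V z| <= B) ->
  (forall w, \int[nu]_t V (t, w) = 0) ->
  (\int[P]_w (expR (l * \sum_(i <- s) V (S i w, w)))%:E
   <= (expR (2 * (l * B) ^+ 2 * (size s)%:R))%:E)%E.
Proof.
move=> + + + mV VB V0; elim: s => [_ _ _|i s IH /= /andP[i_s us] sJ law].
  under eq_integral do rewrite big_nil mulr0 expR0.
  by rewrite integral_cst//= probability_setT mule1 mulr0 expR0.
pose K := [predU J & s].
have iK : i \notin K by rewrite !inE negb_or i_s sJ// inE eqxx.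
have mid (K' J' : {pred I}) : {subset J' <= K'} ->
    measurable_fun setT (fun z : T * sample_space K' => (z.1, z.2) : T * sample_space J').
  move=> JK; apply: measurable_fun_pair; first exact: measurable_fst.
  exact: measurableT_comp (measurable_sub_samples JK) measurable_snd.
have JK : {subset J <= K} by move=> j jJ; rewrite inE jJ.
have mVK : measurable_fun setT (V : T * sample_space K -> R).
  rewrite (_ : V = (V : T * sample_space J -> R) \o (fun z => (z.1, z.2))); last first.
    by apply/funext => -[].
  exact: measurableT_comp mV (mid _ _ JK).
pose U w := \sum_(j <- s) V (S j w, w).
have mU : measurable_fun setT (U : sample_space K -> R).
  rewrite (_ : U = fun w => \sum_(j <- s) if j \in s then V (S j w, w) else 0).
    apply: measurable_sum => j; have [js|_] := boolP (j \in s) => //.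
    apply: (measurableT_comp mVK); apply: measurable_fun_pair => //.
    by apply: measurable_fun_sample; rewrite inE js orbT.
  by apply/funext => w; apply: eq_big_seq => j ->.
have mU' : measurable_fun setT (U : W -> R).
  exact: measurableT_comp mU (@measurable_to_samples K).
pose F (z : T * sample_space K) := (expR (l * V z) * expR (l * U z.2))%:E.
have mexp d0 (X : measurableType d0) (f : X -> R) : measurable_fun setT f ->
    measurable_fun setT (fun x => expR (l * f x)).
  move=> mf; apply: measurableT_comp; first exact: measurable_expR.
  exact: measurable_funM.
have mF : measurable_fun setT F.
  apply/measurable_EFinP; apply: measurable_funM; first exact: mexp.
  by apply: mexp; exact: measurableT_comp mU measurable_snd.
have F0 z : (0 <= F z)%E by rewrite lee_fin mulr_ge0 ?expR_ge0.
under eq_integral do rewrite big_cons mulrDr expRD.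
rewrite (integral_sample iK (fun A mA => law i A (mem_head _ _) mA) mF F0).
pose e := expR (2 * (l * B) ^+ 2).
have inner w : (\int[nu]_t F (t, w) <= e%:E * (expR (l * U w))%:E)%E.
  rewrite /F; under eq_integral do rewrite /= EFinM muleC.
  rewrite ge0_integralZl_EFin ?expR_ge0//; last first.
    by apply/measurable_EFinP; apply: mexp; exact: (measurable_fun_pair1 _ mV).
  rewrite muleC; apply: lee_wpmul2r; first by rewrite lee_fin expR_ge0.
  have mVw : measurable_fun setT (fun t => V (t, w)) by exact: (measurable_fun_pair1 _ mV).
  have iV : nu.-integrable setT (EFin \o (fun t => V (t, w))).
    by apply: (bounded_integrable B) => // t; exact: VB.
  have B0 : 0 <= B := le_trans (normr_ge0 _) (VB (point, w)).
  have [B_eq0|Bn0] := eqVneq B 0.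
    rewrite (eq_integral (cst 1%E)); last first.
      move=> t _; have := VB (t, w); rewrite B_eq0 normr_le0 => /eqP ->.
      by rewrite mulr0 expR0.
    rewrite integral_cst//= probability_setT mule1 lee_fin -expR0 ler_expR.
    by rewrite mulr_ge0// sqr_ge0.
  have B_gt0 : 0 < B by rewrite lt_def Bn0.
  pose k := (expR (l * B) - expR (- (l * B))) / (2 * B).
  have iVk : nu.-integrable setT (EFin \o (fun t => V (t, w) * k)).
    apply: (bounded_integrable (B * `|k|)); first exact: measurable_funM.
    by move=> t; rewrite normrM ler_wpM2r.
  have ie : nu.-integrable setT (EFin \o (fun=> e)).
    by apply: (bounded_integrable `|e|).
  apply: (@le_trans _ _ (\int[nu]_t (e + V (t, w) * k)%:E)%E).
    apply: ge0_le_integral => //.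
    - by apply/measurable_EFinP; exact: mexp.
    - apply/measurable_EFinP; apply: measurable_funD => //.
      exact: measurable_funM.
    - by move=> t _; rewrite lee_fin; exact: expR_le_chord.
  under eq_integral do rewrite EFinD.
  rewrite integralD//= integral_cst//= probability_setT mule1.
  rewrite (_ : (\int[nu]_t (V (t, w) * k)%:E = 0)%E) ?adde0//.
  have := RintegralZr k measurableT iV; rewrite V0 mul0r /Rintegral => h.
  by rewrite -[LHS]fineK ?h// integrable_fin_num.
apply: (@le_trans _ _ (\int[P]_w (e%:E * (expR (l * U w))%:E))%E).
  apply: ge0_le_integral => //.
  - by move=> w _; apply: integral_ge0 => t _; exact: F0.
  - have mG := @measurable_fun_fubini_tonelli_G _ _ _ _ _ nu F mF F0.
    exact: measurableT_comp mG (@measurable_to_samples K).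
  - by apply: measurable_funeM; apply/measurable_EFinP; exact: mexp.
rewrite ge0_integralZl_EFin ?expR_ge0//; last first.
  by apply/measurable_EFinP; exact: mexp.
rewrite -[(size s).+1%:R]natr1 mulrDr mulr1 addrC expRD EFinM.
apply: lee_wpmul2l.
  by rewrite lee_fin expR_ge0.
apply: IH => //.
- by move=> j js; apply: sJ; rewrite inE js orbT.
- by move=> j A js; apply: law; rewrite inE js orbT.
Qed.

End sigma_algebra_of_samples.

(** * Countable suprema and essential suprema *)

Section suprema_of_sequences.
Context {R : realType}.
Implicit Types (u v : nat -> R) (b B : R).

Definition seq_sup u : R := sup (range u).

Lemma seq_sup_ub u B n : (forall n, u n <= B) -> u n <= seq_sup u.
Proof. by move=> uB; apply: ub_le_sup; [exists B => _ [k _ <-]|exists n]. Qed.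

Lemma seq_sup_le u b : (forall n, u n <= b) -> seq_sup u <= b.
Proof. by move=> ub; apply: ge_sup; [exists (u 0%N), 0%N|move=> _ [n _ <-]]. Qed.

Lemma seq_sup_adherent u e : 0 < e -> exists n, seq_sup u < u n + e.
Proof.
move=> e0.
have [hs|hs] := pselect (has_sup (range u)).
  have [_ [n _ <-]] := sup_adherent e0 hs.
  by rewrite ltrBlDr; exists n.
(* An unbounded set has supremum 0 by convention. *)
have [n hn] : exists n, 0 < u n + e.
  apply: contrapT => /forallNP un; apply: hs; split; first by exists (u 0%N), 0%N.
  exists 0 => _ [n _ <-]; have /negP := un n; rewrite -leNgt => h.
  by apply: le_trans h; rewrite lerDl ltW.
by exists n; rewrite /seq_sup sup_out.
Qed.

Lemma seq_sup_bounded u B : (forall n, `|u n| <= B) -> `|seq_sup u| <= B.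
Proof.
move=> uB; have uB' n : u n <= B by apply: le_trans (uB n); exact: ler_norm.
rewrite ler_norml seq_sup_le// andbT; apply: le_trans (seq_sup_ub 0 uB').
by have := uB 0%N; rewrite ler_norml => /andP[].
Qed.

Lemma seq_sup_dist u v B b : (forall n, `|u n| <= B) -> (forall n, `|v n| <= B) ->
  (forall n, `|u n - v n| <= b) -> `|seq_sup u - seq_sup v| <= b.
Proof.
move=> uB vB uv.
have uB' n : u n <= B by apply: le_trans (uB n); exact: ler_norm.
have vB' n : v n <= B by apply: le_trans (vB n); exact: ler_norm.
have uv' n : - b <= u n - v n <= b by rewrite -ler_norml.
rewrite ler_norml lerBlDr lerBrDr; apply/andP; split.
  rewrite addrC lerBlDr; apply: seq_sup_le => n.
  apply: (@le_trans _ _ (u n + b)); last by rewrite lerD2r (seq_sup_ub n uB').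
  by have := uv' n; lra.
apply: seq_sup_le => n; apply: (@le_trans _ _ (b + v n)).
  by have := uv' n; lra.
by rewrite lerD2l (seq_sup_ub n vB').
Qed.

Lemma measurable_seq_sup d (T : measurableType d) (f : nat -> T -> R) :
  (forall n, measurable_fun setT (f n)) ->
  (forall x, exists B, forall n, f n x <= B) ->
  measurable_fun setT (fun x => seq_sup (f^~ x)).
Proof.
move=> mf fB; rewrite (_ : (fun _ => _) = fun x => sups (f^~ x) 0).
  apply: measurable_fun_sups => // x _.
  by have [B HB] := fB x; exists B => _ [n _ <-].
apply/funext => x; rewrite /seq_sup /sups /sdrop; congr (sup _).
by apply/seteqP; split => [_ [n _ <-]|_ [n _ <-]]; exists n.
Qed.

End suprema_of_sequences.

Lemma merge_sequences (I : Type) (c : nat -> nat -> I) :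
  exists b : nat -> I, forall k n, exists p, b p = c k n.
Proof.
exists (fun p => let q := odflt (0, 0)%N (unpickle p) in c q.1 q.2) => k n.
by exists (pickle (k, n)); rewrite /= pickleK.
Qed.

Section countable_subfamilies.
Context {d} {T : measurableType d} {R : realType}.
Variable mu : {finite_measure set T -> \bar R}.

(** Among the countable subfamilies, one has a supremum of maximal integral;
    adding a further member cannot increase it. *)
Lemma countable_envelope (I : Type) (f : I -> T -> R) (B : R) : I ->
  (forall i, measurable_fun setT (f i)) -> (forall i x, `|f i x| <= B) ->
  exists c : nat -> I, forall i,
    {ae mu, forall x, f i x <= seq_sup (fun n => f (c n) x)}.
Proof.
move=> i0 mf fB.
pose g (c : nat -> I) x := seq_sup (fun n => f (c n) x).
have fB' i x : f i x <= B by apply: le_trans (fB i x); exact: ler_norm.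
have gB c x : `|g c x| <= B by exact: seq_sup_bounded.
have mg c : measurable_fun setT (g c).
  by apply: measurable_seq_sup => [n|x]; [exact: mf|exists B].
have ig c : mu.-integrable setT (EFin \o g c) by exact: bounded_integrable (gB c).
pose phi c := \int[mu]_x g c x.
have sub c c' : (forall n, exists p, c' p = c n) -> forall x, g c x <= g c' x.
  move=> cc' x; apply: seq_sup_le => n; have [p <-] := cc' n.
  by apply: (seq_sup_ub (u := fun n => f (c' n) x)) => k.
have phi_sub c c' : (forall n, exists p, c' p = c n) -> phi c <= phi c'.
  by move=> cc'; apply: le_Rintegral => // x _; exact: sub.
have ub_phi : has_ubound (range phi).
  exists (\int[mu]_x B) => _ [c _ <-]; apply: le_Rintegral => //.
    exact: (bounded_integrable `|B|).
  by move=> x _; apply: le_trans (gB c x); exact: ler_norm.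
pose s := sup (range phi).
have hs : has_sup (range phi) by split => //; exists (phi (fun=> i0)), (fun=> i0).
have /choice[c Hc] : forall k : nat, exists c, s - k.+1%:R^-1 < phi c.
  move=> k; have k0 : 0 < k.+1%:R^-1 :> R by rewrite invr_gt0.
  by have [_ [c _ <-] h] := sup_adherent k0 hs; exists c.
have [b Hb] := merge_sequences c.
have sb : s <= phi b.
  rewrite leNgt; apply/negP => /ltr_add_invr[k sk].
  have := phi_sub (c k) b (Hb k); move: sk (Hc k).
  by move: (k.+1%:R^-1 : R) => t; lra.
exists b => i.
pose b' n := if n is n'.+1 then b n' else i.
have bb' x : g b x <= g b' x by apply: sub => n; exists n.+1.
have ib' x : f i x <= g b' x.
  by apply: (@seq_sup_ub _ (fun n => f (b' n) x) B 0%N) => k.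
have : phi b' <= phi b.
  by apply: le_trans sb; apply: ub_le_sup => //; exists b'.
move=> phib.
pose h x := g b' x - g b x.
have h0 x : 0 <= h x by rewrite subr_ge0.
have ih : mu.-integrable setT (EFin \o h).
  apply: (bounded_integrable (B + B)); first exact: measurable_funB.
  by move=> x; rewrite (le_trans (ler_normB _ _))// lerD.
have inth : (\int[mu]_x `|(EFin \o h) x| = 0)%E.
  under eq_integral do rewrite /= ger0_norm//.
  rewrite -[LHS]fineK ?integrable_fin_num//; congr _%:E; apply/eqP.
  rewrite eq_le Rintegral_ge0// andbT.
  by have := RintegralB measurableT (ig b') (ig b); rewrite /Rintegral => ->;
    rewrite subr_le0.
have mh : measurable_fun setT (EFin \o h) by exact: measurable_int ih.
have := (ae_eq_integral_abs mu measurableT mh).1 inth.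
apply: filterS => x /(_ Logic.I) [] /eqP; rewrite subr_eq0 => /eqP gbb.
by rewrite -[seq_sup _]/(g b x) -gbb; exact: ib'.
Qed.

(** A countable set of indices that is dense for tau and along which the
    values f are almost surely approximated as well: take, for every ball of a
    countable base, a countable subfamily realizing the essential supremum over
    that ball. *)
Lemma countable_skeleton (I : Type) (tau : I -> I -> R) (q : nat -> I)
    (f : I -> T -> R) (B : R) :
  (forall i j, tau i j = tau j i) ->
  (forall i j k, tau i k <= tau i j + tau j k) ->
  (forall i, tau i i = 0) ->
  (forall i e, 0 < e -> exists j, tau (q j) i < e) ->
  (forall i, measurable_fun setT (f i)) -> (forall i x, `|f i x| <= B) ->
  exists c : nat -> I, forall i, {ae mu, forall x, forall e, 0 < e ->
    exists n, tau (c n) i < e /\ f i x <= f (c n) x + e}.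
Proof.
move=> tauC tauD tau0 dense mf fB.
have /choice[c Hc] : forall p : nat * nat, exists c : nat -> I,
    (forall n, tau (q p.1) (c n) < p.2.+1%:R^-1) /\
    forall i, tau (q p.1) i < p.2.+1%:R^-1 ->
      {ae mu, forall x, f i x <= seq_sup (fun n => f (c n) x)}.
  move=> [j m]/=; have m0 : 0 < m.+1%:R^-1 :> R by rewrite invr_gt0.
  pose J := {i | tau (q j) i < m.+1%:R^-1}.
  have j0 : J by exists (q j); rewrite tau0.
  have [c Hc] := @countable_envelope J (fun i => f (sval i)) B j0
    (fun i => mf _) (fun i => fB _).
  exists (fun n => sval (c n)); split => [n|i ij]; first exact: svalP (c n).
  exact: (Hc (exist _ i ij)).
have Hc' := Hc.
have [b Hb] := merge_sequences (fun k => c (odflt (0, 0)%N (unpickle k))).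
exists b => i.
have {}Hc : {ae mu, forall x, forall p, tau (q p.1) i < p.2.+1%:R^-1 ->
    f i x <= seq_sup (fun n => f (c p n) x)}.
  have : {ae mu, forall x, forall k : nat, let p := odflt (0, 0)%N (unpickle k) in
      tau (q p.1) i < p.2.+1%:R^-1 -> f i x <= seq_sup (fun n => f (c p n) x)}.
    apply: ae_foralln => k /=.
    have [h|h] := pselect (tau (q (odflt (0, 0)%N (unpickle k)).1) i
        < (odflt (0, 0)%N (unpickle k)).2.+1%:R^-1).
      by apply: filterS ((Hc _).2 i h) => x.
    by apply: aeW.
  by apply: filterS => x H p; have := H (pickle p); rewrite /= pickleK.
apply: filterS Hc => x Hx e e0.
have e2 : 0 < e / 2 by rewrite divr_gt0.
have [m] := ltr_add_invr e2; rewrite add0r => me.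
have m0 : 0 < m.+1%:R^-1 :> R by rewrite invr_gt0.
have [j ji] := dense i _ m0.
have [n Hn] := seq_sup_adherent (fun n => f (c (j, m) n) x) e0.
have [p bp] := Hb (pickle (j, m)) n.
rewrite pickleK /= in bp.
exists p; rewrite bp; split; last exact: le_trans (Hx (j, m) ji) (ltW Hn).
apply: le_lt_trans (tauD _ (q j) _) _; rewrite [e]splitr (tauC _ (q j)).
by apply: ltrD; apply: lt_trans me => //; exact: (Hc' (j, m)).1.
Qed.

End countable_subfamilies.

Section essential_suprema.
Context {d} {T : measurableType d} {R : realType}.
Variable mu : {measure set T -> \bar R}.
Implicit Types (F : set (set T)).

(** [esssup] is defined by choice; it has its property as soon as some function
    does. *)
Lemma esssupP F (I : Type) (f : I -> T -> R) g :
  is_esssup mu F f g -> is_esssup mu F f (esssup mu F f).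
Proof. by rewrite /esssup; case: xgetP => [_ -> //|/(_ g)]. Qed.

Lemma is_esssup_unique F (I : Type) (f : I -> T -> R) g h :
  is_esssup mu F f g -> is_esssup mu F f h -> {ae mu, forall x, g x = h x}.
Proof.
move=> [mg fg gmin] [mh fh hmin].
apply: filterS2 (gmin _ mh fh) (hmin _ mg fg) => x gh hg.
by apply/eqP; rewrite eq_le gh hg.
Qed.

Lemma eq_is_esssup F (I : Type) (f f' : I -> T -> R) g :
  (forall i, {ae mu, forall x, f i x = f' i x}) ->
  is_esssup mu F f g -> is_esssup mu F f' g.
Proof.
move=> ff' [mg fg gmin]; split => // [i|g' mg' fg'].
  by apply: filterS2 (ff' i) (fg i) => x ->.
apply: gmin => // i; by apply: filterS2 (ff' i) (fg' i) => x ->.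
Qed.

Lemma is_esssup_seq_sup F (I : Type) (f : I -> T -> R) (c : nat -> I) :
  measurable_wrt F (fun x => seq_sup (fun n => f (c n) x)) ->
  (forall i, {ae mu, forall x, f i x <= seq_sup (fun n => f (c n) x)}) ->
  is_esssup mu F f (fun x => seq_sup (fun n => f (c n) x)).
Proof.
move=> mF fc; split => // g mg fg.
have : {ae mu, forall x, forall n, f (c n) x <= g x} by exact: ae_foralln.
by apply: filterS => x; exact: seq_sup_le.
Qed.

End essential_suprema.

(** * Bounded measurable functions *)

Section bounded_measurable_functions.
Context {d} {T : measurableType d} {R : realType}.
Implicit Types f g : T -> R.

Definition bmf f := measurable_fun setT f /\ exists B, forall x, `|f x| <= B.

Lemma bmf_intro f B : measurable_fun setT f -> (forall x, `|f x| <= B) -> bmf f.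
Proof. by move=> mf fB; split => //; exists B. Qed.

Lemma bmf_cst r : bmf (fun=> r).
Proof. exact: (@bmf_intro _ `|r|). Qed.

Lemma bmfD f g : bmf f -> bmf g -> bmf (fun x => f x + g x).
Proof.
move=> [mf [B fB]] [mg [C gC]]; split; first exact: measurable_funD.
by exists (B + C) => x; rewrite (le_trans (ler_normD _ _))// lerD.
Qed.

Lemma bmfM f g : bmf f -> bmf g -> bmf (fun x => f x * g x).
Proof.
move=> [mf [B fB]] [mg [C gC]]; split; first exact: measurable_funM.
by exists (B * C) => x; rewrite normrM ler_pM.
Qed.

Lemma bmfB f g : bmf f -> bmf g -> bmf (fun x => f x - g x).
Proof.
move=> [mf [B fB]] [mg [C gC]]; split; first exact: measurable_funB.
by exists (B + C) => x; rewrite (le_trans (ler_normB _ _))// lerD.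
Qed.

Lemma bmfX f n : bmf f -> bmf (fun x => f x ^+ n).
Proof.
move=> [mf [B fB]]; split; first exact: measurable_funX.
by exists (B ^+ n) => x; rewrite normrX lerXn2r ?nnegrE// (le_trans _ (fB x)).
Qed.

Lemma bmf_norm f : bmf f -> bmf (fun x => `|f x|).
Proof.
move=> [mf [B fB]]; split; first exact: measurableT_comp.
by exists B => x; rewrite normr_id.
Qed.

Lemma bmf_sum (I : Type) (s : seq I) (f : I -> T -> R) :
  (forall i, bmf (f i)) -> bmf (fun x => \sum_(i <- s) f i x).
Proof.
move=> bf; elim: s => [|i s IH].
  by under eq_fun do rewrite big_nil; exact: bmf_cst.
by under eq_fun do rewrite big_cons; exact: bmfD.
Qed.

Variable mu : {finite_measure set T -> \bar R}.

Lemma bmf_integrable f : bmf f -> mu.-integrable setT (EFin \o f).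
Proof. by move=> [mf [B fB]]; exact: bounded_integrable fB. Qed.

Lemma bmf_RintegralD f g : bmf f -> bmf g ->
  \int[mu]_x (f x + g x) = \int[mu]_x f x + \int[mu]_x g x.
Proof. by move=> bf bg; rewrite RintegralD//; exact: bmf_integrable. Qed.

Lemma bmf_RintegralB f g : bmf f -> bmf g ->
  \int[mu]_x (f x - g x) = \int[mu]_x f x - \int[mu]_x g x.
Proof. by move=> bf bg; rewrite RintegralB//; exact: bmf_integrable. Qed.

Lemma bmf_RintegralZl f r : bmf f -> \int[mu]_x (r * f x) = r * \int[mu]_x f x.
Proof. by move=> bf; rewrite RintegralZl//; exact: bmf_integrable. Qed.

Lemma bmf_Rintegral_sum (I : Type) (s : seq I) (f : I -> T -> R) :
  (forall i, bmf (f i)) ->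
  \int[mu]_x (\sum_(i <- s) f i x) = \sum_(i <- s) \int[mu]_x f i x.
Proof.
move=> bf; elim: s => [|i s IH].
  rewrite big_nil; under eq_Rintegral do rewrite big_nil.
  by rewrite Rintegral_cst// mul0r.
rewrite big_cons -IH; under eq_Rintegral do rewrite big_cons.
by rewrite bmf_RintegralD//; exact: bmf_sum.
Qed.

Lemma bmf_le_Rintegral f g : bmf f -> bmf g -> (forall x, f x <= g x) ->
  \int[mu]_x f x <= \int[mu]_x g x.
Proof. by move=> bf bg fg; apply: le_Rintegral => //; exact: bmf_integrable. Qed.

Lemma bmf_EFin_Rintegral f : bmf f ->
  (\int[mu]_x (f x)%:E = (\int[mu]_x f x)%:E)%E.
Proof.
by move=> bf; rewrite /Rintegral fineK//; apply: integrable_fin_num => //;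
  exact: bmf_integrable.
Qed.

Lemma bmf_eq_Rintegral_ae f g : bmf f -> bmf g ->
  {ae mu, forall x, f x = g x} -> \int[mu]_x f x = \int[mu]_x g x.
Proof.
move=> [mf _] [mg _] fg; rewrite /Rintegral; congr fine.
apply: ae_eq_integral => //; [exact/measurable_EFinP|exact/measurable_EFinP|].
by apply: filterS fg => x /= -> _.
Qed.

End bounded_measurable_functions.

Lemma Rintegral_bound {d} {T : measurableType d} {R : realType}
  (P : probability T R) (f : T -> R) (B : R) : measurable_fun setT f ->
  (forall x, `|f x| <= B) -> `|\int[P]_x f x| <= B.
Proof.
move=> mf fB; have bf : bmf f by exact: bmf_intro fB.
have intB r : \int[P]_x r = r.
  by rewrite Rintegral_cst//= probability_setT mulr1.
have fB' x : - B <= f x <= B by rewrite -ler_norml.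
rewrite ler_norml; apply/andP; split.
  rewrite -(intB (- B)); apply: bmf_le_Rintegral => //; first exact: bmf_cst.
  by move=> x; have /andP[] := fB' x.
rewrite -[leRHS](intB B); apply: bmf_le_Rintegral => //; first exact: bmf_cst.
by move=> x; have /andP[] := fB' x.
Qed.

(** * Euclidean vectors *)

Section vectors.
Context {R : realType} {K : nat}.
Implicit Types u v w : 'cV[R]_K.

Lemma dotvBl u v w : dotv (u - v) w = dotv u w - dotv v w.
Proof. by rewrite /dotv -sumrB; apply: eq_bigr => i _; rewrite !mxE mulrBl. Qed.

Lemma enorm_ge0 u : 0 <= enorm u.
Proof. exact: sqrtr_ge0. Qed.

Lemma sqr_enorm u : enorm u ^+ 2 = \sum_i u i ord0 ^+ 2.
Proof. by rewrite sqr_sqrtr// sumr_ge0// => i _; exact: sqr_ge0. Qed.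

(** Lagrange's trick: the square of |v| u - |u| v is nonnegative. *)
Lemma dotv_le_enorm u v : `|dotv u v| <= enorm u * enorm v.
Proof.
have key a b : 0 <= a ^+ 2 * enorm u ^+ 2 + b ^+ 2 * enorm v ^+ 2
    - 2 * (a * b) * dotv u v.
  rewrite [leRHS](_ : _ = \sum_i (a * u i ord0 - b * v i ord0) ^+ 2).
    by apply: sumr_ge0 => i _; exact: sqr_ge0.
  rewrite !sqr_enorm /dotv !mulr_sumr -big_split/= -sumrB.
  by apply: eq_bigr => i _; ring.
have eu := enorm_ge0 u; have ev := enorm_ge0 v.
have z w w' : enorm w = 0 -> dotv w w' = 0 /\ dotv w' w = 0.
  move=> /eqP; rewrite sqrtr_eq0 => w0.
  have /eqP : \sum_i w i ord0 ^+ 2 = 0.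
    by apply: le_anti; rewrite w0 sumr_ge0// => i _; exact: sqr_ge0.
  rewrite psumr_eq0 => [/allP H|i _]; last exact: sqr_ge0.
  have wi i : w i ord0 = 0.
    by apply/eqP; rewrite -sqrf_eq0; apply: H; rewrite mem_index_enum.
  by split; apply: big1 => i _; rewrite wi ?mul0r ?mulr0.
have [u0|u0] := eqVneq (enorm u) 0.
  by rewrite (z u v u0).1 normr0 mulr_ge0.
have [v0|v0] := eqVneq (enorm v) 0.
  by rewrite (z v u v0).2 normr0 mulr_ge0.
have uv0 : 0 < enorm u * enorm v by rewrite mulr_gt0// lt_def ?u0 ?v0.
rewrite ler_norml; apply/andP; split.
  have := key (enorm v) (- enorm u).
  rewrite [X in 0 <= X](_ : _ = 2 * (enorm u * enorm v) * (enorm u * enorm v + dotv u v)).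
    rewrite pmulr_rge0; last exact: mulr_gt0.
    by move: (enorm u * enorm v) (dotv u v) => p q; lra.
  by ring.
have := key (enorm v) (enorm u).
rewrite [X in 0 <= X](_ : _ = 2 * (enorm u * enorm v) * (enorm u * enorm v - dotv u v)).
  by rewrite pmulr_rge0 ?subr_ge0//; exact: mulr_gt0.
by ring.
Qed.

Lemma coord_le_maxnorm u i : `|u i ord0| <= maxnorm u.
Proof. by rewrite /maxnorm; exact: (le_bigmax_cond _ (fun i => `|u i ord0|)). Qed.

Lemma enorm_le u (B : R) : (forall i, `|u i ord0| <= B) ->
  enorm u <= Num.sqrt K%:R * `|B|.
Proof.
move=> uB; rewrite -(sqrtr_sqr B) -sqrtrM// ler_wsqrtr//.
apply: (@le_trans _ _ (\sum_(i < K) B ^+ 2)).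
  apply: ler_sum => i _; rewrite -(real_normK (num_real (u i ord0))).
  by rewrite lerXn2r ?nnegrE ?(le_trans _ (uB i)).
by rewrite sumr_const card_ord mulr_natl.
Qed.

End vectors.

(** * Least-squares regression *)

Section least_squares.
Context {d} {S : measurableType d} {R : realType} {K : nat}.
Variables (mu : probability S R) (gam : S -> 'cV[R]_K).
Hypothesis bgam : forall i, bmf (fun x => gam x i ord0).

Let G : 'M[R]_K := \matrix_(i, j) \int[mu]_x (gam x i ord0 * gam x j ord0).
Hypothesis Gunit : G \in unitmx.

Definition dual_basis (x : S) : 'cV[R]_K := invmx G *m gam x.

Definition projection_coef (f : S -> R) : 'cV[R]_K :=
  \col_k \int[mu]_x (dual_basis x k ord0 * f x).

Lemma bmf_dual_basis k : bmf (fun x => dual_basis x k ord0).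
Proof.
under eq_fun do rewrite mxE.
by apply: bmf_sum => j; apply: bmfM => //; exact: bmf_cst.
Qed.

Lemma bmf_dotv b : bmf (fun x => dotv b (gam x)).
Proof. by apply: bmf_sum => i; apply: bmfM => //; exact: bmf_cst. Qed.

Lemma mulmx_gram b i : (G *m b) i ord0 = \int[mu]_x (gam x i ord0 * dotv b (gam x)).
Proof.
rewrite mxE /dotv; under [RHS]eq_Rintegral do rewrite mulr_sumr.
rewrite bmf_Rintegral_sum; last first.
  by move=> j; apply: bmfM => //; apply: bmfM => //; exact: bmf_cst.
apply: eq_bigr => j _; rewrite mxE mulrC -bmf_RintegralZl; last exact: bmfM.
by apply: eq_Rintegral => x _; ring.
Qed.

Lemma mulmx_gram_projection f i : bmf f ->
  (G *m projection_coef f) i ord0 = \int[mu]_x (gam x i ord0 * f x).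
Proof.
move=> bf; have bdf k : bmf (fun x => dual_basis x k ord0 * f x).
  by apply: bmfM => //; exact: bmf_dual_basis.
rewrite mxE (eq_bigr (fun j => \int[mu]_x (G i j * (dual_basis x j ord0 * f x)))).
  rewrite -bmf_Rintegral_sum; last by move=> j; apply: bmfM => //; exact: bmf_cst.
  apply: eq_Rintegral => x _; under eq_bigr do rewrite mulrA.
  rewrite -mulr_suml; congr (_ * _).
  have : (G *m dual_basis x) i ord0 = gam x i ord0 by rewrite /dual_basis mulKVmx.
  by rewrite mxE.
by move=> j _; rewrite [X in _ * X]mxE bmf_RintegralZl.
Qed.

Definition risk (f : S -> R) (b : 'cV[R]_K) : R :=
  \int[mu]_x ((dotv b (gam x) - f x) ^+ 2).

Lemma EFin_risk f b : bmf f ->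
  (\int[mu]_x ((dotv b (gam x) - f x) ^+ 2)%:E = (risk f b)%:E)%E.
Proof.
move=> bf; rewrite bmf_EFin_Rintegral//.
by apply: bmfX; apply: bmfB => //; exact: bmf_dotv.
Qed.

(** Pythagoras: the residual of the projection is orthogonal to the span. *)
Lemma risk_projection f b : bmf f ->
  risk f b = risk f (projection_coef f)
             + \int[mu]_x (dotv (b - projection_coef f) (gam x) ^+ 2).
Proof.
move=> bf; set p := projection_coef f; set e := b - p.
have bres : bmf (fun x => dotv p (gam x) - f x) by apply: bmfB => //; exact: bmf_dotv.
have be := bmf_dotv e.
have cross : \int[mu]_x ((dotv p (gam x) - f x) * dotv e (gam x)) = 0.
  rewrite /dotv; under eq_Rintegral do rewrite mulr_sumr.
  rewrite bmf_Rintegral_sum; last first.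
    by move=> i; apply: bmfM => //; apply: bmfM => //; exact: bmf_cst.
  apply: big1 => i _.
  transitivity (e i ord0 * \int[mu]_x (gam x i ord0 * dotv p (gam x)
                                       - gam x i ord0 * f x)).
    rewrite -bmf_RintegralZl; last first.
      by apply: bmfB; apply: bmfM => //; exact: bmf_dotv.
    by apply: eq_Rintegral => x _; rewrite /dotv; ring.
  rewrite bmf_RintegralB; [|by apply: bmfM => //; exact: bmf_dotv|exact: bmfM].
  by rewrite -mulmx_gram -mulmx_gram_projection// subrr mulr0.
have b1 := bmfX 2 bres; have b2 := bmfX 2 be.
have b3 : bmf (fun x => 2 * ((dotv p (gam x) - f x) * dotv e (gam x))).
  by apply: bmfM; [exact: bmf_cst|exact: bmfM].
rewrite /risk -[RHS]addr0 -(mulr0 2) -cross -bmf_RintegralZl; last exact: bmfM.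
rewrite -(bmf_RintegralD mu b1 b2) -(bmf_RintegralD mu (bmfD b1 b2) b3).
apply: eq_Rintegral => x _.
have -> : dotv b (gam x) = dotv e (gam x) + dotv p (gam x).
  by rewrite /e dotvBl subrK.
ring.
Qed.

Lemma risk_minimizer f b : bmf f ->
  (forall b', risk f b <= risk f b') <-> b = projection_coef f.
Proof.
move=> bf; set p := projection_coef f; split => [minb|-> b']; last first.
  by rewrite (risk_projection b')// lerDl Rintegral_ge0// => x _; exact: sqr_ge0.
have be := bmf_dotv (b - p).
have e0 : \int[mu]_x (dotv (b - p) (gam x) ^+ 2) = 0.
  apply/eqP; rewrite eq_le Rintegral_ge0 ?andbT; last first.
    by move=> x _; exact: sqr_ge0.
  by have := minb p; rewrite (risk_projection b)// gerDl.
have ae0 : {ae mu, forall x, dotv (b - p) (gam x) = 0}.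
  have := (ae_eq_integral_abs mu measurableT
    (f := fun x => (dotv (b - p) (gam x) ^+ 2)%:E) _).1.
  move=> H; have {}H := H (measurable_sqr_EFin be.1) _.
  have int0 : (\int[mu]_x `|(dotv (b - p) (gam x) ^+ 2)%:E| = 0)%E.
    under eq_integral do rewrite gee0_abs ?lee_fin ?sqr_ge0//.
    by rewrite bmf_EFin_Rintegral ?e0//; exact: bmfX.
  apply: filterS (H int0) => x /(_ Logic.I) [] /eqP.
  by rewrite sqrf_eq0 => /eqP.
have : G *m (b - p) = 0.
  apply/matrixP => i j; rewrite [j]ord1 mulmx_gram mxE.
  rewrite (@bmf_eq_Rintegral_ae _ _ _ _ _ (fun=> 0)).
  - by rewrite Rintegral_cst// mul0r.
  - by apply: bmfM => //; exact: bmf_dotv.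
  - exact: bmf_cst.
  - by apply: filterS ae0 => x ->; rewrite mulr0.
move=> /(congr1 (mulmx (invmx G))); rewrite mulKmx// mulmx0 => /eqP.
by rewrite subr_eq0 => /eqP.
Qed.

End least_squares.

(** * Kernels and policies *)

Section kernel_integrals.
Context {d1 d2 d3} {X : measurableType d1} {Y : measurableType d2}
  {Z : measurableType d3} {R : realType}.

Lemma bmf_kernel (k : R.-pker X ~> Y) (f : Y -> R) : bmf f ->
  bmf (fun x => \int[k x]_y f y).
Proof.
move=> bf; have [mf [B fB]] := bf.
have kE x : \int[k x]_y f y = \int[kernel_at k x]_y f y by [].
apply: (@bmf_intro _ _ _ _ B) => [|x]; last by rewrite kE; exact: Rintegral_bound.
pose g y := f y + B.
have g0 y : 0 <= g y by have := fB y; rewrite /g ler_norml => /andP[]; lra.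
have bg : bmf g by apply: bmfD => //; exact: bmf_cst.
have -> : (fun x => \int[k x]_y f y) =
    (fun x => fine (\int[k x]_y (g y)%:E)%E - B).
  apply/funext => x; rewrite -[fine _]/(\int[kernel_at k x]_y g y).
  rewrite bmf_RintegralD//; last exact: bmf_cst.
  by rewrite [\int[_]__ B]Rintegral_cst//= prob_kernel mulr1 addrK.
apply: measurable_funB => //; apply: measurableT_comp => //.
apply: measurable_fun_integral_kernel => //.
- by move=> U mU; exact: measurable_kernel.
- by apply/measurable_EFinP; exact: bg.1.
Qed.

Lemma Rintegral_pkcomp (l : R.-pker X ~> Y) (k : R.-pker (X * Y) ~> Z)
    (f : Z -> R) x : bmf f -> (forall z, 0 <= f z) ->
  \int[pkcomp l k x]_z f z = \int[l x]_y \int[k (x, y)]_z f z.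
Proof.
move=> bf f0; rewrite {1 2}/Rintegral; congr fine.
rewrite [LHS]integral_kcomp//; last by apply/measurable_EFinP; exact: bf.1.
apply: eq_integral => y _.
exact: (bmf_EFin_Rintegral (kernel_at k (x, y)) bf).
Qed.

Lemma Rintegral_pkcomp_noparam (l : R.-pker X ~> Y) (k : R.-pker Y ~> Z)
    (f : Z -> R) x : bmf f -> (forall z, 0 <= f z) ->
  \int[pkcomp_noparam l k x]_z f z = \int[l x]_y \int[k y]_z f z.
Proof.
move=> bf f0; rewrite {1 2}/Rintegral; congr fine.
transitivity (\int[kcomp l (kernel.kernel_snd k) x]_z (f z)%:E)%E; first by [].
rewrite [LHS]integral_kcomp//; last by apply/measurable_EFinP; exact: bf.1.
apply: eq_integral => y _.
exact: (bmf_EFin_Rintegral (kernel_at k y) bf).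
Qed.

Lemma Rintegral_kdirac (g : X -> Y) (mg : measurable_fun setT g) (f : Y -> R) x :
  measurable_fun setT f -> \int[kdirac mg x]_y f y = f (g x).
Proof.
move=> mf; rewrite /Rintegral [X in fine X]integral_dirac//; last exact/measurable_EFinP.
by rewrite diracT mul1e.
Qed.

(** Nearly maximizing over countably many options can be done measurably: pick
    the first one that is good enough. *)
Lemma measurable_near_argmax (u : nat -> X -> R) (c : nat -> Y) (e : R) :
  (forall n, measurable_fun setT (u n)) ->
  (forall x, exists B, forall n, u n x <= B) -> 0 < e ->
  exists2 g : X -> Y, measurable_fun setT g &
    forall x, exists n, g x = c n /\ seq_sup (u^~ x) < u n x + e.
Proof.
move=> mu uB e0.
pose good n x := seq_sup (u^~ x) < u n x + e.
have exg x : exists n, good n x by exact: seq_sup_adherent.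
pose N x := ex_minn (exg x).
have NP x : good (N x) x by rewrite /N; case: ex_minnP.
have Nmin x k : (k < N x)%N -> ~~ good k x.
  by rewrite /N; case: ex_minnP => m _ min; rewrite ltnNge; apply: contra => /min.
have mgood n : measurable [set x | good n x].
  rewrite (_ : [set _ | _] = (fun x => u n x + e - seq_sup (u^~ x)) @^-1` `]0, +oo[%classic).
    rewrite -[X in measurable X]setTI; apply: measurable_funB => //.
      exact: measurable_funD.
    exact: measurable_seq_sup.
  by apply/seteqP; split => x /=; rewrite in_itv/= andbT subr_gt0.
have mN k : measurable [set x | N x = k].
  rewrite (_ : [set _ | _] = [set x | good k x] `&`
      \bigcap_(j in [set j | (j < k)%N]) ~` [set x | good j x]).
    apply: measurableI => //; apply: bigcap_measurableType => j _.
    exact: measurableC.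
  apply/seteqP; split => [x <-|x [gk gj]].
    by split; [exact: NP|move=> j /= /Nmin /negP].
  apply/eqP; rewrite eqn_leq; apply/andP; split.
    by rewrite /N; case: ex_minnP => m _; exact.
  by rewrite leqNgt; apply/negP => /gj; apply; exact: NP.
exists (fun x => c (N x)); last first.
  by move=> x; exists (N x); split => //; exact: NP.
move=> _ B mB; rewrite setTI.
rewrite (_ : _ @^-1` B = \bigcup_(k in [set k | B (c k)]) [set x | N x = k]).
  exact: bigcup_measurable.
by apply/seteqP; split => [x Bx|x [k Bk /= Nk]];
  [exists (N x)|rewrite /preimage/= Nk].
Qed.

End kernel_integrals.

Section policies.
Context {dS dA} {S : measurableType dS} {A : measurableType dA} {R : realType}.
Variable M : mdp S A R.
Local Notation H := (horizon M).

Definition det_policy (g : nat -> S -> A)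
  (mg : forall h, measurable_fun setT (g h)) : @policy _ _ S A R := fun h => kdirac (mg h).

Lemma Rintegral_step g mg h (f : S -> R) x : bmf f -> (forall y, 0 <= f y) ->
  \int[step M (@det_policy g mg) h x]_y f y = \int[trans M h.+1 (x, g h x)]_y f y.
Proof.
move=> bf f0; rewrite [LHS]Rintegral_pkcomp//.
rewrite [LHS]Rintegral_kdirac//.
have [+ _] := bmf_kernel (trans M h.+1) bf.
move=> mk; exact: (measurable_fun_pair2 _ mk).
Qed.

(** The contribution to the error at time h of an error made at time l; the case
    l = h is separate because [multistep] makes at least one step. *)
Definition propagated (pi : policy) (err : nat -> S -> R) h l x : R :=
  if (h < l)%N then \int[multistep M pi (l - h.+1) h x]_y err l y else err h x.

Lemma bmf_propagated pi err h l : (forall h, bmf (err h)) ->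
  bmf (propagated pi err h l).
Proof.
move=> be; rewrite /propagated; case: (h < l)%N => //.
exact: (bmf_kernel (multistep M pi (l - h.+1) h) (be l)).
Qed.

Lemma propagated_step pi err h l x : (forall h, bmf (err h)) ->
  (forall h y, 0 <= err h y) -> (h < l)%N ->
  propagated pi err h l x = \int[step M pi h x]_y propagated pi err h.+1 l y.
Proof.
move=> be e0 hl; rewrite /propagated hl; have [hl1|lh] := ltnP h.+1 l.
  rewrite -(subnSK hl1) [LHS]Rintegral_pkcomp_noparam//.
by rewrite (_ : l = h.+1) ?subnn//; apply/eqP; rewrite eqn_leq lh hl.
Qed.

(** Each use of the recursion integrates the bound for the next time against one
    more transition of the policy, which lengthens all the products by one. *)
Lemma unroll_recursion (pi : policy) (Dn err : nat -> S -> R) (e : R) :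
  (forall h, bmf (Dn h)) -> (forall h, bmf (err h)) ->
  (forall h x, 0 <= err h x) -> (forall x, Dn H x = 0) ->
  (forall h x, (h < H)%N ->
    Dn h x <= \int[step M pi h x]_y Dn h.+1 y + err h x + e) ->
  forall h x, (h <= H)%N ->
    Dn h x <= \sum_(h <= l < H) propagated pi err h l x + (H - h)%:R * e.
Proof.
move=> bD be e0 DH rec h + hH.
have [n] : exists n, n = (H - h)%N by exists (H - h)%N.
elim: n h hH => [|n IH] h hH nE x.
  have -> : h = H by apply/eqP; rewrite eqn_leq hH -subn_eq0 -nE.
  by rewrite DH big_geq// subnn mul0r addr0.
have hltH : (h < H)%N by rewrite -subn_gt0 -nE.
have IHh := IH h.+1 hltH.
have nE' : n = (H - h.+1)%N by apply: succn_inj; rewrite nE subnSK.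
have {}nE : (H - h)%N = (H - h.+1).+1 by rewrite subnSK.
apply: (le_trans (rec _ _ hltH)).
pose rhs y := \sum_(h.+1 <= l < H) propagated pi err h.+1 l y + (H - h.+1)%:R * e.
have bp l : bmf (propagated pi err h.+1 l) by exact: bmf_propagated.
have brhs : bmf rhs by apply: bmfD; [exact: bmf_sum|exact: bmf_cst].
have le1 : \int[step M pi h x]_y Dn h.+1 y <= \int[kernel_at (step M pi h) x]_y rhs y.
  apply: (@bmf_le_Rintegral _ _ _ (kernel_at (step M pi h) x)) => // y.
  exact: IHh.
rewrite -addrA; apply: le_trans (lerD le1 (lexx _)) _.
rewrite bmf_RintegralD//; [|exact: bmf_sum|exact: bmf_cst].
rewrite bmf_Rintegral_sum// [\int[_]__ (_ * e)]Rintegral_cst//= prob_kernel mulr1.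
rewrite [in leRHS]big_ltn// nE -natr1 mulrDl mul1r.
rewrite [propagated pi err h h x]/propagated ltnn.
rewrite [X in X + _ + _ <= _](_ : _ = \sum_(h.+1 <= l < H) propagated pi err h l x).
  lra.
by apply: eq_big_nat => l /andP[hl _]; apply: esym; exact: propagated_step.
Qed.

End policies.

(** * Change of measure and error propagation *)

Lemma sqre_ge0 {R : realType} (x : \bar R) : (0 <= x ^+ 2)%E.
Proof.
rewrite expe2; case: x => [r| |]; rewrite ?mulyy ?mulNyNy ?leey//.
by rewrite -EFinM lee_fin -expr2 sqr_ge0.
Qed.

Section density.
Context {d} {T : measurableType d} {R : realType}.

Lemma Lnorm2 (mu : {measure set T -> \bar R}) (f : T -> R) :
  ('N[mu]_2%:E[EFin \o f] = sqrte (\int[mu]_x (f x ^+ 2)%:E))%E.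
Proof.
rewrite unlock/= poweR12_sqrt; last first.
  by apply: integral_ge0 => x _; rewrite lee_fin powR_ge0.
congr sqrte; apply: eq_integral => x _ /=.
by rewrite powR_mulrn// real_normK// num_real.
Qed.

(** Cauchy-Schwarz against the density of Q with respect to mu. *)
Lemma Rintegral_density (Q mu : probability T R) (f : T -> R) (b : R) :
  Q `<< mu -> bmf f -> (forall x, 0 <= f x) -> L2_le mu f b ->
  ((\int[Q]_y f y)%:E <= b%:E *
    sqrte (\int[mu]_y (Radon_Nikodym (charge_of_finite_measure Q) mu y ^+ 2)))%E.
Proof.
move=> Qmu bf f0 [mf b0 fb].
set r := Radon_Nikodym _ _.
have Qmu' : charge_of_finite_measure Q `<< mu by [].
have rfin y : r y \is a fin_num by exact: Radon_Nikodym_fin_num.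
have mr : measurable_fun setT r.
  exact: measurable_int (Radon_Nikodym_integrable Qmu').
pose g y := fine (r y).
have gE y : r y = (g y)%:E by rewrite fineK.
have mg : measurable_fun setT g by apply: measurableT_comp.
have iQ : Q.-integrable setT (EFin \o f) by exact: bmf_integrable.
have half2 : 2^-1 + 2^-1 = 1 :> R by lra.
have := hoelder mu mf mg (ltr0n _ 2) (ltr0n _ 2) half2.
rewrite !Lnorm2 Lnorm1 => CS.
rewrite -bmf_EFin_Rintegral// -(Radon_Nikodym_change_of_variables Qmu measurableT iQ).
apply: (@le_trans _ _ (\int[mu]_x `|(EFin \o (f \* g)%R) x|)%E).
  apply: (le_trans (lee_abs _)).
  apply: le_trans (le_abse_integral _ measurableT _) _.
    by apply: emeasurable_funM => //; exact/measurable_EFinP.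
  by rewrite (eq_integral (fun x => `|(EFin \o (f \* g)%R) x|)%E)// => x _;
    rewrite -[Radon_Nikodym _ _]/r gE.
apply: (le_trans CS); apply: lee_pmul; rewrite ?sqrte_ge0//.
  rewrite -[b%:E](_ : sqrte (b ^+ 2)%:E = _) ?lee_sqrt ?lee_fin ?sqr_ge0//.
  by rewrite /= sqrtr_sqr ger0_norm.
rewrite [X in (_ <= sqrte X)%E](eq_integral (fun x => (g x ^+ 2)%:E))// => x _.
by rewrite gE -EFin_expe.
Qed.

End density.

Section error_propagation.
Context {dS dA} {S : measurableType dS} {A : measurableType dA} {R : realType}.
Variables (M : mdp S A R) (K : nat) (D : regression S R K).
Local Notation H := (horizon M).
Hypothesis dominated : transitions_dominated M D.

Lemma step_dominated pi h x : (h < H)%N -> step M pi h x `<< ref D h.+1.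
Proof.
move=> hH; apply/null_content_dominatesP => B mB B0.
apply: integral0_eq => a _; have := @dominated h.+1 hH x a.
by move=> /null_content_dominatesP/(_ B mB B0).
Qed.

Lemma multistep_dominated pi n h x : (h + n < H)%N ->
  multistep M pi n h x `<< ref D (h + n).+1.
Proof.
elim: n h x => [|n IH] h x hH; first by rewrite addn0 in hH *; exact: step_dominated.
apply/null_content_dominatesP => B mB B0; apply: integral0_eq => y _.
rewrite addnS -addSn in hH B0; have := IH h.+1 y hH.
by move=> /null_content_dominatesP/(_ B mB B0).
Qed.

Lemma multistep_dominated_at pi h l x : (h < l < H)%N ->
  kernel_at (multistep M pi (l - h.+1) h) x `<< ref D l.
Proof.
move=> /andP[hl lH].
have lE : (h + (l - h.+1)).+1 = l by rewrite -addSn subnKC.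
have := @multistep_dominated pi (l - h.+1) h x; rewrite lE; apply.
exact: ltnW.
Qed.

(** A density has L2 norm at least its L1 norm, which is one. *)
Lemma Rfrak_max_ge1 : (1 <= Rfrak_max M D)%E.
Proof.
rewrite /Rfrak_max; case: ifPn => // H1.
pose pi : @policy _ _ S A R := det_policy (fun=> @measurable_cst _ _ S A setT point).
apply: le_ereal_sup_tmp; eexists; first by exists 0%N, 1%N, pi; split; [rewrite H1|].
rewrite -{1}(_ : sqrte 1 = 1)%E ?sqrtr1 ?lee_sqrt//; last by rewrite /= sqrtr1.
  apply: (@le_trans _ _ (\int[ref D 0]_x 1)%E).
    by rewrite integral_cst//= probability_setT mule1.
  apply: le_integral_nonmeasurable => // x.
  have b1 : @bmf _ S R (fun=> 1) by exact: bmf_cst.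
  have L1 : L2_le (ref D 1) (fun=> 1 : R) 1.
    by have := L2_le_cst (ref D 1) (1 : R); rewrite normr1.
  have := Rintegral_density (@multistep_dominated_at pi 0 1 x _) b1 (fun=> ler01) L1.
  rewrite H1 => /(_ isT); rewrite Rintegral_cst//= probability_setT mulr1 mul1e.
  rewrite -{1}(_ : sqrte 1 = 1)%E ?lee_sqrt//; last by rewrite /= sqrtr1.
  by apply: integral_ge0 => y _; exact: sqre_ge0.
by apply: integral_ge0 => x _; apply: integral_ge0 => y _; exact: sqre_ge0.
Qed.

(** Cauchy-Schwarz at every starting point, and then integration over the starting
    point; the two integrals are compared as integrals of arbitrary nonnegative
    functions, because the densities come without joint measurability. *)
Lemma L2_propagated (rho : R) (pi : policy) (err : nat -> S -> R) h l e :
  Rfrak_max M D = rho%:E -> (h < l < H)%N -> (forall h, bmf (err h)) ->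
  (forall h y, 0 <= err h y) -> L2_le (ref D l) (err l) e ->
  L2_le (ref D h) (propagated M pi err h l) (rho * e).
Proof.
move=> rhoE hlH be err0 Le; have [_ e0 _] := Le.
have mP := (bmf_propagated M pi h l be).1.
have /andP[hl lH] := hlH.
have H1 : (1 < H)%N by exact: leq_ltn_trans (leq_ltn_trans (leq0n h) hl) lH.
pose G x := (\int[ref D l]_y (policy_density M D pi h l x y ^+ 2))%E.
have G0 x : (0 <= G x)%E by apply: integral_ge0 => y _; exact: sqre_ge0.
have P0 x : 0 <= propagated M pi err h l x.
  by rewrite /propagated hl; apply: Rintegral_ge0.
have bound x : ((propagated M pi err h l x)%:E <= e%:E * sqrte (G x))%E.
  have := Rintegral_density (multistep_dominated_at pi x hlH) (be l) (err0 l) Le.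
  by rewrite /propagated hl.
have rho0 : 0 <= rho.
  by rewrite -lee_fin -rhoE; apply: le_trans Rfrak_max_ge1; rewrite lee_fin.
have [e_eq0|en0] := eqVneq e 0.
  split => //; first exact: mulr_ge0.
  rewrite integral0_eq ?lee_fin ?sqr_ge0// => x _.
  have := bound x; rewrite e_eq0 mul0e lee_fin => /(conj (P0 x))/andP.
  by rewrite -eq_le => /eqP <-; rewrite expr0n.
have e_gt0 : 0 < e by rewrite lt_def en0.
suff L : L2_le (ref D h) (fun x => e^-1 * propagated M pi err h l x) rho.
  have := L2_le_scale e L; rewrite ger0_norm// [e * rho]mulrC.
  by under eq_fun do rewrite mulVKf//.
split => //; first exact: measurable_funM.
apply: (@le_trans _ _ (\int[ref D h]_x G x)%E).
  apply: le_integral_nonmeasurable => x; first by rewrite lee_fin sqr_ge0.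
  rewrite -lee_sqrt// /= sqrtr_sqr ger0_norm; last first.
    by rewrite mulr_ge0// invr_ge0.
  by rewrite EFinM lee_pdivrMl// -EFinM.
rewrite -lee_sqrt ?lee_fin ?sqr_ge0// /= sqrtr_sqr ger0_norm// -rhoE.
rewrite /Rfrak_max H1; apply: ereal_sup_ubound.
by exists h, l, pi.
Qed.

(** A pointwise one-step recursion for the error gives a bound for its norm:
    choose a policy that nearly realizes the suprema, unroll the recursion, and
    bring every propagated term back to its own reference measure. *)
Lemma error_propagation (rho : R) (c : nat -> nat -> A) (Dn err : nat -> S -> R)
    (e : nat -> R) : Rfrak_max M D = rho%:E ->
  (forall h, bmf (Dn h)) -> (forall h, bmf (err h)) ->
  (forall h x, 0 <= Dn h x) -> (forall h x, 0 <= err h x) ->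
  (forall x, Dn H x = 0) ->
  (forall h x, (h < H)%N -> Dn h x <=
     seq_sup (fun n => \int[trans M h.+1 (x, c h n)]_y Dn h.+1 y) + err h x) ->
  forall h, (h <= H)%N ->
    (forall l, (h <= l < H)%N -> L2_le (ref D l) (err l) (e l)) ->
    L2_le (ref D h) (Dn h) (rho * \sum_(h <= l < H) e l).
Proof.
move=> rhoE bD be D0 err0 DH rec h hH Le.
have rho1 : 1 <= rho by rewrite -lee_fin -rhoE Rfrak_max_ge1.
have key d : 0 < d ->
    L2_le (ref D h) (Dn h) (rho * \sum_(h <= l < H) e l + (H - h)%:R * d).
  move=> d0.
  have bK k n : bmf (fun x => \int[trans M k.+1 (x, c k n)]_y Dn k.+1 y).
    have [mk [B HB]] := bmf_kernel (trans M k.+1) (bD k.+1).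
    split; first exact: (measurable_fun_pair1 _ mk).
    by exists B => x; exact: HB.
  have /choice[g Hg] : forall k, exists g : S -> A, measurable_fun setT g /\
      forall x, exists n, g x = c k n /\
        seq_sup (fun n => \int[trans M k.+1 (x, c k n)]_y Dn k.+1 y) <
        \int[trans M k.+1 (x, c k n)]_y Dn k.+1 y + d.
    move=> k; have [] := @measurable_near_argmax _ _ S A R
      (fun n x => \int[trans M k.+1 (x, c k n)]_y Dn k.+1 y) (c k) d.
    - by move=> n; exact: (bK k n).1.
    - move=> x; have [_ [B HB]] := bmf_kernel (trans M k.+1) (bD k.+1).
      by exists B => n; apply: le_trans (HB (x, c k n)); exact: ler_norm.
    - exact: d0.
    - by move=> g mg Hg; exists g.
  pose pi : @policy _ _ S A R := det_policy (fun k => (Hg k).1).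
  have unroll x := @unroll_recursion _ _ _ _ _ M pi Dn err d bD be err0 DH _ h x hH.
  have rec' k x : (k < H)%N ->
      Dn k x <= \int[step M pi k x]_y Dn k.+1 y + err k x + d.
    move=> kH; apply: (le_trans (rec k x kH)).
    rewrite Rintegral_step//; have [n [-> hn]] := (Hg k).2 x.
    by move: hn; move: (seq_sup _) (Rintegral _ _ _) => p q; lra.
  have sumL : L2_le (ref D h)
      (fun x => \sum_(h <= l < H) propagated M pi err h l x + (H - h)%:R * d)
      (\sum_(h <= l < H) rho * e l + (H - h)%:R * d).
    apply: L2_le_add; last first.
      have := L2_le_cst (ref D h) ((H - h)%:R * d).
      by rewrite ger0_norm// mulr_ge0// ltW.
    apply: (L2_le_sum (b := fun l => rho * e l)) => l.
    rewrite mem_index_iota => hlH; have Ll := Le l hlH.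
    move: hlH => /andP[hl lH]; have [lth|leh] := ltnP h l.
      by apply: L2_propagated => //; rewrite lth.
    have {leh}lE : l = h by apply/eqP; rewrite eqn_leq leh hl.
    move: Ll; rewrite lE /propagated ltnn => Lh; have [_ eh _] := Lh.
    by apply: L2_le_ler Lh; rewrite ler_peMl.
  rewrite mulr_sumr; apply: L2_le_mono sumL; first exact: (bD h).1.
  move=> x; rewrite ger0_norm//; apply: le_trans (ler_norm _).
  exact: unroll.
apply: L2_le_lim => [|d d0].
  apply: mulr_ge0; first exact: le_trans rho1.
  rewrite big_nat; apply: sumr_ge0 => l hlH.
  by have [] := Le l hlH.
have N0 : 0 < (H - h).+1%:R :> R by rewrite ltr0n.
apply: L2_le_ler (key (d / (H - h).+1%:R) (divr_gt0 d0 N0)).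
rewrite lerD2l mulrCA ler_piMr ?(ltW d0)// ler_pdivrMr// mul1r ler_nat.
exact: leqnSn.
Qed.

End error_propagation.

(** * Truncation and null sets of product measures *)

Section truncation.
Context {R : realType}.
Implicit Types L y : R.

Lemma trunc_bound L y : 0 <= L -> `|trunc L y| <= L.
Proof.
move=> L0; rewrite /trunc ler_norml le_max lexx/= ge_max ge_min lexx/= andbT.
by rewrite (le_trans _ L0)// oppr_le0.
Qed.

Lemma trunc_id L y : `|y| <= L -> trunc L y = y.
Proof. by rewrite ler_norml /trunc => /andP[Ly yL]; rewrite (min_r yL) (max_r Ly). Qed.

Lemma trunc_dist L y y' : `|trunc L y - trunc L y'| <= `|y - y'|.
Proof.
wlog yy' : y y' / y <= y' => [wl|].
  by have [/wl//|/ltW /wl] := leP y y'; rewrite distrC [leRHS]distrC.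
have contract (a b c d : R) : 0 <= c - d <= a - b -> `|d - c| <= `|b - a|.
  by move=> /andP[cd cdab]; rewrite distrC [leRHS]distrC !ger0_norm// (le_trans cd).
apply: contract; rewrite /trunc.
have /andP[m0 m1] : 0 <= Num.min L y' - Num.min L y <= y' - y.
  by case: (leP L y) => h1; case: (leP L y') => h2; apply/andP; split; lra.
move: (Num.min L y') (Num.min L y) m0 m1 => b a ab1 ab2.
by case: (leP (- L) b) => h1; case: (leP (- L) a) => h2; apply/andP; split; lra.
Qed.

Lemma measurable_trunc d (T : measurableType d) L (f : T -> R) :
  measurable_fun setT f -> measurable_fun setT (fun x => trunc L (f x)).
Proof. by move=> mf; apply: measurable_maxr => //; exact: measurable_minr. Qed.

End truncation.

Lemma ge0_integral_eq0_ae d (T : measurableType d) (R : realType)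
  (mu : {measure set T -> \bar R}) (f : T -> \bar R) : measurable_fun setT f ->
  (forall x, 0 <= f x)%E -> (\int[mu]_x f x = 0)%E -> {ae mu, forall x, f x = 0%E}.
Proof.
move=> mf f0 int0; have := (ae_eq_integral_abs mu measurableT mf).1.
have -> : (\int[mu]_x `|f x| = 0)%E by under eq_integral do rewrite gee0_abs//.
by move=> /(_ erefl); apply: filterS => x; exact.
Qed.

Section almost_everywhere_in_products.
Context {d1 d2} {T1 : measurableType d1} {T2 : measurableType d2} {R : realType}.
Variables (m1 : probability T1 R) (m2 : probability T2 R).

Lemma ae_fst (Q : T1 -> Prop) : {ae m1, forall x, Q x} ->
  {ae m1 \x m2, forall z, Q z.1}%E.
Proof.
move=> [B [mB B0 QB]]; exists (B `*` setT); split.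
- exact: measurableX.
- by rewrite product_measure1E//= B0 mul0e.
- by move=> z nQ; split => //; apply: QB.
Qed.

Lemma ae_snd (Q : T2 -> Prop) : {ae m2, forall x, Q x} ->
  {ae m1 \x m2, forall z, Q z.2}%E.
Proof.
move=> [B [mB B0 QB]]; exists (setT `*` B); split.
- exact: measurableX.
- by rewrite product_measure1E//= B0 mule0.
- by move=> z nQ; split => //; apply: QB.
Qed.

Lemma ae_ysection0 (B : set (T1 * T2)) : measurable B -> (m1 \x m2)%E B = 0%E ->
  {ae m2, forall y, m1 [set x | B (x, y)] = 0%E}.
Proof.
move=> mB B0; have mi : measurable_fun setT (EFin \o \1_B : T1 * T2 -> \bar R).
  by apply/measurable_EFinP.
have i0 z : (0 <= (EFin \o \1_B : T1 * T2 -> \bar R) z)%E by rewrite lee_fin.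
have mG := @measurable_fun_fubini_tonelli_G _ _ _ _ _ m1 _ mi i0.
have G0 y : (0 <= fubini_G m1 (EFin \o \1_B) y)%E.
  by apply: integral_ge0 => x _; exact: i0.
have : (\int[m2]_y fubini_G m1 (EFin \o \1_B) y = 0)%E.
  by rewrite -fubini_tonelli2// integral_indic// setIT.
move=> /(ge0_integral_eq0_ae mG G0); apply: filterS => y <-.
rewrite -[X in m1 X]setIT -integral_indic//.
by rewrite -[X in measurable X]setTI; exact: (pair2_measurable y).
Qed.

Lemma bmf_Rintegral_prod (f : T1 * T2 -> R) : bmf f ->
  \int[(m1 \x m2)%E]_z f z = \int[m1]_x \int[m2]_y f (x, y).
Proof.
move=> bf; rewrite /Rintegral; congr fine.
rewrite -(integral12_prod_meas1 (bmf_integrable ((m1 \x m2)%E : probability _ R) bf)).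
apply: eq_integral => x _; rewrite /fubini_F/=.
have bx : bmf (fun y => f (x, y)).
  have [mf [B fB]] := bf; apply: (bmf_intro (B := B)) => //.
  exact: (measurable_fun_pair2 x mf).
exact: bmf_EFin_Rintegral.
Qed.

End almost_everywhere_in_products.

(** * Consequences of the assumptions *)

Section algorithm_analysis.
Context {dS dA dE dO : measure_display} {R : realType}
  {S : measurableType dS} {A : measurableType dA} {E : measurableType dE}
  {Omega : measurableType dO}.
Variables (nrm : R -> R -> R) (M : mdp S A R) (K N : nat) (D : regression S R K)
  (rhoS : S -> S -> R) (rhoA : A -> A -> R)
  (PE : probability E R) (kap : nat -> S * A * E -> S)
  (Pr : probability Omega R)
  (X : nat -> 'I_N -> {RV Pr >-> S}) (eps : nat -> 'I_N -> {RV Pr >-> E})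
  (LK Rmax LR LamK LgK : R).
Hypotheses (nrm_norm : is_norm2 nrm) (N0 : (0 < N)%N)
  (metricS : is_metric rhoS) (metricA : is_metric rhoA)
  (LK0 : 0 <= LK) (LR0 : 0 <= LR)
  (rmr : random_map_representation M PE kap)
  (lrm : lipschitz_random_map M nrm rhoS rhoA kap LK)
  (blr : bounded_lipschitz_rewards M rhoS Rmax LR)
  (bc : basis_conditions M D rhoS LamK LgK)
  (dominated : transitions_dominated M D)
  (indep : independent_samples M D X eps PE).

Local Notation H := (horizon M).
Local Notation Lt := (Ltilde M Rmax).
Local Notation Vmax := (Ltilde M Rmax 0).
Local Notation LVK := (LR + Vmax * LamK * LgK * Num.sqrt K%:R).
Local Notation gam := (Defs.basis D).
Local Notation beta := (betaN D X eps kap).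
Local Notation sp := (@sample_pair _ _ _ _ S A E Omega R M N Pr X eps).

Definition dual h x : 'cV[R]_K := invmx (gram D h) *m gam x.

Lemma H_gt0 : (0 < H)%N. Proof. exact: horizon_gt0. Qed.

Lemma Rmax_ge0 : 0 <= Rmax.
Proof. by have [_ tb _ _] := blr; exact: le_trans (normr_ge0 _) (tb point). Qed.

Lemma Ltilde_ge0 h : 0 <= Lt h.
Proof. by rewrite mulr_ge0// Rmax_ge0. Qed.

Lemma Ltilde_le_Vmax h : Lt h <= Vmax.
Proof. by rewrite ler_wpM2r ?Rmax_ge0// ler_nat ltnS leq_sub2l. Qed.

Lemma LtildeS h : (h < H)%N -> Lt h = Rmax + Lt h.+1.
Proof. by move=> hH; rewrite /Ltilde -[(H - h)%N](subnSK hH) -natr1 mulrDl mul1r addrC. Qed.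

Lemma LamK_ge0 : 0 <= LamK.
Proof.
have [_ /(_ 0%N H_gt0 point) + _ _] := bc; apply: le_trans.
by rewrite /maxnorm; apply: bigmax_ge_id.
Qed.

Lemma LVK_ge0 : 0 <= LVK.
Proof.
have [_ _ /ltW LgK0 _] := bc.
apply: addr_ge0 => //; do 3?[apply: mulr_ge0]; rewrite ?sqrtr_ge0//.
  exact: Ltilde_ge0.
exact: LamK_ge0.
Qed.

Lemma dual_bound h x k : (h < H)%N -> `|dual h x k ord0| <= LamK.
Proof.
by move=> hH; have [_ + _ _] := bc => /(_ h hH x); apply: le_trans; exact: coord_le_maxnorm.
Qed.

(** The basis is bounded because its dual is: gamma = Sigma (Sigma^-1 gamma). *)
Lemma bmf_basis k : bmf (fun x => gam x k ord0).
Proof.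
have [gu _ _ _] := bc.
apply: (@bmf_intro _ _ _ _ (\sum_j `|gram D 0 k j| * LamK)).
  exact: measurable_basis.
move=> x; have -> : gam x = gram D 0 *m dual 0 x.
  by rewrite mulKVmx// gu// H_gt0.
rewrite mxE (le_trans (ler_norm_sum _ _ _))//; apply: ler_sum => j _.
by rewrite normrM ler_wpM2l// dual_bound// H_gt0.
Qed.

Lemma measurable_dual h k : measurable_fun setT (fun x => dual h x k ord0).
Proof. exact: (bmf_dual_basis (ref D h) bmf_basis k).1. Qed.

Lemma betaN_coord h V a w k : beta h V a w k ord0 =
  N%:R^-1 * \sum_(i < N) V (kap h.+1 (X h i w, a, eps h i w), w)
                         * dual h (X h i w) k ord0.
Proof. by rewrite !mxE summxE; congr (_ * _); apply: eq_bigr => i _; rewrite !mxE. Qed.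

Lemma betaN_dist h V V' a a' w k (b : R) : (h < H)%N ->
  (forall i, `|V (kap h.+1 (X h i w, a, eps h i w), w)
               - V' (kap h.+1 (X h i w, a', eps h i w), w)| <= b) ->
  `|beta h V a w k ord0 - beta h V' a' w k ord0| <= b * LamK.
Proof.
move=> hH Vb; rewrite !betaN_coord -mulrBr -sumrB normrM ger0_norm ?invr_ge0//.
rewrite ler_pdivrMl ?ltr0n// (le_trans (ler_norm_sum _ _ _))//.
apply: (@le_trans _ _ (\sum_(i < N) b * LamK)); last first.
  by rewrite sumr_const card_ord mulr_natl.
by apply: ler_sum => i _; rewrite -mulrBl normrM ler_pM// dual_bound.
Qed.

Lemma betaN_bound h V a w k (b : R) : (h < H)%N -> (forall z, `|V z| <= b) ->
  `|beta h V a w k ord0| <= b * LamK.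
Proof.
move=> hH Vb; have := @betaN_dist h V (fun=> 0) a a w k b hH.
rewrite [beta h (fun=> 0) _ _ _ _]betaN_coord [X in _ * X]big1 ?mulr0 ?subr0.
  by apply => i; rewrite subr0.
by move=> i _; rewrite mul0r.
Qed.

Lemma betaN_enorm h V a w (b : R) : (h < H)%N -> (forall z, `|V z| <= b) ->
  enorm (beta h V a w) <= Num.sqrt K%:R * (b * LamK).
Proof.
move=> hH Vb; have b0 : 0 <= b := le_trans (normr_ge0 _) (Vb point).
rewrite -[b * LamK]ger0_norm ?mulr_ge0 ?LamK_ge0//.
by apply: enorm_le => k; exact: betaN_bound.
Qed.

(** * The sigma-algebras of the samples *)

Definition levels_from (h : nat) : {pred 'I_H * 'I_N} := fun ti => (h <= ti.1)%N.

Local Notation Om h := (g_sigma_algebraType (sample_boxes sp (levels_from h))).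

Lemma measurable_sp ti : measurable_fun setT (sp ti).
Proof. by apply: measurable_fun_pair; exact: measurable_funP. Qed.

Lemma measurable_Om h : measurable_fun setT (id : Omega -> Om h).
Proof. exact: (@measurable_to_samples _ _ _ _ _ sp measurable_sp). Qed.

Lemma measurable_OmS h : measurable_fun setT (id : Om h -> Om h.+1).
Proof. by apply: measurable_sub_samples => ti; exact: ltnW. Qed.

Lemma measurable_sp_Om h (hH : (h < H)%N) i :
  measurable_fun setT (sp (Ordinal hH, i) : Om h -> S * E).
Proof. by apply: measurable_fun_sample; rewrite unfold_in /levels_from /=. Qed.

Lemma measurable_kap h a : (h < H)%N ->
  measurable_fun setT (fun s : S * E => kap h.+1 (s.1, a, s.2)).
Proof.
move=> hH; have [mk _] := @rmr h.+1 hH.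
apply: (measurableT_comp mk); apply: measurable_fun_pair.
  by apply: measurable_fun_pair.
by [].
Qed.

Lemma measurable_kap_noise h x a : (h < H)%N ->
  measurable_fun setT (fun e : E => kap h.+1 (x, a, e)).
Proof. by move=> hH; have [mk _] := @rmr h.+1 hH; exact: (measurable_fun_pair2 (x, a) mk). Qed.

(** A function of two variables, so that the sample can be integrated out while
    the data of the later levels are kept. *)
Definition summand h (V : S * Omega -> R) a k (z : (S * E) * Omega) : R :=
  V (kap h.+1 (z.1.1, a, z.1.2), z.2) * dual h z.1.1 k ord0.

Lemma measurable_summand h V a k : (h < H)%N ->
  measurable_fun setT (V : S * Om h.+1 -> R) ->
  measurable_fun setT (summand h V a k : (S * E) * Om h.+1 -> R).
Proof.
move=> hH mV; apply: measurable_funM.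
  apply: (measurableT_comp mV); apply: measurable_fun_pair => //.
  exact: (measurableT_comp (measurable_kap a hH) measurable_fst).
apply: (measurableT_comp (measurable_dual h k)).
exact: (measurableT_comp measurable_fst measurable_fst).
Qed.

Lemma measurable_betaN h V a k : (h < H)%N ->
  measurable_fun setT (V : S * Om h.+1 -> R) ->
  measurable_fun setT (fun w : Om h => beta h V a w k ord0).
Proof.
move=> hH mV; under eq_fun do rewrite betaN_coord.
apply: measurable_funM => //; apply: measurable_sum => i.
have m : measurable_fun setT
    (fun w : Om h => (sp (Ordinal hH, i) w, w) : (S * E) * Om h.+1).
  by apply: measurable_fun_pair; [exact: measurable_sp_Om|exact: measurable_OmS].
exact: (measurableT_comp (measurable_summand a k hH mV) m).
Qed.

Lemma measurable_update h V a (L : R) : (h < H)%N ->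
  measurable_fun setT (V : S * Om h.+1 -> R) ->
  measurable_fun setT (fun z : S * Om h =>
    reward M h (z.1, a) + trunc L (dotv (beta h V a z.2) (gam z.1))).
Proof.
move=> hH mV; apply: measurable_funD.
  have mr := measurable_reward hH.
  exact: (measurableT_comp (measurable_fun_pair1 a mr) measurable_fst).
apply: measurable_trunc; apply: measurable_sum => k; apply: measurable_funM.
  exact: (measurableT_comp (measurable_betaN a k hH mV) measurable_snd).
exact: (measurableT_comp (@measurable_basis _ _ _ _ D k) measurable_fst).
Qed.

(** The product sigma-algebra of the states and of the samples of the levels
    from h on is the one with respect to which the algorithm takes its essential
    suprema. *)
Lemma samples_from_measurable h (B : set (S * Om h)) :
  samples_from M X eps h B <-> measurable B.
Proof.
pose gens := [set C : set (S * Omega) | exists2 B : set S, measurable B &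
          C = (fun z => z.1) @^-1` B \/
          exists t i, (h <= t < H)%N /\ C = (fun z => X t i z.2) @^-1` B]
      `|` [set C | exists2 B : set E, measurable B &
          exists t i, (h <= t < H)%N /\ C = (fun z => eps t i z.2) @^-1` B].
split.
  suff : samples_from M X eps h `<=` (@measurable _ (S * Om h)%type) by exact.
  apply: smallest_sub; first exact: sigma_algebra_measurable.
  move=> C [[B0 mB0 [->|[t [i [/andP[ht tH] ->]]]]]|[B0 mB0 [t [i [/andP[ht tH] ->]]]]].
  - by rewrite -[X in measurable X]setTI; exact: measurable_fst.
  - rewrite -[X in measurable X]setTI.
    have m : measurable_fun setT (fun z : S * Om h => (sp (Ordinal tH, i) z.2).1).
      apply: (measurableT_comp measurable_fst).
      apply: (measurableT_comp _ measurable_snd).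
      by apply: measurable_fun_sample; rewrite unfold_in /levels_from.
    exact: m.
  - rewrite -[X in measurable X]setTI.
    have m : measurable_fun setT (fun z : S * Om h => (sp (Ordinal tH, i) z.2).2).
      apply: (measurableT_comp measurable_snd).
      apply: (measurableT_comp _ measurable_snd).
      by apply: measurable_fun_sample; rewrite unfold_in /levels_from.
    exact: m.
pose T := g_sigma_algebraType gens.
have m1 : measurable_fun setT (fst : T -> S).
  move=> _ B0 mB0; rewrite setTI; apply: sub_sigma_algebra; left.
  by exists B0 => //; left.
have m2 : measurable_fun setT (snd : T -> Om h).
  apply: (measurable_to_sample_space (S := sp)) => -[t i] ht.
  apply: measurable_fun_pair => _ B0 mB0; rewrite setTI; apply: sub_sigma_algebra.
    by left; exists B0 => //; right; exists t, i; split => //; apply/andP.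
  by right; exists B0 => //; exists t, i; split => //; apply/andP.
move=> mB; have m := measurable_fun_pair m1 m2.
have := m measurableT B mB; rewrite setTI.
suff -> : (fun x : T => (x.1, x.2)) @^-1` B = B by [].
by apply/seteqP; split => -[].
Qed.

Lemma measurable_wrt_samples h (g : S * Omega -> R) :
  measurable_wrt (samples_from M X eps h) g <->
  measurable_fun setT (g : S * Om h -> R).
Proof.
split => mg; last by move=> B mB; apply/samples_from_measurable; rewrite -[X in measurable X]setTI; exact: mg.
by move=> _ B mB; rewrite setTI; apply/samples_from_measurable; exact: mg.
Qed.

Lemma measurable_set_S_Om h (B : set (S * Om h)) :
  measurable B -> measurable (B : set (S * Omega)).
Proof.
move=> mB.
have m : measurable_fun setT (fun z : S * Omega => (z.1, z.2) : S * Om h).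
  apply: measurable_fun_pair => //.
  exact: (measurableT_comp (@measurable_Om h) measurable_snd).
have := m measurableT B mB; rewrite setTI (_ : _ @^-1` B = B)//.
by apply/seteqP; split => -[].
Qed.

Lemma measurable_S_Om h (g : S * Omega -> R) :
  measurable_fun setT (g : S * Om h -> R) -> measurable_fun setT g.
Proof.
move=> mg _ B mB; rewrite setTI; apply: (@measurable_set_S_Om h).
by rewrite -[X in measurable X]setTI; exact: mg.
Qed.

(** * A countable set of actions *)

(** The weight of the action metric in the metric of state-action pairs. *)
Definition nA := nrm 0 1.

Lemma nA_ge0 : 0 <= nA.
Proof.
have [_ nZ nD] := nrm_norm.
have n00 : nrm 0 0 = 0 by have := nZ 0 0 0; rewrite !mul0r normr0 mul0r.
have := nD 0 1 0 (-1); rewrite addr0 subrr n00.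
have -> : nrm 0 (-1) = nA by have := nZ (-1) 0 1; rewrite mulr0 mulr1 normrN1 mul1r.
by rewrite -mulr2n pmulrn_lge0.
Qed.

(** The pseudometric for which the approximations at the next state are
    1-Lipschitz in the action. *)
Definition tau a a' := LVK * LK * nA * rhoA a a'.

Lemma LVKn_ge0 : 0 <= LVK * LK * nA.
Proof. by rewrite mulr_ge0 ?nA_ge0// mulr_ge0// LVK_ge0. Qed.

(** The truncation makes the function bounded before the optimal values are known
    to be; it will turn out to change them on a null set only. *)
Definition bellman_term h a x : R :=
  reward M h (x, a) + Pop M h.+1 a (fun y => trunc (Lt h.+1) (Vstar M h.+1 y)) x.

Lemma measurable_reward_at h a : (h < H)%N -> measurable_fun setT (fun x => reward M h (x, a)).
Proof. by move=> hH; exact: (measurable_fun_pair1 a (measurable_reward hH)). Qed.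

Lemma bmf_Pop h a (V : S -> R) : bmf V -> bmf (Pop M h a V).
Proof.
move=> bV; have [mk [B kB]] := bmf_kernel (trans M h) bV; split.
  exact: (measurable_fun_pair1 a mk).
by exists B => x; exact: kB.
Qed.

Lemma Pop_bound h a (V : S -> R) (B : R) x : measurable_fun setT V ->
  (forall y, `|V y| <= B) -> `|Pop M h a V x| <= B.
Proof. exact: (@Rintegral_bound _ _ _ (kernel_at (trans M h) (x, a))). Qed.

Lemma backup_bound h a (V : S -> R) x : (h < H)%N -> measurable_fun setT V ->
  (forall y, `|V y| <= Lt h.+1) -> `|reward M h (x, a) + Pop M h.+1 a V x| <= Lt h.
Proof.
move=> hH mV VB; rewrite (LtildeS hH) (le_trans (ler_normD _ _))// lerD//.
  by have [rb _ _ _] := blr; exact: rb.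
exact: Pop_bound.
Qed.

Lemma Vstar_terminal : Vstar M H = terminal M.
Proof.
apply/funext => x; rewrite /Vstar.
pose pi : @policy _ _ S A R := det_policy (fun=> @measurable_cst _ _ S A setT point).
rewrite (_ : [set _ | _ in _] = [set terminal M x]) ?sup1//.
have val pi' : policy_value M pi' H x = terminal M x.
  by rewrite /policy_value subnn/= /total_reward/= big_nil add0r.
by apply/seteqP; split => [_ [pi' _ <-]|_ ->]; [exact: val|exists pi].
Qed.

(** An invertible Gram matrix forces the basis and its dual not to vanish. *)
Lemma basis_not_null : (0 < K)%N ->
  ~ {ae ref D 0, forall x k, gam x k ord0 = 0}.
Proof.
move=> K0 gam0; have [gu _ _ _] := bc.
have G0 : gram D 0 = 0.
  apply/matrixP => i j; rewrite !mxE.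
  rewrite (@bmf_eq_Rintegral_ae _ _ _ _ _ (fun=> 0)).
  - by rewrite Rintegral_cst// mul0r.
  - by apply: bmfM; exact: bmf_basis.
  - exact: bmf_cst.
  - by apply: filterS gam0 => x ->; rewrite mul0r.
have := mulmxV (gu 0%N H_gt0); rewrite G0 mul0mx => /matrixP.
move=> /(_ (Ordinal K0) (Ordinal K0)) /eqP; rewrite !mxE eqxx eq_sym.
by rewrite oner_eq0.
Qed.

(** When the entropy or the diameter is infinite, positive factors in front of it
    are what makes the error bound infinite. *)
Lemma LamK_gt0 : (0 < K)%N -> 0 < LamK.
Proof.
move=> K0; rewrite lt_def LamK_ge0 andbT; apply/eqP => L0.
apply: (basis_not_null K0); apply: aeW => x k; have [gu _ _ _] := bc.
rewrite -[gam x](mulKVmx (gu 0%N H_gt0)) mxE big1// => j _.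
have := dual_bound x j H_gt0; rewrite L0 normr_le0 => /eqP.
by rewrite /dual => ->; rewrite mulr0.
Qed.

Lemma second_moment_gt0 (v : R) : (0 < K)%N -> 0 <= v ->
  second_moment_bound M D v -> 0 < v.
Proof.
move=> K0 v0 mom; rewrite lt_def v0 andbT; apply/eqP => v_eq0.
apply: (basis_not_null K0).
have m2 : measurable_fun setT (fun x => (enorm (gam x) ^+ 2)%:E).
  apply/measurable_EFinP; under eq_fun do rewrite sqr_enorm.
  by apply: measurable_sum => k; apply: measurable_funX; exact: measurable_basis.
have e0 x : (0 <= (enorm (gam x) ^+ 2)%:E)%E by exact: ge0_sqr_EFin.
have : (\int[ref D 0]_x (enorm (gam x) ^+ 2)%:E = 0)%E.
  apply: le_anti; rewrite integral_ge0// andbT.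
  by have := mom 0%N H_gt0; rewrite v_eq0 expr0n.
move=> /(ge0_integral_eq0_ae m2 e0); apply: filterS => x [] /eqP.
rewrite sqr_enorm psumr_eq0 => [/allP g0 k|k _]; last exact: sqr_ge0.
by apply/eqP; rewrite -sqrf_eq0; apply: g0; rewrite mem_index_enum.
Qed.

Hypothesis bellman : bellman_equation M D.

Lemma measurable_Vstar h : (h <= H)%N -> measurable_fun setT (Vstar M h).
Proof.
rewrite leq_eqVlt => /predU1P[->|hH].
  by rewrite Vstar_terminal; exact: measurable_terminal.
by have [m _ _] := bellman hH; move=> _ B mB; rewrite setTI; exact: m.
Qed.

Lemma bellman_term_regular h a : (h < H)%N ->
  measurable_fun setT (bellman_term h a) /\ forall x, `|bellman_term h a x| <= Lt h.
Proof.
move=> hH; have mV := measurable_trunc (Lt h.+1) (measurable_Vstar hH).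
have VB y := trunc_bound (Vstar M h.+1 y) (Ltilde_ge0 h.+1).
split; last by move=> x; exact: backup_bound.
apply: measurable_funD; first exact: measurable_reward_at.
exact: (bmf_Pop h.+1 a (bmf_intro mV VB)).1.
Qed.

Lemma dense_actions (t : R) :
  ((LVK * LK)%:E * dudley rhoA + (LVK * LK)%:E * diameter rhoA = t%:E)%E ->
  exists q : nat -> A, forall a e, 0 < e -> exists j, tau (q j) a < e.
Proof.
move=> tE; have L0 : 0 <= LVK * LK by rewrite mulr_ge0// LVK_ge0.
have dud0 : (0 <= dudley rhoA)%E by apply: integral_ge0 => u _; exact: sqrte_ge0.
have diam0 : (0 <= diameter rhoA)%E.
  by apply: le_trans (le_diameter rhoA point point); rewrite lee_fin metric_ge0.
have [LKn0|LKn] := eqVneq (LVK * LK * nA) 0.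
  by exists (fun=> point) => a e e0; exists 0%N; rewrite /tau LKn0 mul0r.
have LL : 0 < LVK * LK by rewrite lt_def L0 andbT; move: LKn; rewrite mulf_eq0 negb_or => /andP[].
have LKnp : 0 < LVK * LK * nA by rewrite lt_def LKn LVKn_ge0.
have [dud diam] : (dudley rhoA < +oo)%E /\ (diameter rhoA < +oo)%E.
  move: tE; case: (dudley rhoA) dud0 => [I| |]//; case: (diameter rhoA) diam0 => [d| |]//;
    by rewrite ?gt0_muley ?lte_fin// ?addey// ?addye ?ltry.
have [d diamE] : exists d, diameter rhoA = d%:E by move: diam diam0; case: diameter => [d| |]//; exists d.
have [q Hq] := dense_sequence point diamE dud.
exists q => a e e0; have [j Hj] := Hq a _ (divr_gt0 e0 LKnp).
by exists j; rewrite /tau mulrC -ltr_pdivlMr.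
Qed.

Lemma tau_pseudometric : [/\ forall a b, tau a b = tau b a,
  forall a b d, tau a d <= tau a b + tau b d & forall a, tau a a = 0].
Proof.
have [r0 rC rD] := metricA; split => [a b|a b d|a].
- by rewrite /tau rC.
- by rewrite /tau -mulrDr ler_wpM2l ?LVKn_ge0.
- by rewrite /tau (r0 a a).2 ?mulr0.
Qed.

(** One countable family of actions serves every purpose at a given level: it is
    dense, it realizes the rewards, and it realizes the optimal values. *)
Lemma exists_skeleton (t : R) :
  ((LVK * LK)%:E * dudley rhoA + (LVK * LK)%:E * diameter rhoA = t%:E)%E ->
  exists c : nat -> nat -> A, forall h, (h < H)%N -> forall a,
    {ae ref D h, forall x, forall e : R, 0 < e ->
       exists n, tau (c h n) a < e /\ reward M h (x, a) <= reward M h (x, c h n) + e} /\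
    {ae ref D h, forall x,
       bellman_term h a x <= seq_sup (fun n => bellman_term h (c h n) x)}.
Proof.
move=> /dense_actions[q Hq]; have [tauC tauD tau0] := tau_pseudometric.
suff level h : exists c : nat -> A, (h < H)%N -> forall a,
    {ae ref D h, forall x, forall e : R, 0 < e ->
       exists n, tau (c n) a < e /\ reward M h (x, a) <= reward M h (x, c n) + e} /\
    {ae ref D h, forall x,
       bellman_term h a x <= seq_sup (fun n => bellman_term h (c n) x)}.
  by have /choice[c Hc] := level; exists c.
have [hH|Hh] := pselect (h < H)%N; last by exists (fun=> point).
have [rb _ _ _] := blr.
have [c1 Hc1] := countable_skeleton (ref D h) tauC tauD tau0 Hq
  (f := fun a x => reward M h (x, a)) (fun a => measurable_reward_at a hH)
  (fun a x => rb h hH x a).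
have [c2 Hc2] := countable_envelope (ref D h) point
  (fun a => (bellman_term_regular a hH).1) (fun a => (bellman_term_regular a hH).2).
have [b Hb] := merge_sequences (fun k => if k is 0%N then c1 else c2).
exists b => _ a; split.
  apply: filterS (Hc1 a) => x Hx e e0; have [n Hn] := Hx e e0.
  by have [p bp] := Hb 0%N n; exists p; rewrite bp.
apply: filterS (Hc2 a) => x /le_trans; apply; apply: seq_sup_le => n.
have [p <-] := Hb 1%N n.
apply: (@seq_sup_ub _ (fun n => bellman_term h (b n) x) (Lt h)) => k.
by apply: le_trans ((bellman_term_regular _ hH).2 x); exact: ler_norm.
Qed.

(** * A regular version of the approximations *)

Variable c : nat -> nat -> A.

Definition update h (V : S * Omega -> R) (a : A) (z : S * Omega) : R :=
  reward M h (z.1, a) + trunc (Lt h.+1) (dotv (beta h V a z.2) (gam z.1)).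

(** The algorithm with suprema along the countable family c in place of essential
    suprema: its bounds hold at every state and for every outcome. *)
Fixpoint Vt_back (n : nat) : S * Omega -> R :=
  if n is n'.+1 then
    fun z => seq_sup (fun k => update (H - n) (Vt_back n') (c (H - n) k) z)
  else fun z => terminal M z.1.

Definition Vt h := Vt_back (H - h).

Lemma Vt_terminal h : (H <= h)%N -> Vt h = fun z => terminal M z.1.
Proof. by rewrite /Vt -subn_eq0 => /eqP ->. Qed.

Lemma VtE h : (h < H)%N ->
  Vt h = fun z => seq_sup (fun k => update h (Vt h.+1) (c h k) z).
Proof.
move=> hH; rewrite /Vt -(subnSK hH) /=.
by rewrite (subnSK hH) subKn// ltnW.
Qed.

Lemma backward_ind (Q : nat -> Prop) : (forall h, (H <= h)%N -> Q h) ->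
  (forall h, (h < H)%N -> Q h.+1 -> Q h) -> forall h, Q h.
Proof.
move=> QH Qstep h; have [n] : exists n, n = (H - h)%N by exists (H - h)%N.
elim: n h => [|n IH] h nE; first by apply: QH; rewrite -subn_eq0 -nE.
have hH : (h < H)%N by rewrite -subn_gt0 -nE.
by apply: Qstep => //; apply: IH; apply: succn_inj; rewrite nE subnSK.
Qed.

Lemma update_bound h V a z : (h < H)%N -> `|update h V a z| <= Lt h.
Proof.
move=> hH; rewrite (LtildeS hH) (le_trans (ler_normD _ _))// lerD//.
  by have [rb _ _ _] := blr; exact: rb.
by apply: trunc_bound; exact: Ltilde_ge0.
Qed.

Lemma Vt_bound h z : `|Vt h z| <= Lt h.
Proof.
have [Hh|hH] := leqP H h.
  rewrite Vt_terminal// /Ltilde; move: Hh; rewrite -subn_eq0 => /eqP ->.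
  by rewrite mul1r; have [_ tb _ _] := blr.
by rewrite VtE//; apply: seq_sup_bounded => k; exact: update_bound.
Qed.

Lemma Vt_bound_Vmax h z : `|Vt h z| <= Vmax.
Proof. exact: le_trans (Vt_bound h z) (Ltilde_le_Vmax h). Qed.

(** The coefficients are bounded by V_max Lambda_K for every outcome, so the
    Lipschitz constant of the approximations does not depend on the samples. *)
Lemma Vt_lipschitz h x x' w : `|Vt h (x, w) - Vt h (x', w)| <= LVK * rhoS x x'.
Proof.
have rho0 := metric_ge0 metricS x x'.
have [_ _ /ltW LgK0 Lg] := bc; have [_ _ Lr Ltm] := blr.
have [Hh|hH] := leqP H h.
  rewrite Vt_terminal//= (le_trans (Ltm x x'))// ler_wpM2r// lerDl.
  do 3?[apply: mulr_ge0]; rewrite ?sqrtr_ge0//; first exact: Ltilde_ge0.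
  exact: LamK_ge0.
rewrite VtE//; apply: (@seq_sup_dist _ _ _ (Lt h)) => k; rewrite ?update_bound//.
rewrite /update/= opprD addrACA (le_trans (ler_normD _ _))// mulrDl lerD//.
  exact: Lr.
rewrite (le_trans (trunc_dist _ _ _))//.
have -> b : dotv b (gam x) - dotv b (gam x') = dotv b (gam x - gam x').
  by rewrite /dotv -sumrB; apply: eq_bigr => i _; rewrite !mxE mulrBr.
rewrite (le_trans (dotv_le_enorm _ _))//.
have b1 := betaN_enorm (c h k) w hH (Vt_bound_Vmax h.+1).
apply: (le_trans (ler_pM (enorm_ge0 _) (enorm_ge0 _) b1 (Lg x x'))).
by rewrite le_eqVlt; apply/orP; left; apply/eqP; ring.
Qed.

Lemma measurable_Vt h : measurable_fun setT (Vt h : S * Om h -> R).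
Proof.
elim/backward_ind: h => h hH.
  rewrite Vt_terminal//; exact: (measurableT_comp (measurable_terminal M) measurable_fst).
move=> IH; rewrite VtE//; apply: measurable_seq_sup => [k|z].
  exact: measurable_update.
by exists (Lt h) => k; apply: le_trans (update_bound _ _ _ hH); exact: ler_norm.
Qed.

Lemma measurable_Vt_section h w : measurable_fun setT (fun x => Vt h (x, w)).
Proof.
have m : measurable_fun setT (Vt h) by exact: measurable_S_Om (@measurable_Vt h).
exact: (measurable_fun_pair1 w m).
Qed.

(** * Regularity in the action *)

Lemma kap_lipschitz h x a a' e : (h < H)%N ->
  rhoS (kap h.+1 (x, a, e)) (kap h.+1 (x, a', e)) <= LK * nA * rhoA a a'.
Proof.
move=> hH; have := @lrm h.+1 hH x a x a' e.
have [r0 _ _] := metricS; rewrite ((r0 x x).2 erefl).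
have [_ nZ _] := nrm_norm.
have -> : nrm 0 (rhoA a a') = rhoA a a' * nA.
  have := nZ (rhoA a a') 0 1; rewrite mulr0 mulr1 ger0_norm//.
  exact: metric_ge0.
by rewrite [_ * nA]mulrC mulrA.
Qed.

Lemma Vt_kap_dist h x a a' e w : (h < H)%N ->
  `|Vt h.+1 (kap h.+1 (x, a, e), w) - Vt h.+1 (kap h.+1 (x, a', e), w)|
  <= tau a a'.
Proof.
move=> hH; apply: (le_trans (Vt_lipschitz _ _ _ _)).
rewrite /tau -2!(mulrA LVK); apply: ler_wpM2l; first exact: LVK_ge0.
exact: kap_lipschitz.
Qed.

Lemma beta_lipschitz h a a' w k : (h < H)%N ->
  `|beta h (Vt h.+1) a w k ord0 - beta h (Vt h.+1) a' w k ord0|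
  <= tau a a' * LamK.
Proof. by move=> hH; apply: betaN_dist => // i; exact: Vt_kap_dist. Qed.

Hypothesis skeleton : forall h, (h < H)%N -> forall a,
  {ae ref D h, forall x, forall e : R, 0 < e ->
     exists n, tau (c h n) a < e /\ reward M h (x, a) <= reward M h (x, c h n) + e}.

(** The family c approximates both parts of an update: the rewards for almost every
    state, and the regression part for all states and outcomes, as it is Lipschitz
    for tau. The null set is therefore the same for all outcomes. *)
Lemma update_le_Vt h a : (h < H)%N ->
  {ae ref D h, forall x, forall w, update h (Vt h.+1) a (x, w) <= Vt h (x, w)}.
Proof.
move=> hH; apply: filterS (skeleton hH a) => x sk w.
pose Q := 1 + Num.sqrt K%:R * LamK * enorm (gam x).
have Q0 : 0 < Q.
  by rewrite ltr_wpDr// !mulr_ge0 ?sqrtr_ge0 ?LamK_ge0 ?enorm_ge0.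
apply/ler_addgt0Pr => e e0; have [n [tn rn]] := sk (e / Q) (divr_gt0 e0 Q0).
apply: (@le_trans _ _ (update h (Vt h.+1) (c h n) (x, w) + e)); last first.
  rewrite lerD2r (VtE hH).
  apply: (@seq_sup_ub _ (fun k => update h (Vt h.+1) (c h k) (x, w)) (Lt h) n) => k.
  by apply: le_trans (update_bound _ _ _ hH); exact: ler_norm.
rewrite /update/=.
set t := trunc _ _; set t' := trunc _ _.
suff tt' : t <= t' + (e - e / Q).
  have := lerD rn tt'.
  by rewrite [X in _ <= X -> _](_ : _ = reward M h (x, c h n) + t' + e)//; ring.
rewrite -lerBlDl.
apply: le_trans (ler_norm _) _; apply: le_trans (trunc_dist _ _ _) _.
rewrite -dotvBl; apply: le_trans (dotv_le_enorm _ _) _.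
have eb : enorm (beta h (Vt h.+1) a w - beta h (Vt h.+1) (c h n) w) <=
    Num.sqrt K%:R * (e / Q * LamK).
  have p0 : 0 <= e / Q * LamK by rewrite mulr_ge0 ?LamK_ge0// divr_ge0// ltW.
  rewrite -[e / Q * LamK]ger0_norm//.
  apply: enorm_le => k; rewrite mxE [X in _ + X]mxE distrC.
  apply: (le_trans (beta_lipschitz _ _ _ _ hH)).
  by rewrite ler_wpM2r ?LamK_ge0// ltW.
apply: (le_trans (ler_wpM2r (enorm_ge0 _) eb)).
rewrite [X in _ <= X](_ : _ = e / Q * (Q - 1)); last by field; rewrite gt_eqF.
by rewrite /Q le_eqVlt; apply/orP; left; apply/eqP; ring.
Qed.

Lemma is_esssup_Vt_section h w : (h < H)%N ->
  is_esssup (ref D h) measurable (fun a x => update h (Vt h.+1) a (x, w))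
    (fun x => Vt h (x, w)).
Proof.
move=> hH; rewrite (VtE hH).
apply: (is_esssup_seq_sup (f := fun a x => update h (Vt h.+1) a (x, w)) (c := c h)).
  have := measurable_Vt_section h w; rewrite (VtE hH) => m B mB.
  by rewrite -[X in measurable X]setTI; exact: m.
by move=> a; apply: filterS (update_le_Vt a hH) => x /(_ w); rewrite (VtE hH).
Qed.

(** For a fixed outcome the coefficients are one admissible choice of zeta. *)
Lemma Vzeta_Vt h w : (h <= H)%N ->
  {ae ref D h, forall x,
    Vzeta M D Rmax h (fun a => beta h (Vt h.+1) a w) x = Vt h (x, w)}.
Proof.
rewrite leq_eqVlt => /predU1P[->|hH].
  by apply: aeW => x; rewrite /Vzeta ltnn Vt_terminal.
rewrite /Vzeta hH; have ess := is_esssup_Vt_section w hH.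
exact: is_esssup_unique (esssupP ess) ess.
Qed.

(** * Agreement with the algorithm *)

(** The next states of the samples have a law that is dominated by the reference
    measure of the next level and are independent of the data of that level and
    of the later ones. *)
Lemma null_next_state h a i (B : set (S * Om h.+1)) : (h < H)%N ->
  measurable B -> (ref D h.+1 \x Pr)%E (B : set (S * Omega)) = 0%E ->
  {ae Pr, forall w, ~ B (kap h.+1 (X h i w, a, eps h i w), w)}.
Proof.
move=> hH mB B0.
pose ti : 'I_H * 'I_N := (Ordinal hH, i).
pose F (z : (S * E) * Om h.+1) : \bar R := (\1_B (kap h.+1 (z.1.1, a, z.1.2), z.2))%:E.
have mF : measurable_fun setT F.
  apply/measurable_EFinP.
  apply: (measurableT_comp (measurable_indic mB)).
  apply: measurable_fun_pair => //.
  exact: (measurableT_comp (measurable_kap a hH) measurable_fst).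
have F0 z : (0 <= F z)%E by rewrite lee_fin.
have tiJ : ti \notin levels_from h.+1 by rewrite unfold_in /levels_from /= ltnn.
have [law prod] := indep.
have := integral_sample measurable_sp prod tiJ (law ti) mF F0.
have mFw w : measurable_fun setT (fun t => F (t, w)).
  exact: (measurable_fun_pair1 w mF).
have mBO := measurable_set_S_Om mB.
have aeB := ae_ysection0 mBO B0.
have inner0 : {ae Pr, forall w, (\int[ref D h \x PE]_t F (t, w) = 0)%E}.
  apply: filterS aeB => w Bw0.
  rewrite fubini_tonelli1//; apply: integral0_eq => x _; rewrite /fubini_F /F/=.
  have hH1 : (0 < h.+1 <= H)%N := hH.
  have mBw : measurable [set y | B (y, w)].
    by rewrite -[X in measurable X]setTI; exact: (pair2_measurable w).
  have := (dominated hH1 x a) ; move=> /null_content_dominatesP/(_ _ mBw Bw0).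
  rewrite ((rmr hH1).2 x a _ mBw) => P0.
  rewrite -[RHS]P0 -[X in PE X]setIT -integral_indic//.
  by rewrite -[X in measurable X]setTI; apply: (measurable_kap_noise x a hH).
have mG : measurable_fun setT (fun w : Omega => \int[ref D h \x PE]_t F (t, w))%E.
  pose nu : probability (S * E)%type R := (ref D h \x PE)%E.
  have mG := @measurable_fun_fubini_tonelli_G _ _ _ _ _ nu _ mF F0.
  exact: (measurableT_comp mG (@measurable_Om h.+1)).
rewrite (ae_eq_integral (cst 0%E) _ measurableT mG)//; last first.
  have [C [mC C0 CF]] := inner0.
  exists C; split => // w /= nF; apply: CF => /= Fw0; apply: nF => _; exact: Fw0.
rewrite integral0 => int0.
have mFS : measurable_fun setT (fun w : Omega => F (sp ti w, w)).
  apply: (measurableT_comp mF); apply: measurable_fun_pair; first exact: measurable_sp.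
  exact: measurable_Om.
apply: filterS (ge0_integral_eq0_ae mFS (fun w => F0 _) int0) => w.
rewrite /F /= => -[] /eqP; rewrite indicE; case: (boolP (_ \in _)).
  by rewrite oner_eq0.
by move=> /negP nB _ Bw; apply: nB; exact: mem_set.
Qed.

(** The coefficients see the approximation of the next level only at the next states
    of the samples. *)
Lemma betaN_ae h V V' a : (h < H)%N ->
  measurable_fun setT (V : S * Om h.+1 -> R) ->
  measurable_fun setT (V' : S * Om h.+1 -> R) ->
  {ae ref D h.+1 \x Pr, forall z, V z = V' z}%E ->
  {ae Pr, forall w, beta h V a w = beta h V' a w}.
Proof.
move=> hH mV mV' VV'.
pose B : set (S * Om h.+1) := [set z | V z != V' z].
have mB : measurable B.
  rewrite (_ : B = ~` ((fun z => V z - V' z) @^-1` [set 0])).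
    apply: measurableC; rewrite -[X in measurable X]setTI.
    by apply: measurable_funB.
  apply/seteqP; split => z; rewrite /B /=.
    by move=> /eqP VV VV0; apply: VV; apply/eqP; rewrite -subr_eq0 VV0.
  by move=> VV0; apply/eqP => VV; apply: VV0; rewrite VV subrr.
have B0 : (ref D h.+1 \x Pr)%E (B : set (S * Omega)) = 0%E.
  apply/eqP; rewrite -measure_le0; have [C [mC C0 BC]] := VV'.
  rewrite -C0 le_measure ?inE//; first exact: measurable_set_S_Om.
  by move=> z /= Bz; apply: BC => /= VV; move: Bz; rewrite /B/= VV eqxx.
have : {ae Pr, forall w, forall i : 'I_N,
    V (kap h.+1 (X h i w, a, eps h i w), w) = V' (kap h.+1 (X h i w, a, eps h i w), w)}.
  have H1 : {ae Pr, forall w, forall k : nat, forall kN : (k < N)%N,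
      let i := Ordinal kN in
      V (kap h.+1 (X h i w, a, eps h i w), w) = V' (kap h.+1 (X h i w, a, eps h i w), w)}.
    apply: ae_foralln => k; have [kN|Nk] := pselect (k < N)%N; last first.
      by apply: aeW => w kN; case: Nk.
    apply: filterS (null_next_state a (Ordinal kN) hH mB B0) => w nB kN'.
    rewrite (bool_irrelevance kN' kN) /=.
    by apply/eqP; apply: contrapT => /negP VV; apply: nB.
  by apply: filterS H1 => w Hw [k kN]; exact: (Hw k kN).
apply: filterS => w Vw; rewrite /betaN; congr (_ *: _).
by apply: eq_bigr => i _; rewrite Vw.
Qed.

Local Notation VNh := (VN M D Rmax X eps kap).

Lemma VNE h : (h < H)%N -> VNh h =
  esssup (ref D h \x Pr)%E (samples_from M X eps h) (fun a z => update h (VNh h.+1) a z).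
Proof.
move=> hH; rewrite /VN -(subnSK hH) [LHS]/=.
by rewrite (subnSK hH) subKn// ltnW.
Qed.

Lemma is_esssup_Vt h : (h < H)%N ->
  is_esssup (ref D h \x Pr)%E (samples_from M X eps h)
    (fun a z => update h (Vt h.+1) a z) (Vt h).
Proof.
move=> hH; rewrite (VtE hH); apply: is_esssup_seq_sup.
  by apply/measurable_wrt_samples; rewrite -(VtE hH); exact: measurable_Vt.
move=> a; have := ae_fst Pr (update_le_Vt a hH).
by apply: filterS => -[x w] /(_ w); rewrite (VtE hH).
Qed.

(** Approximations that agree almost everywhere give coefficients that agree almost
    surely, and then the essential suprema of the previous level agree. *)
Lemma VN_eq_Vt h : (h <= H)%N ->
  measurable_fun setT (VNh h : S * Om h -> R) /\
  {ae ref D h \x Pr, forall z, VNh h z = Vt h z}%E.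
Proof.
move: h; apply: (backward_ind (Q := fun h => (h <= H)%N -> _)) => h hH.
  move=> Hh; have {Hh}hH : h = H by apply/eqP; rewrite eqn_leq Hh hH.
  have -> : VNh h = Vt h by rewrite /VN /Vt hH subnn.
  by split; [exact: measurable_Vt|apply: aeW].
move=> /(_ hH) [mVN VNVt] _.
have ess : is_esssup (ref D h \x Pr)%E (samples_from M X eps h)
    (fun a z => update h (VNh h.+1) a z) (Vt h).
  apply: eq_is_esssup (is_esssup_Vt hH) => a.
  have mVt := @measurable_Vt h.+1.
  have := ae_snd (ref D h) (betaN_ae a hH mVN mVt VNVt).
  by apply: filterS => z; rewrite /update => ->.
have := esssupP ess; rewrite -(VNE hH) => essVN; split.
  by apply/measurable_wrt_samples; case: essVN.
exact: is_esssup_unique essVN ess.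
Qed.

(** * The regression noise *)

Local Notation joint h := (ref D h \x PE)%E.

(** Deviation of an empirical mean over the samples of level h from its
    conditional expectation given the later levels. *)
Definition deviation h (F : (S * E) * Omega -> R) (w : Omega) : R :=
  N%:R^-1 * \sum_(i < N) F ((X h i w, eps h i w), w)
  - \int[joint h]_s F (s, w).

Lemma bmf_sample h (F : (S * E) * Om h.+1 -> R) (B : R) (w : Om h.+1) :
  measurable_fun setT F -> (forall z, `|F z| <= B) -> bmf (fun s => F (s, w)).
Proof. by move=> mF FB; apply: (bmf_intro (B := B)) => //; exact: (measurable_fun_pair1 w mF). Qed.

Lemma measurable_Rintegral_sample h (F : (S * E) * Om h.+1 -> R) (B : R) :
  measurable_fun setT F -> (forall z, `|F z| <= B) ->
  measurable_fun setT (fun w : Om h.+1 => \int[joint h]_s F (s, w)).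
Proof.
move=> mF FB; pose nu : probability (S * E)%type R := joint h.
have bF w := bmf_sample w mF FB.
have -> : (fun w => \int[joint h]_s F (s, w)) =
    (fun w => fine (\int[nu]_s (F (s, w) + B)%:E)%E - B).
  apply/funext => w; rewrite -[fine _]/(\int[nu]_s (F (s, w) + B)).
  rewrite bmf_RintegralD//; last exact: bmf_cst.
  by rewrite [\int[_]__ B]Rintegral_cst//= probability_setT mulr1 addrK.
apply: measurable_funB => //; apply: measurableT_comp => //.
apply: (@measurable_fun_fubini_tonelli_G _ _ _ _ _ nu (fun z => (F z + B)%:E)).
  by apply/measurable_EFinP; exact: measurable_funD.
by move=> z; rewrite lee_fin; have := FB z; rewrite ler_norml => /andP[+ _]; lra.
Qed.

Lemma measurable_deviation h (F : (S * E) * Om h.+1 -> R) (B : R) :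
  measurable_fun setT F -> (forall z, `|F z| <= B) ->
  measurable_fun setT (deviation h F).
Proof.
move=> mF FB; apply: measurable_funB; last first.
  exact: measurableT_comp (measurable_Rintegral_sample mF FB) (@measurable_Om h.+1).
apply: measurable_funM => //; apply: measurable_sum => i.
apply: (measurableT_comp mF); apply: measurable_fun_pair.
  by apply: measurable_fun_pair; exact: measurable_funP.
exact: measurable_Om.
Qed.

Lemma deviation_bound h (F : (S * E) * Om h.+1 -> R) (B : R) w :
  measurable_fun setT F -> (forall z, `|F z| <= B) -> `|deviation h F w| <= 2 * B.
Proof.
move=> mF FB; rewrite /deviation (le_trans (ler_normB _ _))// mulr_natl mulr2n.
have [mFw _] := bmf_sample w mF FB.
apply: lerD.
  rewrite normrM ger0_norm ?invr_ge0// ler_pdivrMl ?ltr0n//.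
  rewrite (le_trans (ler_norm_sum _ _ _))//.
  rewrite (le_trans (ler_sum _ (fun i _ => FB _)))// sumr_const card_ord.
  by rewrite mulr_natl.
exact: (@Rintegral_bound _ _ _ (joint h) _ B mFw).
Qed.

Lemma deviationB h (F G : (S * E) * Om h.+1 -> R) (B C : R) w :
  measurable_fun setT F -> (forall z, `|F z| <= B) ->
  measurable_fun setT G -> (forall z, `|G z| <= C) ->
  deviation h F w - deviation h G w = deviation h (fun z => F z - G z) w.
Proof.
move=> mF FB mG GC; rewrite /deviation sumrB.
have bF := bmf_sample w mF FB; have bG := bmf_sample w mG GC.
have -> := bmf_RintegralB ((ref D h \x PE)%E : probability _ R) bF bG.
by ring.
Qed.

(** Given the later levels, a normalized sum of N independent centred variables
    bounded by 2 B. *)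
Lemma deviation_mgf h (F : (S * E) * Om h.+1 -> R) (B l : R) : (h < H)%N ->
  measurable_fun setT F -> (forall z, `|F z| <= B) ->
  (\int[Pr]_w (expR (l * deviation h F w))%:E
   <= (expR (2 * (l * (2 * B / Num.sqrt N%:R)) ^+ 2))%:E)%E.
Proof.
move=> hH mF FB; pose nu : probability (S * E)%type R := joint h.
have bF w := bmf_sample w mF FB.
pose V (z : (S * E) * Om h.+1) := F z - \int[nu]_s F (s, z.2).
have mV : measurable_fun setT V.
  apply: measurable_funB => //.
  exact: measurableT_comp (measurable_Rintegral_sample mF FB) measurable_snd.
have VB z : `|V z| <= 2 * B.
  rewrite /V (le_trans (ler_normB _ _))// mulr_natl mulr2n lerD//.
  by apply: Rintegral_bound => [|s]; [exact: (bF z.2).1|exact: FB].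
have V0 w : \int[nu]_t V (t, w) = 0.
  have -> := bmf_RintegralB nu (bF w) (bmf_cst (\int[nu]_s F (s, w))).
  by rewrite [X in _ - X]Rintegral_cst//= probability_setT mulr1 subrr.
pose s := [seq (Ordinal hH, i) | i <- enum 'I_N] : seq ('I_H * 'I_N).
have us : uniq s by rewrite map_inj_uniq ?enum_uniq// => i j [].
have sJ ti : ti \in s -> ti \notin levels_from h.+1.
  by move=> /mapP[i _ ->]; rewrite unfold_in /levels_from /= ltnn.
have [law prod] := indep.
have laws ti (C : set (S * E)) : ti \in s -> measurable C -> Pr (sp ti @^-1` C) = nu C.
  by move=> /mapP[i _ ->] mC; rewrite law.
have := @sample_mgf _ _ _ _ _ _ Pr sp measurable_sp prod nu (levels_from h.+1) s V
  (2 * B) (l / N%:R) us sJ laws mV VB V0.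
have NR : N%:R != 0 :> R by rewrite pnatr_eq0 -lt0n.
have -> : size s = N by rewrite size_map size_enum_ord.
congr ((_ <= _%:E)%E); last first.
  rewrite (_ : (l * (2 * B / Num.sqrt N%:R)) ^+ 2 = (l * (2 * B)) ^+ 2 / Num.sqrt N%:R ^+ 2).
    by rewrite sqr_sqrtr//; congr expR; field.
  by rewrite mulrA exprMn exprVn.
apply: eq_integral => w _; congr (expR _)%:E.
rewrite /deviation -mulrA; congr (_ * _).
rewrite /s big_map big_enum/= /V sumrB/= sumr_const card_ord mulrBr.
congr (_ - _); last by rewrite -[(\int[nu]_s F (s, w)) *+ N]mulr_natl mulKf.
Qed.

Lemma deviation_L2 h (F : (S * E) * Om h.+1 -> R) (B : R) : (h < H)%N ->
  measurable_fun setT F -> (forall z, `|F z| <= B) ->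
  L2_le Pr (deviation h F) (12 * B / Num.sqrt N%:R).
Proof.
move=> hH mF FB; have mdev := measurable_deviation mF FB.
have B0 : 0 <= B := le_trans (normr_ge0 _) (FB point).
have sN : 0 < Num.sqrt N%:R :> R by rewrite sqrtr_gt0 ltr0n.
have [B_eq0|Bn0] := eqVneq B 0.
  rewrite B_eq0 mulr0 mul0r.
  apply: L2_le_mono (L2_le0 Pr) => // w; have := deviation_bound w mF FB.
  by rewrite B_eq0 mulr0 normr0.
have s0 : 0 < 2 * B / Num.sqrt N%:R by rewrite divr_gt0// mulr_gt0// lt_def Bn0.
have [g Lg gX] := @subgaussian_envelope _ _ _ Pr 1 (fun=> deviation h F) _ (ltn0Sn 0) s0
  (fun=> mdev) (fun _ l => deviation_mgf l hH mF FB).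
apply: L2_le_mono (L2_le_ler _ Lg) => //.
  by move=> w; apply: le_trans (gX ord0 w) (ler_norm _).
by rewrite ln1 sqrtr0 addr0 mulr1 le_eqVlt; apply/orP; left; apply/eqP; ring.
Qed.

(** The coefficients that the samples of level h estimate, given the later
    levels. *)
Definition beta_mean h a (w : Omega) : 'cV[R]_K :=
  \col_k \int[joint h]_s summand h (Vt h.+1) a k (s, w).

Lemma summand_bound h a k z : (h < H)%N ->
  `|summand h (Vt h.+1) a k z| <= Vmax * LamK.
Proof.
by move=> hH; rewrite normrM ler_pM// ?Vt_bound_Vmax// dual_bound.
Qed.

Lemma summand_dist h a a' k z : (h < H)%N ->
  `|summand h (Vt h.+1) a k z - summand h (Vt h.+1) a' k z| <= tau a a' * LamK.
Proof.
by move=> hH; rewrite -mulrBl normrM ler_pM// ?dual_bound// Vt_kap_dist.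
Qed.

Lemma deviation_summand h a k w :
  deviation h (summand h (Vt h.+1) a k) w =
  (beta h (Vt h.+1) a w - beta_mean h a w) k ord0.
Proof. by rewrite mxE betaN_coord [X in _ = _ + X]mxE mxE. Qed.

(** Uniformly in the action, the noise of the coefficients is controlled by
    chaining: its increments are sub-Gaussian at the scale 1 / sqrt N, and they
    are Lipschitz for every outcome. *)
Lemma noise_envelope h (t : R) : (h < H)%N ->
  ((LVK * LK)%:E * dudley rhoA + (LVK * LK)%:E * diameter rhoA = t%:E)%E ->
  exists2 g : Omega -> R,
    L2_le Pr g (Num.sqrt K%:R * (LamK / Num.sqrt N%:R * (48 * (1 + nA)) * (t + Vmax)))
  & forall a w, enorm (beta h (Vt h.+1) a w - beta_mean h a w) <= g w.
Proof.
move=> hH tE; have sN : 0 < Num.sqrt N%:R :> R by rewrite sqrtr_gt0 ltr0n.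
have dud0 : (0 <= dudley rhoA)%E by apply: integral_ge0 => u _; exact: sqrte_ge0.
have diam0 : (0 <= diameter rhoA)%E.
  apply: le_trans (le_diameter rhoA point point).
  by rewrite lee_fin metric_ge0.
have LL0 : 0 <= LVK * LK by rewrite mulr_ge0// LVK_ge0.
have t0 : 0 <= t by rewrite -lee_fin -tE adde_ge0// mule_ge0.
pose q := 2 * LamK * nA / Num.sqrt N%:R.
have q0 : 0 <= q by rewrite divr_ge0 ?sqrtr_ge0// !mulr_ge0 ?LamK_ge0 ?nA_ge0.
pose s := q * (LVK * LK).
have s0 : 0 <= s by exact: mulr_ge0.
have fin1 : (s%:E * dudley rhoA < +oo)%E.
  rewrite /s EFinM -muleA; apply: lte_mul_pinfty => //.
  apply: le_lt_trans (ltry t); rewrite -tE leeDl// mule_ge0//.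
have fin2 : (s%:E * diameter rhoA < +oo)%E.
  rewrite /s EFinM -muleA; apply: lte_mul_pinfty => //.
  apply: le_lt_trans (ltry t); rewrite -tE leeDr// mule_ge0//.
pose Z k a w := deviation h (summand h (Vt h.+1) a k) w.
have mS a k := measurable_summand a k hH (@measurable_Vt h.+1).
have mSB a a' k : measurable_fun setT ((fun z => summand h (Vt h.+1) a k z
    - summand h (Vt h.+1) a' k z) : (S * E) * Om h.+1 -> R).
  exact: measurable_funB.
have SB a k z := summand_bound a k z hH.
have SD a a' k z := summand_dist a a' k z hH.
have ZB k a a' w : Z k a w - Z k a' w =
    deviation h (fun z => summand h (Vt h.+1) a k z - summand h (Vt h.+1) a' k z) w.
  exact: (deviationB w (mS a k) (SB a k) (mS a' k) (SB a' k)).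
have bd k : exists g, L2_le Pr g (LamK / Num.sqrt N%:R * (48 * (1 + nA)) * (t + Vmax)) /\
    forall a w, `|Z k a w| <= g w.
  have mZ a : measurable_fun setT (Z k a) by exact: measurable_deviation (mS a k) (SB a k).
  have mgf a a' l : (\int[Pr]_w (expR (l * (Z k a w - Z k a' w)))%:E
      <= (expR (2 * (l * (s * rhoA a a')) ^+ 2))%:E)%E.
    under eq_integral do rewrite ZB.
    apply: le_trans (deviation_mgf l hH (mSB a a' k) (SD a a' k)) _.
    by rewrite /tau /s /q le_eqVlt; apply/orP; left; apply/eqP; congr (expR _)%:E; ring.
  have lip a a' w : `|Z k a w - Z k a' w| <= s * 2 ^+ N * rhoA a a'.
    rewrite ZB; apply: le_trans (deviation_bound w (mSB a a' k) (SD a a' k)) _.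
    have := inv2X_le_inv_sqrt (R := R) N0.
    have p2 : 0 < 2 ^+ N :> R by exact: exprn_gt0.
    rewrite exprVn => h1; have {}h1 : 1 <= 2 ^+ N / Num.sqrt N%:R :> R.
      by rewrite -[leLHS](mulfV (lt0r_neq0 p2)) ler_wpM2l// ltW.
    rewrite (_ : s * _ * _ = 2 * (tau a a' * LamK) * (2 ^+ N / Num.sqrt N%:R)).
      rewrite ler_peMr// mulr_ge0// mulr_ge0 ?LamK_ge0//.
      by rewrite mulr_ge0 ?LVKn_ge0//; exact: metric_ge0.
    by rewrite /tau /s /q; ring.
  have base := deviation_L2 hH (mS point k) (SB point k).
  have [g [b [Lg gZ bE]]] := chaining_bound metricA s0 mZ mgf lip base N0 fin1 fin2.
  exists g; split => //; apply: L2_le_ler Lg.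
  rewrite -lee_fin; apply: le_trans bE _.
  have -> : ((24 * s)%:E * (dudley rhoA + diameter rhoA) = (24 * q * t)%:E)%E.
    rewrite /s mulrA EFinM -muleA ge0_muleDr//.
    by rewrite tE.
  rewrite lee_fin /q.
  have -> : LamK / Num.sqrt N%:R * (48 * (1 + nA)) * (t + Vmax) =
    12 * (Vmax * LamK) / Num.sqrt N%:R +
    24 * (2 * LamK * nA / Num.sqrt N%:R) * t +
    LamK / Num.sqrt N%:R * (48 * t + (36 + 48 * nA) * Vmax) by ring.
  rewrite lerDl mulr_ge0 ?divr_ge0 ?LamK_ge0 ?sqrtr_ge0//.
  have := Ltilde_ge0 0; have := nA_ge0; move: nA Vmax => n v n0 v0.
  by rewrite addr_ge0 ?mulr_ge0 ?addr_ge0 ?mulr_ge0.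
have /choice[g Hg] := bd.
set bb := LamK / _ * _ * _ in Hg *.
exists (fun w => enorm (\col_k g k w)).
  split.
  - apply: measurableT_comp.
      exact: continuous_measurable_fun (@sqrt_continuous R).
    apply: measurable_sum => k; apply: measurable_funX.
    under eq_fun do rewrite mxE.
    by have [[]] := Hg k.
  - rewrite mulr_ge0 ?sqrtr_ge0// mulr_ge0 ?addr_ge0 ?Ltilde_ge0//.
    by rewrite mulr_ge0 ?divr_ge0 ?LamK_ge0 ?sqrtr_ge0// mulr_ge0// addr_ge0 ?nA_ge0.
  - under eq_integral do rewrite sqr_enorm -sumEFin.
    rewrite ge0_integral_sum//; last 2 first.
    + move=> k; apply: measurable_sqr_EFin; under eq_fun do rewrite mxE.
      by have [[]] := Hg k.
    + by move=> k w _; rewrite lee_fin sqr_ge0.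
    rewrite exprMn sqr_sqrtr//.
    apply: (@le_trans _ _ (\sum_(k < K) (bb ^+ 2)%:E)%E).
      apply: lee_sum => k _; under eq_integral do rewrite mxE.
      by have [[]] := Hg k.
    by rewrite sumEFin lee_fin sumr_const card_ord mulr_natl.
move=> a w; rewrite /enorm ler_wsqrtr// ler_sum// => k _.
rewrite -deviation_summand mxE -(real_normK (num_real (deviation _ _ _))).
rewrite lerXn2r ?nnegrE//; last exact: (Hg k).2.
exact: le_trans (normr_ge0 _) ((Hg k).2 a w).
Qed.

(** * The conditional expectation of the coefficients is a projection *)

Lemma bmf_Vt h w : bmf (fun x => Vt h (x, w)).
Proof.
apply: (bmf_intro (B := Vmax)) => [|x]; first exact: measurable_Vt_section.
exact: Vt_bound_Vmax.
Qed.

Lemma PopB h a (V V' : S -> R) x : bmf V -> bmf V' ->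
  Pop M h a V x - Pop M h a V' x = Pop M h a (fun y => V y - V' y) x.
Proof.
by move=> bV bV'; exact: esym (bmf_RintegralB (kernel_at (trans M h) (x, a)) bV bV').
Qed.

Lemma Pop_ae_eq h a (V V' : S -> R) x : (h < H)%N ->
  measurable_fun setT V -> measurable_fun setT V' ->
  {ae ref D h.+1, forall y, V y = V' y} -> Pop M h.+1 a V x = Pop M h.+1 a V' x.
Proof.
move=> hH mV mV' [B [mB B0 VB]]; rewrite /Pop /Rintegral; congr fine.
apply: ae_eq_integral => //; [exact/measurable_EFinP|exact/measurable_EFinP|].
exists B; split => //; last by move=> y /= nV; apply: VB => /= VV; apply: nV => _; rewrite VV.
by have := @dominated h.+1 hH x a => /null_content_dominatesP; exact.
Qed.

Lemma Pop_kap h a (V : S -> R) x : (h < H)%N -> bmf V ->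
  Pop M h.+1 a V x = \int[PE]_e V (kap h.+1 (x, a, e)).
Proof.
move=> hH bV; have mk := measurable_kap_noise x a hH.
rewrite /Pop /Rintegral; congr fine.
rewrite (eq_measure_integral (pushforward PE (fun e => kap h.+1 (x, a, e)))); last first.
  by move=> B mB _; exact: (rmr (h := h.+1) hH).2.
rewrite integral_pushforward//; first by apply/measurable_EFinP; exact: bV.1.
apply: (bmf_integrable PE (f := fun e => V (kap h.+1 (x, a, e)))).
have [mV [B VB]] := bV; apply: (bmf_intro (B := B)) => //.
exact: measurableT_comp mV mk.
Qed.

(** Integrating out the noise of a sample turns the value at its next state into the
    expectation under the transition kernel. *)
Lemma beta_meanE h a w : (h < H)%N -> beta_mean h a w =
  projection_coef (ref D h) gam (Pop M h.+1 a (fun y => Vt h.+1 (y, w))).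
Proof.
move=> hH; apply/matrixP => k j; rewrite [j]ord1 !mxE.
have bs : bmf (fun s : S * E => summand h (Vt h.+1) a k (s, w)).
  exact: bmf_sample (measurable_summand a k hH (@measurable_Vt h.+1))
    (fun z => summand_bound a k z hH).
rewrite (bmf_Rintegral_prod (ref D h) PE bs).
apply: eq_Rintegral => x _; rewrite /summand/=.
rewrite (Pop_kap a x hH (bmf_Vt h.+1 w)) -[dual_basis _ _ _]/(dual h x).
have bk : bmf (fun e => Vt h.+1 (kap h.+1 (x, a, e), w)).
  apply: (bmf_intro (B := Vmax)) => [|e]; last exact: Vt_bound_Vmax.
  exact: measurableT_comp (bmf_Vt h.+1 w).1 (measurable_kap_noise x a hH).
rewrite -bmf_RintegralZl//.
by apply: eq_Rintegral => e _; rewrite mulrC.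
Qed.

Definition coefs h w a := beta h (Vt h.+1) a w.

Lemma measurable_Vzeta h w : (h <= H)%N ->
  measurable_fun setT (Vzeta M D Rmax h (coefs h w)).
Proof.
rewrite leq_eqVlt => /predU1P[->|hH].
  by rewrite /Vzeta ltnn; exact: measurable_terminal.
rewrite /Vzeta hH; have [mes _ _] := esssupP (is_esssup_Vt_section w hH).
by move=> _ B mB; rewrite setTI; exact: mes.
Qed.

Lemma Pop_Vzeta h a w : (h < H)%N ->
  Pop M h.+1 a (Vzeta M D Rmax h.+1 (coefs h.+1 w)) =
  Pop M h.+1 a (fun y => Vt h.+1 (y, w)).
Proof.
move=> hH; apply/funext => x; apply: Pop_ae_eq => //.
- exact: measurable_Vzeta.
- exact: measurable_Vt_section.
- exact: Vzeta_Vt.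
Qed.

(** The minimizer of the regression risk that defines the approximation error is
    the coefficient that the samples estimate. *)
Lemma betaZ_coefs h a w : (h < H)%N ->
  betaZ M D Rmax h (coefs h.+1 w) a = beta_mean h a w.
Proof.
move=> hH; have [gu _ _ _] := bc.
have bP := bmf_Pop h.+1 a (bmf_Vt h.+1 w).
have riskE b : regression_risk M D h (Vzeta M D Rmax h.+1 (coefs h.+1 w)) a b =
    (risk (ref D h) gam (Pop M h.+1 a (fun y => Vt h.+1 (y, w))) b)%:E.
  by rewrite /regression_risk Pop_Vzeta// EFin_risk//; exact: bmf_basis.
have minE := risk_minimizer bmf_basis (gu h hH) _ bP.
rewrite beta_meanE//; apply: xget_unique => [b'|b bmin]; rewrite /= ?riskE.
  by rewrite lee_fin; move: b'; apply/minE.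
by apply/minE => b'; have := bmin b'; rewrite !riskE lee_fin.
Qed.

(** * The approximation error *)

Definition residual h w a x : R :=
  dotv (beta_mean h a w) (gam x) - Pop M h.+1 a (fun y => Vt h.+1 (y, w)) x.

Lemma residual_bounded h w : (h < H)%N ->
  exists B, forall a x, `|residual h w a x| <= B.
Proof.
move=> hH; have /choice[G HG] : forall k, exists B, forall x, `|gam x k ord0| <= B.
  by move=> k; have [_] := bmf_basis k.
exists (\sum_k Vmax * LamK * G k + Vmax) => a x.
rewrite (le_trans (ler_normB _ _))// lerD//; last first.
  by apply: Pop_bound => [|y]; [exact: measurable_Vt_section|exact: Vt_bound_Vmax].
rewrite (le_trans (ler_norm_sum _ _ _))// ler_sum// => k _.
rewrite normrM ler_pM// mxE.
apply: (@Rintegral_bound _ _ _ ((ref D h \x PE)%E : probability _ R)).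
  exact: (bmf_sample w (measurable_summand a k hH (@measurable_Vt h.+1))
    (fun z => summand_bound a k z hH)).1.
by move=> s; exact: summand_bound.
Qed.

Lemma measurable_residual h w a : (h < H)%N ->
  measurable_fun setT (residual h w a).
Proof.
move=> hH; apply: measurable_funB; first exact: (bmf_dotv bmf_basis _).1.
exact: (bmf_Pop h.+1 a (bmf_Vt h.+1 w)).1.
Qed.

Definition max_residual h w x : R := seq_sup (fun n => `|residual h w (c h n) x|).

Lemma bmf_max_residual h w : (h < H)%N -> bmf (max_residual h w).
Proof.
move=> hH; have [B rB] := residual_bounded w hH.
apply: (bmf_intro (B := B)) => [|x]; last first.
  by apply: seq_sup_bounded => n; rewrite normr_id.
apply: measurable_seq_sup => [n|x]; last by exists B.
by apply: measurableT_comp => //; exact: measurable_residual.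
Qed.

(** The coefficients of a fixed outcome take part in the supremum that defines the
    approximation error, and a supremum along c is almost everywhere below the
    essential supremum. *)
Lemma max_residual_L2 h w (e : R) : (h < H)%N -> 0 <= e ->
  (approx_error M D Rmax h <= e%:E)%E -> L2_le (ref D h) (max_residual h w) e.
Proof.
move=> hH e0 approx; have [B rB] := residual_bounded w hH.
(* The essential supremum of the squared residuals exists, as they are bounded. *)
pose f a x := residual h w a x ^+ 2.
have mf a : measurable_fun setT (f a) by apply: measurable_funX; exact: measurable_residual.
have fB a x : `|f a x| <= B ^+ 2.
  by rewrite normrX lerXn2r ?nnegrE ?(le_trans _ (rB a x)).
have [k Hk] := countable_envelope (ref D h) (point : A) mf fB.
pose es := esssup (ref D h) measurable f.
have [mes fes _] : is_esssup (ref D h) measurable f es.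
  apply: esssupP; apply: (is_esssup_seq_sup (c := k)) => // C mC.
  rewrite -[X in measurable X]setTI; apply: measurable_seq_sup => //.
  by move=> x; exists (B ^+ 2) => n; apply: le_trans (fB (k n) x); exact: ler_norm.
have {}mes : measurable_fun setT es by move=> _ C mC; rewrite setTI; exact: mes.
have esE : (sqrte (\int[ref D h]_x (es x)%:E) <= e%:E)%E.
  apply: le_trans approx; apply: ereal_sup_ubound; exists (coefs h.+1 w).
  rewrite (_ : (fun a y => _) = f)//; apply/funext => a; apply/funext => y.
  by rewrite betaZ_coefs// Pop_Vzeta.
have bm := bmf_max_residual w hH.
split => //; first exact: bm.1.
have m2 : measurable_fun setT (fun x => max_residual h w x ^+ 2).
  by apply: measurable_funX; exact: bm.1.
have aele : {ae ref D h, forall x, max_residual h w x ^+ 2 <= es x}.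
  have : {ae ref D h, forall x n, f (c h n) x <= es x} by apply: ae_foralln => n; exact: fes.
  apply: filterS => x Hx.
  have es0 : 0 <= es x by apply: le_trans (Hx 0%N); exact: sqr_ge0.
  have mr0 : 0 <= max_residual h w x.
    apply: le_trans (normr_ge0 (residual h w (c h 0%N) x)) _.
    by apply: (@seq_sup_ub _ (fun n => `|residual h w (c h n) x|) B) => n.
  rewrite -[es x]sqr_sqrtr// lerXn2r ?nnegrE ?sqrtr_ge0//.
  apply: seq_sup_le => n; rewrite -sqrtr_sqr.
  by rewrite ler_wsqrtr//; exact: Hx.
have le1 : (\int[ref D h]_x (max_residual h w x ^+ 2)%:E
    <= \int[ref D h]_x (es x)%:E)%E.
  have -> : (\int[ref D h]_x (es x)%:E = \int[ref D h]_x (Num.max (es x) 0)%:E)%E.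
    apply: ae_eq_integral => //.
    - exact/measurable_EFinP.
    - by apply/measurable_EFinP; exact: measurable_maxr.
    - apply: filterS aele => x Hx _; rewrite max_l//.
      by apply: le_trans Hx; exact: sqr_ge0.
  apply: ae_ge0_le_integral => //.
  - by move=> x _; rewrite lee_fin sqr_ge0.
  - exact/measurable_EFinP.
  - by move=> x _; rewrite lee_fin le_max lexx orbT.
  - by apply/measurable_EFinP; exact: measurable_maxr.
  - by apply: filterS aele => x Hx _; rewrite lee_fin le_max Hx.
apply: le_trans le1 _; move: esE; case: (\int[_]__ _)%E => [r| |]//=; last by move=> _; rewrite leNye.
rewrite !lee_fin => re; have [r0|r0] := leP 0 r.
  by rewrite -(sqr_sqrtr r0) lerXn2r ?nnegrE ?sqrtr_ge0.
by rewrite (le_trans (ltW r0))// sqr_ge0.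
Qed.

(** * A version of the optimal values *)

(** Along the family c the Bellman equation holds at every state, which is what
    allows a comparison with the algorithm state by state. *)
Fixpoint Vh_back (n : nat) : S -> R :=
  if n is n'.+1 then
    fun x => seq_sup (fun k => reward M (H - n) (x, c (H - n) k)
                       + Pop M (H - n).+1 (c (H - n) k) (Vh_back n') x)
  else terminal M.

Definition Vh h := Vh_back (H - h).

Lemma Vh_terminal h : (H <= h)%N -> Vh h = terminal M.
Proof. by rewrite /Vh -subn_eq0 => /eqP ->. Qed.

Lemma VhE h : (h < H)%N -> Vh h =
  fun x => seq_sup (fun k => reward M h (x, c h k) + Pop M h.+1 (c h k) (Vh h.+1) x).
Proof.
move=> hH; rewrite /Vh -(subnSK hH) /=.
by rewrite (subnSK hH) subKn// ltnW.
Qed.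

Lemma Vh_bounded h : measurable_fun setT (Vh h) /\ forall x, `|Vh h x| <= Lt h.
Proof.
elim/backward_ind: h => h hH.
  rewrite Vh_terminal//; split; first exact: measurable_terminal.
  move=> x; rewrite /Ltilde; move: hH; rewrite -subn_eq0 => /eqP ->.
  by rewrite mul1r; have [_ tb _ _] := blr.
move=> [mV VB]; have bV : bmf (Vh h.+1) by exact: bmf_intro VB.
have ub k x := backup_bound (c h k) x hH mV VB.
rewrite VhE//; split; last by move=> x; exact: seq_sup_bounded.
apply: measurable_seq_sup => [k|x].
  apply: measurable_funD; first exact: measurable_reward_at.
  exact: (bmf_Pop h.+1 (c h k) bV).1.
by exists (Lt h) => k; apply: le_trans (ub k x); exact: ler_norm.
Qed.

Lemma bmf_Vh h : bmf (Vh h).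
Proof. by have [mV VB] := Vh_bounded h; exact: bmf_intro VB. Qed.

Definition gap h w x : R := `|Vh h x - Vt h (x, w)|.

Lemma bmf_gap h w : bmf (gap h w).
Proof. by apply: bmf_norm; apply: bmfB; [exact: bmf_Vh|exact: bmf_Vt]. Qed.

(** One step of the backward recursion: the gap at the next level is propagated
    by the transitions, and the step itself adds the approximation error and the
    noise of the coefficients. *)
Lemma gap_recursion h w x (g : R) : (h < H)%N ->
  (forall a, enorm (beta h (Vt h.+1) a w - beta_mean h a w) <= g) ->
  gap h w x <= seq_sup (fun n => Pop M h.+1 (c h n) (gap h.+1 w) x)
               + (max_residual h w x + g * enorm (gam x)).
Proof.
move=> hH noise; have [mV VB] := Vh_bounded h.+1.
have bg := bmf_gap h.+1 w.
have gapB y : `|gap h.+1 w y| <= Lt h.+1 + Lt h.+1.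
  rewrite normr_id (le_trans (ler_normB _ _))// lerD//.
  exact: Vt_bound.
have PB n : Pop M h.+1 (c h n) (gap h.+1 w) x <= Lt h.+1 + Lt h.+1.
  by apply: le_trans (ler_norm _) _; apply: Pop_bound => //; exact: bg.1.
have [B rB] := residual_bounded w hH.
rewrite /gap VhE// VtE//; apply: (@seq_sup_dist _ _ _ (Lt h)) => n.
- exact: backup_bound.
- exact: update_bound.
rewrite /update/= opprD addrACA subrr add0r.
rewrite -[Pop M _ _ _ _](trunc_id (L := Lt h.+1)); last exact: Pop_bound.
apply: le_trans (trunc_dist _ _ _) _.
set P := Pop _ _ _ _ _; set P' := Pop M h.+1 (c h n) (fun y => Vt h.+1 (y, w)) x.
set b := dotv _ _; set b' := dotv (beta_mean h (c h n) w) (gam x).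
have -> : P - b = (P - P') + (- (b' - P') + (b' - b)) by ring.
rewrite (le_trans (ler_normD _ _))// lerD//.
  apply: le_trans (seq_sup_ub (u := fun n => Pop M h.+1 (c h n) (gap h.+1 w) x) n PB).
  rewrite /P /P' PopB//; [|exact: bmf_Vh|exact: bmf_Vt].
  have bd : bmf (fun y => Vh h.+1 y - Vt h.+1 (y, w)).
    by apply: bmfB; [exact: bmf_Vh|exact: bmf_Vt].
  have iP := bmf_integrable (kernel_at (trans M h.+1) (x, c h n)) bd.
  exact: (le_normr_Rintegral measurableT iP).
rewrite (le_trans (ler_normD _ _))// lerD//.
  rewrite normrN; apply: (seq_sup_ub (u := fun n => `|residual h w (c h n) x|) (B := B)).
  by move=> k; exact: rB.
rewrite -dotvBl (le_trans (dotv_le_enorm _ _))// ler_wpM2r ?enorm_ge0//.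
rewrite (le_trans _ (noise (c h n)))// le_eqVlt; apply/orP; left; apply/eqP.
by rewrite /enorm; congr Num.sqrt; apply: eq_bigr => i _; rewrite !mxE -sqrrN opprB.
Qed.

Lemma bmf_enorm_basis : bmf (fun x => enorm (gam x)).
Proof.
have /choice[G HG] : forall k, exists B, forall x, `|gam x k ord0| <= B.
  by move=> k; have [_] := bmf_basis k.
apply: (bmf_intro (B := Num.sqrt (\sum_k G k ^+ 2))) => [|x].
  apply: measurableT_comp; first exact: continuous_measurable_fun (@sqrt_continuous R).
  by apply: measurable_sum => k; apply: measurable_funX; exact: measurable_basis.
rewrite ger0_norm ?enorm_ge0// ler_wsqrtr// ler_sum// => k _.
rewrite -(real_normK (num_real (gam x k ord0))) lerXn2r ?nnegrE//.
exact: le_trans (normr_ge0 _) (HG k x).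
Qed.

Hypothesis bellman_skeleton : forall h, (h < H)%N -> forall a,
  {ae ref D h, forall x,
     bellman_term h a x <= seq_sup (fun n => bellman_term h (c h n) x)}.

(** Both sides are essential suprema of the same family once they agree at the next
    level: transition kernels are dominated by the reference measure. *)
Lemma Vstar_eq_Vh h : (h <= H)%N -> {ae ref D h, forall x, Vstar M h x = Vh h x}.
Proof.
move: h; apply: (backward_ind (Q := fun h => (h <= H)%N -> _)) => h hH.
  move=> Hh; have {Hh}hH : h = H by apply/eqP; rewrite eqn_leq Hh hH.
  by apply: aeW => x; rewrite hH Vstar_terminal Vh_terminal.
move=> /(_ hH) IH _; have mVs := measurable_Vstar hH.
have [mVh VhB] := Vh_bounded h.+1.
have termE a x : bellman_term h a x = reward M h (x, a) + Pop M h.+1 a (Vh h.+1) x.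
  congr (_ + _); apply: Pop_ae_eq => //; first exact: measurable_trunc.
  by apply: filterS IH => y ->; rewrite trunc_id.
have backupE a x : reward M h (x, a) + Pop M h.+1 a (Vstar M h.+1) x = bellman_term h a x.
  by rewrite termE; congr (_ + _); exact: Pop_ae_eq.
have ess1 : is_esssup (ref D h) measurable (bellman_term h) (Vstar M h).
  by apply: eq_is_esssup (bellman hH) => a; apply: aeW => x; exact: backupE.
have VhE' : Vh h = fun x => seq_sup (fun n => bellman_term h (c h n) x).
  rewrite VhE//; apply/funext => x; congr seq_sup; apply/funext => n.
  by rewrite termE.
apply: is_esssup_unique ess1 _; rewrite VhE'.
apply: is_esssup_seq_sup; last by move=> a; exact: bellman_skeleton.
move=> B mB; rewrite -VhE' -[X in measurable X]setTI.
by apply: (bmf_Vh h).1.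
Qed.

Variables (vrho rho nb : R) (ex : nat -> R).
Hypotheses (vrho0 : 0 <= vrho) (moment : second_moment_bound M D vrho).
Hypothesis rhoE : Rfrak_max M D = rho%:E.
Hypothesis noise : forall h, (h < H)%N ->
  exists2 g : Omega -> R, L2_le Pr g nb
  & forall a w, enorm (beta h (Vt h.+1) a w - beta_mean h a w) <= g w.

Lemma gap_L2 h : (h <= H)%N ->
  (forall l, (h <= l < H)%N -> 0 <= ex l /\ (approx_error M D Rmax l <= (ex l)%:E)%E) ->
  exists g : nat -> Omega -> R,
  (forall l, (l < H)%N -> L2_le Pr (g l) nb) /\
  forall w, L2_le (ref D h) (gap h w)
    (rho * \sum_(h <= l < H) (ex l + vrho * g l w)).
Proof.
move=> hH approx.
have /choice[g Hg] : forall l, exists g : Omega -> R, (l < H)%N -> L2_le Pr g nb /\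
    forall a w, enorm (beta l (Vt l.+1) a w - beta_mean l a w) <= g w.
  move=> l; have [lH|Hl] := pselect (l < H)%N; last by exists (fun=> 0).
  by have [g Lg gb] := noise lH; exists g.
exists g; split => [l lH|w]; first exact: (Hg l lH).1.
have g0 l : (l < H)%N -> 0 <= g l w.
  move=> lH; exact: le_trans (enorm_ge0 _) ((Hg l lH).2 point w).
pose err l x := if (l < H)%N then max_residual l w x + g l w * enorm (gam x) else 0.
have berr l : bmf (err l).
  rewrite /err; have [lH|lH] := boolP (l < H)%N; last exact: bmf_cst.
  apply: bmfD; first exact: bmf_max_residual.
  by apply: bmfM; [exact: bmf_cst|exact: bmf_enorm_basis].
have mr0 l x : (l < H)%N -> 0 <= max_residual l w x.
  move=> lH; have [B rB] := residual_bounded w lH.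
  apply: le_trans (normr_ge0 (residual l w (c l 0%N) x)) _.
  by apply: (@seq_sup_ub _ (fun n => `|residual l w (c l n) x|) B) => n.
apply: (@error_propagation _ _ _ _ _ _ _ _ dominated rho c (gap^~ w) err) => //.
- by move=> l; exact: bmf_gap.
- by move=> l x; exact: normr_ge0.
- move=> l x; rewrite /err; have [lH|//] := boolP (l < H)%N.
  by rewrite addr_ge0 ?mr0// mulr_ge0 ?enorm_ge0 ?g0.
- by move=> x; rewrite /gap Vh_terminal// Vt_terminal// subrr normr0.
- move=> l x lH; rewrite /err lH; apply: gap_recursion => //.
  by move=> a; exact: (Hg l lH).2.
move=> l hlH; have [e0 ae] := approx l hlH.
have /andP[_ lH] := hlH; rewrite /err lH.
apply: L2_le_add; first exact: max_residual_L2.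
have Lv : L2_le (ref D l) (fun x => enorm (gam x)) vrho.
  by split => //; [exact: bmf_enorm_basis.1|exact: moment].
by have := L2_le_scale (g l w) Lv; rewrite (ger0_norm (g0 l lH)) [_ * vrho]mulrC.
Qed.

(** In the bound of [gap_L2] only the noise depends on the outcome. *)
Lemma expected_gap h : (h <= H)%N ->
  (forall l, (h <= l < H)%N -> 0 <= ex l /\ (approx_error M D Rmax l <= (ex l)%:E)%E) ->
  L2_le (ref D h \x Pr)%E (fun z => Vh h z.1 - Vt h z)
    (rho * \sum_(h <= l < H) (ex l + vrho * nb)).
Proof.
move=> hH approx; have [g [Lg gapw]] := gap_L2 hH approx.
have rho1 : 1 <= rho by rewrite -lee_fin -rhoE Rfrak_max_ge1.
have rho0 : 0 <= rho by exact: le_trans rho1.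
have Lw : L2_le Pr (fun w => rho * \sum_(h <= l < H) (ex l + vrho * g l w))
    (rho * \sum_(h <= l < H) (ex l + vrho * nb)).
  rewrite -{2}(ger0_norm rho0); apply: L2_le_scale.
  apply: (L2_le_sum (f := fun l w => ex l + vrho * g l w)
    (b := fun l => ex l + vrho * nb)) => l.
  rewrite mem_index_iota => hlH; have /andP[_ lH] := hlH.
  apply: L2_le_add.
    by have := L2_le_cst Pr (ex l); rewrite (ger0_norm (approx l hlH).1).
  by have := L2_le_scale vrho (Lg l lH); rewrite (ger0_norm vrho0).
have mdiff : measurable_fun setT (fun z : S * Omega => Vh h z.1 - Vt h z).
  apply: measurable_funB; first exact: measurableT_comp (bmf_Vh h).1 measurable_fst.
  exact: measurable_S_Om (@measurable_Vt h).
have [_ b0 Lb] := Lw; split => //; apply: le_trans Lb.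
have m2 := measurable_sqr_EFin mdiff.
have p2 z := ge0_sqr_EFin (fun z : S * Omega => Vh h z.1 - Vt h z) z.
rewrite fubini_tonelli2//.
apply: le_integral_nonmeasurable => w.
  by apply: integral_ge0 => x _; exact: p2.
have [_ _] := gapw w; apply: le_trans.
rewrite /fubini_G le_eqVlt; apply/orP; left; apply/eqP; apply: eq_integral => x _ /=.
by rewrite /gap real_normK ?num_real.
Qed.

Lemma Lnorm_error h : (h <= H)%N ->
  (forall l, (h <= l < H)%N -> 0 <= ex l /\ (approx_error M D Rmax l <= (ex l)%:E)%E) ->
  ('N[ref D h \x Pr]_2%:E [(fun z => (Vstar M h z.1 - VNh h z)%:E)]
   <= (rho * \sum_(h <= l < H) (ex l + vrho * nb))%:E)%E.
Proof.
move=> hH approx; have [mdiff b0 Lb] := expected_gap hH approx.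
have [mVN VNVt] := VN_eq_Vt hH.
rewrite (Lnorm2 (ref D h \x Pr)%E (fun z => Vstar M h z.1 - VNh h z)).
rewrite (ae_eq_integral (fun z => ((Vh h z.1 - Vt h z) ^+ 2)%:E) _ measurableT _ _ _).
- move: b0 Lb; move: (rho * _) => b b0 Lb.
  have -> : b%:E = sqrte (b ^+ 2)%:E by rewrite /= sqrtr_sqr ger0_norm.
  by rewrite lee_sqrt// lee_fin sqr_ge0.
- apply: measurable_sqr_EFin; apply: measurable_funB.
    exact: measurableT_comp (measurable_Vstar hH) measurable_fst.
  exact: measurable_S_Om mVN.
- exact: measurable_sqr_EFin.
- by apply: filterS2 (ae_fst Pr (Vstar_eq_Vh hH)) VNVt => z -> -> _.
Qed.

End algorithm_analysis.

Theorem theorem4 (R : realType) (nrm : R -> R -> R) (nrm_norm : is_norm2 nrm) :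
  exists C : R, 0 < C /\
  forall (dS dA dE dO : measure_display)
    (S : measurableType dS) (A : measurableType dA) (E : measurableType dE)
    (Omega : measurableType dO)
    (M : mdp S A R) (K N : nat) (D : regression S R K)
    (rhoS : S -> S -> R) (rhoA : A -> A -> R)
    (PE : probability E R) (kap : nat -> S * A * E -> S)
    (Pr : probability Omega R)
    (X : nat -> 'I_N -> {RV Pr >-> S}) (eps : nat -> 'I_N -> {RV Pr >-> E})
    (LK Rmax LR LamK LgK vrho : R),
  (0 < K)%N -> (0 < N)%N ->
  is_metric rhoS -> is_metric rhoA ->
  0 <= LK -> 0 <= LR -> 0 <= vrho ->
  bellman_equation M D ->
  random_map_representation M PE kap ->
  lipschitz_random_map M nrm rhoS rhoA kap LK ->
  bounded_lipschitz_rewards M rhoS Rmax LR ->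
  basis_conditions M D rhoS LamK LgK ->
  transitions_dominated M D ->
  (Rfrak_max M D < +oo)%E ->
  second_moment_bound M D vrho ->
  independent_samples M D X eps PE ->
  let Vmax := Ltilde M Rmax 0 in
  let LVK := LR + Vmax * LamK * LgK * Num.sqrt K%:R in
  forall h : nat, (h <= horizon M)%N ->
  ('N[ref D h \x Pr]_2%:E
      [(fun z => (Vstar M h z.1 - VN M D Rmax X eps kap h z)%:E)]
   <= C%:E * Rfrak_max M D *
      (((horizon M - h)%:R * vrho * LamK)%:E *
         ((LVK * LK)%:E * dudley rhoA + (LVK * LK)%:E * diameter rhoA
          + Vmax%:E) * (Num.sqrt (K%:R / N%:R))%:E
       + \sum_(h <= l < horizon M) approx_error M D Rmax l))%E.
Proof.
have n0 : 0 <= nrm 0 1 := nA_ge0 nrm_norm.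
exists (48 * (1 + nrm 0 1)); split; first by rewrite mulr_gt0// ltr_wpDr.
move=> dS dA dE dO S A E Omega M K N D rhoS rhoA PE kap Pr X eps LK Rmax LR LamK
  LgK vrho K0 N0 metricS metricA LK0 LR0 vrho0 bellman rmr lrm blr bc dom Rfin
  moment indep Vmax LVK h hH.
have [rho rhoE] : exists rho, Rfrak_max M D = rho%:E.
  by have := Rfrak_max_ge1 dom; move: Rfin; case: Rfrak_max => [r| |]//; exists r.
have rho1 : 1 <= rho by rewrite -lee_fin -rhoE; exact: Rfrak_max_ge1 dom.
have rho0 : 0 <= rho by exact: le_trans rho1.
set C := 48 * (1 + nrm 0 1).
have C1 : 1 <= C by rewrite /C; lra.
have Lam_gt0 := LamK_gt0 bc K0.
have vrho_gt0 := second_moment_gt0 bc K0 vrho0 moment.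
have Vmax0 : 0 <= Vmax := Ltilde_ge0 blr 0.
have LL0 : 0 <= LVK * LK by rewrite mulr_ge0//; exact: LVK_ge0 LR0 blr bc.
have sKN : 0 < Num.sqrt (K%:R / N%:R) :> R by rewrite sqrtr_gt0 divr_gt0// ltr0n.
have dud0 : (0 <= dudley rhoA)%E by apply: integral_ge0 => u _; exact: sqrte_ge0.
have diam0 : (0 <= diameter rhoA)%E.
  by apply: le_trans (le_diameter rhoA point point); rewrite lee_fin metric_ge0.
have approx0 l : (0 <= approx_error M D Rmax l)%E.
  by apply: le_ereal_sup_tmp; eexists; first (by exists (fun=> 0)); exact: sqrte_ge0.
set T := ((LVK * LK)%:E * dudley rhoA + (LVK * LK)%:E * diameter rhoA)%E.
have T0 : (0 <= T)%E by rewrite adde_ge0// mule_ge0.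
set B := (\sum_(h <= l < horizon M) approx_error M D Rmax l)%E.
have B0 : (0 <= B)%E by exact: sume_ge0.
pose p : R := (horizon M - h)%:R * vrho * LamK.
have p_ge0 : 0 <= p by rewrite !mulr_ge0// ltW.
have stat0 : (0 <= p%:E * (T + Vmax%:E) * (Num.sqrt (K%:R / N%:R))%:E)%E.
  by rewrite mule_ge0 ?lee_fin ?(ltW sKN)// mule_ge0 ?lee_fin// adde_ge0 ?lee_fin.
have q0 : 0 < C * rho by rewrite mulr_gt0//; lra.
(* At the horizon both sides are the terminal reward. *)
have [hE|hltH] : h = horizon M \/ (h < horizon M)%N.
  by move: hH; rewrite leq_eqVlt => /predU1P[|]; [left|right].
  rewrite (Lnorm2 (ref D h \x Pr)%E (fun z => Vstar M h z.1 - VN M D Rmax X eps kap h z)).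
  have gap0 z : Vstar M h z.1 - VN M D Rmax X eps kap h z = 0.
    by rewrite /VN hE subnn Vstar_terminal subrr.
  rewrite (eq_integral (cst 0%E)) => [|z _]; last by rewrite gap0 expr0n.
  rewrite integral0 /= sqrtr0 rhoE mule_ge0//; last exact: adde_ge0.
  by rewrite lee_fin ltW.
have p0 : 0 < p by rewrite !mulr_gt0// ltr0n subn_gt0.
have rhs_top : (p%:E * (T + Vmax%:E) * (Num.sqrt (K%:R / N%:R))%:E + B = +oo)%E ->
    (C%:E * Rfrak_max M D * (p%:E * (T + Vmax%:E) * (Num.sqrt (K%:R / N%:R))%:E + B)
     = +oo)%E.
  by move=> ->; rewrite rhoE -EFinM gt0_muley// lte_fin.
(* An infinite entropy, diameter or approximation error makes the bound infinite. *)
have [Ttop|Tfin] := eqVneq T +oo%E.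
  rewrite rhs_top ?leey// Ttop addye// gt0_muley ?lte_fin// gt0_mulye ?lte_fin//.
  by rewrite addye// -ltNye (lt_le_trans _ B0).
have [Btop|Bfin] := eqVneq B +oo%E.
  by rewrite rhs_top ?leey// Btop addey// -ltNye (lt_le_trans _ stat0).
have [t tE] : exists t, T = t%:E by move: T0 Tfin; case: (T) => [t| |]//; exists t.
pose ex l := fine (approx_error M D Rmax l).
have exE l : (h <= l < horizon M)%N -> approx_error M D Rmax l = (ex l)%:E.
  move=> hl; rewrite fineK// ge0_fin_numE//.
  have Blt : (B < +oo)%E by rewrite ltey.
  apply: le_lt_trans Blt; rewrite /B (bigD1_seq l) ?iota_uniq ?mem_index_iota//=.
  by rewrite leeDl// sume_ge0.
have BE : B = (\sum_(h <= l < horizon M) ex l)%:E.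
  by rewrite -sumEFin; apply: eq_big_nat => l hl; exact: exE.
have t0 : 0 <= t by rewrite -lee_fin -tE.
have [c Hc] := exists_skeleton nrm_norm metricA LK0 LR0 blr bc bellman tE.
have noise l (lH : (l < horizon M)%N) := noise_envelope nrm_norm N0 metricS metricA
  LK0 LR0 rmr lrm blr bc indep c lH tE.
have approx l : (h <= l < horizon M)%N ->
    0 <= ex l /\ (approx_error M D Rmax l <= (ex l)%:E)%E.
  by move=> hl; rewrite fine_ge0//; split => //; rewrite exE.
have := Lnorm_error nrm_norm N0 metricS metricA LR0 rmr lrm blr bc dom indep bellman
  (fun h hH a => (Hc h hH a).1) (fun h hH a => (Hc h hH a).2) vrho0 moment rhoE
  noise hH approx.
move=> /le_trans; apply.
rewrite tE BE rhoE -!(EFinM, EFinD) lee_fin.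
rewrite big_split/= sumr_const_nat -[(vrho * _) *+ _]mulr_natl.
rewrite [C * rho]mulrC -[leRHS]mulrA ler_wpM2l// addrC [leRHS]mulrDr.
have s0 : 0 <= \sum_(h <= l < horizon M) ex l.
  by rewrite big_nat; apply: sumr_ge0 => l hl; exact: (approx l hl).1.
apply: lerD; last by rewrite ler_peMl.
rewrite sqrtrM// sqrtrV// -/Vmax /nA -/C le_eqVlt; apply/orP; left; apply/eqP; ring.
Qed.
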